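(* Fix an integer $p\geq 3$ and $(\beta,h)\in(0,\infty)^2$, and let $\bm X=(X_1,\ldots,X_N)$ be a sample from the $p$-spin Curie-Weiss model $\mathbb{P}_{\beta,h,p}$ (defined in the context), with magnetization $S_N=\sum_{i=1}^N X_i$. Then there exists a constant $C>0$ such that the following hold. \begin{enumerate} \item If $(\beta,h)$ is $p$-regular, with $m_*$ the unique global maximizer of $H=H_{\beta,h,p}$, then for each $r\in\{0,1\}$, $$\frac{\mathbb{P}\left((-1)^r \frac{S_N-Nm_*}{\sqrt{-N/H''(m_* )}}>x\right)}{1-\Phi(x)} = 1 + (1+ x^3)\, O\left(\frac{1}{\sqrt{N}}\right)$$ for all $x\in [0,CN^{1/6}]$. \item If $(\beta,h)$ is $p$-critical, then for any global maximizer $m$ of $H$, any neighborhood $A$ of $m$ whose closure contains no other global maximizer of $H$, and each $r\in\{0,1\}$, $$\frac{\mathbb{P}\left((-1)^r \frac{S_N-Nm}{\sqrt{-N/H''(m)}}>x\,\Big|\,\frac{S_N}{N}\in A\right)}{1-\Phi(x)} = 1 + (1+ x^3)\, O\left(\frac{1}{\sqrt{N}}\right)$$ for all $x\in [0,CN^{1/6}]$. \item If $(\beta,h)$ is $p$-special, with $m_*$ the unique global maximizer of $H$, then for each $r\in\{0,1\}$, $$\frac{\mathbb{P}\left((-1)^r\frac{S_N-Nm_*}{N^{3/4}}>x\right)}{1-F(x)} = 1 + (1+ x^{5})\, O\left(\frac{1}{N^{1/4}}\right)$$ for all $x\in [0,CN^{1/20}]$, where $F$ is the distribution function with Lebesgue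 density $$\frac{\mathrm dF(x)}{\mathrm dx} = \frac{2}{\Gamma(1/4)}\left(-\frac{H^{(4)}(m_* )}{24}\right)^{1/4}\exp\left(\frac{H^{(4)}(m_* )}{24} x^4\right),\quad x\in\mathbb{R},$$ and $H^{(4)}$ denotes the fourth derivative of $H$. \end{enumerate}
   Context: For $p\geq 2$, $\beta>0$, $h>0$, the $p$-spin Curie-Weiss model is the probability measure on $\{-1,1\}^N$ given by $$\mathbb{P}_{\beta,h,p}(\bm X) = \frac{\exp\left\{\beta N^{1-p}\sum_{1\leq i_1,\ldots,i_p\leq N} X_{i_1}\cdots X_{i_p} + h\sum_{i=1}^N X_i\right\}}{2^N Z_N(\beta,h,p)},$$ with $Z_N(\beta,h,p)$ the normalizing constant. Let $I(x)=\frac12\{(1+x)\log(1+x)+(1-x)\log(1-x)\}$ and $H(x)=H_{\beta,h,p}(x)=\beta x^p+hx-I(x)$ for $x\in[-1,1]$. A global maximizer of $H$ is a point of $[-1,1]$ at which $H$ attains its maximum over $[-1,1]$ (such points lie in $(-1,1)$). The point $(\beta,h)$ is called $p$-regular if $H$ has a unique global maximizer $m_*\in(-1,1)$ and $H''(m_* )<0$; $p$-special if $H$ has a unique global maximizer $m_*\in(-1,1)$ and $H''(m_* )=0$; and $p$-critical if $H$ has more than one global maximizer. $\Phi$ is the standard normal distribution function. The $O(\cdot)$ terms are uniform in $x$ over the stated ranges, with constants not depending on $N$ or $x$. *)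

(* Defs.v *)
From Stdlib Require Import Reals List ClassicalEpsilon.
From Coquelicot Require Import Coquelicot.
Import ListNotations.
Open Scope R_scope.

Definition lsum {A : Type} (f : A -> R) (l : list A) : R :=
  fold_right (fun a acc => f a + acc) 0 l.
Definition lprod {A : Type} (f : A -> R) (l : list A) : R :=
  fold_right (fun a acc => f a * acc) 1 l.

Fixpoint configs (N : nat) : list (list R) :=
  match N with
  | O => [ [] ]
  | S n => flat_map (fun c => [1 :: c; (-1) :: c]) (configs n)
  end.

Fixpoint idx_tuples (p N : nat) : list (list nat) :=
  match p with
  | O => [ [] ]
  | S q => flat_map (fun t => map (fun i => i :: t) (seq 0 N)) (idx_tuples q N)
  end.

Definition magn (X : list R) : R := lsum (fun v => v) X.

(* Unnormalized Gibbs weight of the p-spin Curie-Weiss model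
   exp{ beta N^{1-p} sum_{1<=i_1,..,i_p<=N} X_{i_1}...X_{i_p} + h sum_i X_i }.
   (The factor 2^{-N} and Z_N cancel in probabilities.) *)
Definition cw_weight (beta h : R) (p N : nat) (X : list R) : R :=
  exp (beta / (INR N) ^ (p - 1)
         * lsum (fun t => lprod (fun i => nth i X 0) t) (idx_tuples p N)
       + h * magn X).

Definition cw_prob (beta h : R) (p N : nat) (E : list R -> Prop) : R :=
  lsum (fun X => if excluded_middle_informative (E X) then cw_weight beta h p N X else 0)
       (configs N)
  / lsum (cw_weight beta h p N) (configs N).

Definition cw_cond_prob (beta h : R) (p N : nat) (E B : list R -> Prop) : R :=
  cw_prob beta h p N (fun X => E X /\ B X) / cw_prob beta h p N B.

(* I(x) = 1/2 {(1+x)log(1+x) + (1-x)log(1-x)}; at x = +-1 Stdlib's ln 0 = 0 gives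
   the usual convention 0 log 0 = 0. *)
Definition Ient (x : R) : R :=
  / 2 * ((1 + x) * ln (1 + x) + (1 - x) * ln (1 - x)).

Definition Hfun (beta h : R) (p : nat) (x : R) : R :=
  beta * x ^ p + h * x - Ient x.

Definition is_global_max (beta h : R) (p : nat) (m : R) : Prop :=
  -1 <= m <= 1 /\ forall y, -1 <= y <= 1 -> Hfun beta h p y <= Hfun beta h p m.

(* k-th derivative of H (H is smooth on (-1,1), where all maximizers lie). *)
Definition Hder (beta h : R) (p k : nat) (x : R) : R := Derive_n (Hfun beta h p) k x.

Definition p_regular (beta h : R) (p : nat) : Prop :=
  exists m, (forall y, is_global_max beta h p y <-> y = m) /\ -1 < m < 1
            /\ Hder beta h p 2 m < 0.

Definition p_special (beta h : R) (p : nat) : Prop :=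
  exists m, (forall y, is_global_max beta h p y <-> y = m) /\ -1 < m < 1
            /\ Hder beta h p 2 m = 0.

Definition p_critical (beta h : R) (p : nat) : Prop :=
  exists m1 m2, m1 <> m2 /\ is_global_max beta h p m1 /\ is_global_max beta h p m2.

Definition Phi (x : R) : R :=
  RInt_gen (fun t => exp (- t ^ 2 / 2) / sqrt (2 * PI))
           (Rbar_locally m_infty) (at_point x).

Definition Gamma_fun (s : R) : R :=
  RInt_gen (fun t => Rpower t (s - 1) * exp (- t)) (at_right 0) (Rbar_locally p_infty).

Definition special_density (H4 : R) (x : R) : R :=
  2 / Gamma_fun (1 / 4) * Rpower (- H4 / 24) (1 / 4) * exp (H4 / 24 * x ^ 4).

Definition special_cdf (H4 : R) (x : R) : R :=
  RInt_gen (special_density H4) (Rbar_locally m_infty) (at_point x).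

Definition in_closure (A : R -> Prop) (y : R) : Prop :=
  forall eps, 0 < eps -> exists a, A a /\ Rabs (a - y) < eps.

Definition is_nbhd (A : R -> Prop) (m : R) : Prop :=
  exists eps, 0 < eps /\ forall y, Rabs (y - m) < eps -> A y.

(* Main.v *)
(* The probability that S_N = 2 j - N is proportional to C(N, j) exp (N g(u)), u = (2 j - N) / N,
   and by Stirling's formula to exp (N H(u)) / sqrt (1 - u^2) up to a factor 1 + O(1/N), uniformly
   for u near m; the Stirling constant cancels in probabilities. Let q = 2 (regular and critical
   case) or q = 4 (special case), N = th^(q (q + 1)) and u = m + s v / th^(q + 1). Taylor's
   formula turns the weight into exp (- c v^q) with relative error O((1 + v^(q+1)) / th^(q+1))
   as long as v <= M th, and the points beyond M th have total mass negligible against the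
   tail T(th), T(x) being the integral of exp (- c v^q) over [x, oo). The lattice sum over v > x
   is then compared cell by cell (mean value theorem) with T +- K / th^(q+1) V, where V is an
   explicit function with - V' >= (1 + v^(q+1)) exp (- c v^q) and V(x) = O((1 + x^(q+1)) T(x)).
   The case r = 1 follows by reflecting the configurations. A critical maximizer is nondegenerate
   because a degenerate one forces H to be strictly concave elsewhere on (0, 1). *)
Require Import Defs.
From Stdlib Require Import Reals Factorial List Lra Lia ClassicalEpsilon.
From Coquelicot Require Import Coquelicot.
Open Scope R_scope.

(** In the code q is [S r]. All errors must be relative to T(x), which at the end of the range is as
    small as exp (- const th^q); so the mass beyond M th has to be beaten by an exponential, not
    only by a power of N. The exponent q (q + 1) makes both scales integer powers of th: N (u - m)^q
    becomes s^q v^q, and the Taylor remainder N (u - m)^(q+1) becomes a multiple of v^(q+1) /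
    th^(q+1), which stays bounded as long as v = O(th). Thus th is the range of x (N^(1/6) or
    N^(1/20)), and th^(q+1) is the inverse of the error rate (N^(1/2) or N^(1/4)). The analysis is
    one-sided: only u >= m is treated, and the left half is the right half of the reflected model.
    The normalizing constant is never computed: the conditioning event is cut at m into two halves,
    each comparable with T(0), so that the probability is compared with T(x) / (2 T(0)). The value
    of T(0), a Gaussian or a Gamma integral, serves only to recognize Phi and F. *)

(** * Sums over configurations *)

Lemma lsum_app {A : Type} (f : A -> R) (l1 l2 : list A) :
  lsum f (l1 ++ l2) = lsum f l1 + lsum f l2.
Proof.
  unfold lsum; induction l1 as [|a l IH]; simpl; [ring|]. rewrite IH; ring.
Qed.

Lemma lsum_flat_map {A B : Type} (f : B -> R) (g : A -> list B) (l : list A) :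
  lsum f (flat_map g l) = lsum (fun a => lsum f (g a)) l.
Proof.
  induction l as [|a l IH]; [reflexivity|]. simpl. now rewrite lsum_app, IH.
Qed.

Lemma lsum_map {A B : Type} (f : B -> R) (g : A -> B) (l : list A) :
  lsum f (map g l) = lsum (fun a => f (g a)) l.
Proof. induction l as [|a l IH]; [reflexivity|]. simpl. now rewrite IH. Qed.

Lemma lsum_ext_in {A : Type} (f g : A -> R) (l : list A) :
  (forall a, In a l -> f a = g a) -> lsum f l = lsum g l.
Proof.
  induction l as [|a l IH]; intros E; [reflexivity|]. simpl.
  rewrite E by now left. rewrite IH; [reflexivity|]. intros b Hb; apply E; now right.
Qed.

Lemma lsum_scal {A : Type} (k : R) (f : A -> R) (l : list A) :
  lsum (fun a => k * f a) l = k * lsum f l.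
Proof. induction l as [|a l IH]; simpl; [ring|]. rewrite IH; ring. Qed.

Lemma lsum_nonneg {A : Type} (f : A -> R) (l : list A) :
  (forall a, 0 <= f a) -> 0 <= lsum f l.
Proof.
  intros Hf; induction l as [|a l IH]; simpl; [lra|]. specialize (Hf a). lra.
Qed.

Lemma configs_length (N : nat) (X : list R) : In X (configs N) -> length X = N.
Proof.
  revert X; induction N as [|N IH]; simpl; intros X HX.
  - destruct HX as [<-|[]]; reflexivity.
  - apply in_flat_map in HX. destruct HX as [Y [HY HX]].
    destruct HX as [<-|[<-|[]]]; simpl; f_equal; now apply IH.
Qed.

Lemma lsum_nth_seq (X : list R) : lsum (fun i => nth i X 0) (seq 0 (length X)) = magn X.
Proof.
  induction X as [|a X IH]; [reflexivity|].
  simpl. rewrite <- seq_shift, lsum_map. unfold magn in *. simpl. now rewrite IH.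
Qed.

(** The tuples may repeat indices, so the sum of products factors completely; this is what makes the
    Gibbs weight a function of the magnetization alone. *)
Lemma tuple_sum (p : nat) (X : list R) :
  lsum (fun t => lprod (fun i => nth i X 0) t) (idx_tuples p (length X)) = magn X ^ p.
Proof.
  induction p as [|p IH]; [simpl; ring|].
  simpl idx_tuples. rewrite lsum_flat_map.
  rewrite (lsum_ext_in _ (fun t => magn X * lprod (fun i => nth i X 0) t)).
  - rewrite (lsum_scal (magn X) (fun t => lprod (fun i => nth i X 0) t)), IH. simpl; ring.
  - intros t _. rewrite lsum_map, <- lsum_nth_seq, (Rmult_comm (lsum _ _)), <- lsum_scal.
    apply lsum_ext_in; intros i _. simpl. ring.
Qed.

Lemma cw_weight_magn (beta h : R) (p N : nat) (X : list R) :
  (1 <= p)%nat -> (1 <= N)%nat -> In X (configs N) ->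
  cw_weight beta h p N X =
  exp (INR N * (beta * (magn X / INR N) ^ p + h * (magn X / INR N))).
Proof.
  intros Hp HN HX. apply configs_length in HX. subst N.
  unfold cw_weight. rewrite tuple_sum. f_equal.
  assert (HN0 : INR (length X) <> 0) by (apply not_0_INR; lia).
  destruct p as [|p]; [lia|]. replace (S p - 1)%nat with p by lia.
  unfold Rdiv. rewrite Rpow_mult_distr, pow_inv. simpl. field. split; [exact HN0|].
  now apply pow_nonzero.
Qed.

(** Spin flip symmetry. No permutation of the list is needed: quantifying over [F] lets the
    induction absorb one spin into the function y -> F (1 + y) + F (-1 + y). *)
Lemma configs_reflect (N : nat) (F : R -> R) :
  lsum (fun X => F (magn X)) (configs N) = lsum (fun X => F (- magn X)) (configs N).
Proof.
  revert F; induction N as [|N IH]; intros F.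
  - unfold magn; simpl. now rewrite Ropp_0.
  - simpl configs. rewrite !lsum_flat_map. unfold magn; simpl. fold magn.
    change (lsum (fun X => (fun y => F (1 + y) + (F (-1 + y) + 0)) (magn X)) (configs N)
      = lsum (fun a : list R => F (- (1 + magn a)) + (F (- (-1 + magn a)) + 0)) (configs N)).
    rewrite IH. apply lsum_ext_in; intros X _.
    replace (- (1 + magn X)) with (-1 + - magn X) by ring.
    replace (- (-1 + magn X)) with (1 + - magn X) by ring. ring.
Qed.

(** Pascal's rule in summed form: a new spin either keeps the number j of plus spins or raises it by
    one. *)
Lemma sum_binomial_step (N : nat) (G : nat -> R) :
  sum_f_R0 (fun j => Binomial.C (S N) j * G j) (S N) =
  sum_f_R0 (fun j => Binomial.C N j * (G j + G (S j))) N.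
Proof.
  rewrite (sum_eq (fun j => Binomial.C N j * (G j + G (S j)))
             (fun j => Binomial.C N j * G j + Binomial.C N j * G (S j)))
    by (intros; ring).
  rewrite sum_plus.
  destruct N as [|N].
  { simpl. unfold Binomial.C; simpl; field. }
  rewrite (decomp_sum _ (S (S N))) by lia. simpl pred.
  rewrite (decomp_sum (fun j => Binomial.C (S N) j * G j)) by lia. simpl pred.
  rewrite !tech5.
  rewrite (sum_eq (fun i => Binomial.C (S (S N)) (S i) * G (S i))
             (fun i => Binomial.C (S N) i * G (S i) + Binomial.C (S N) (S i) * G (S i))).
  2:{ intros i Hi. rewrite <- pascal by lia. ring. }
  rewrite sum_plus.
  replace (Binomial.C (S (S N)) 0) with 1 by (rewrite C_n_0; reflexivity).
  replace (Binomial.C (S N) 0) with 1 by (rewrite C_n_0; reflexivity).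
  replace (Binomial.C (S (S N)) (S (S N))) with 1 by (rewrite C_n_n; reflexivity).
  replace (Binomial.C (S N) (S N)) with 1 by (rewrite C_n_n; reflexivity).
  ring.
Qed.

Lemma configs_binomial (N : nat) (F : R -> R) :
  lsum (fun X => F (magn X)) (configs N) =
  sum_f_R0 (fun j => Binomial.C N j * F (2 * INR j - INR N)) N.
Proof.
  revert F; induction N as [|N IH]; intros F.
  - unfold magn; simpl. unfold Binomial.C; simpl.
    replace (2 * 0 - 0) with 0 by ring. field.
  - simpl configs. rewrite !lsum_flat_map. unfold magn; simpl. fold magn.
    change (lsum (fun X => (fun y => F (1 + y) + (F (-1 + y) + 0)) (magn X)) (configs N)
      = sum_f_R0 (fun j : nat => Binomial.C (S N) j * (fun j => F (2 * INR j - INR (S N))) j) (S N)).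
    rewrite IH, sum_binomial_step. apply sum_eq; intros j Hj.
    rewrite !S_INR. f_equal.
    replace (2 * INR j - (INR N + 1)) with (-1 + (2 * INR j - INR N)) by ring.
    replace (2 * (INR j + 1) - (INR N + 1)) with (1 + (2 * INR j - INR N)) by ring.
    ring.
Qed.

(** * Stirling's formula *)

Lemma nonneg_of_derive (f df : R -> R) (a b : R) :
  a <= b -> 0 <= f a -> (forall x, a <= x <= b -> is_derive f x (df x)) ->
  (forall x, a <= x <= b -> 0 <= df x) -> 0 <= f b.
Proof.
  intros [Hab | <-] Ha Hd Hp; [|exact Ha].
  destruct (MVT_cor2 f df a b Hab) as [c [E Hc]].
  - intros c Hc. apply is_derive_Reals. now apply Hd.
  - assert (0 <= df c) by (apply Hp; lra). nra.
Qed.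

(** At t = 1/n this reads (n + 1/2) ln (1 + 1/n) >= 1, which is the monotonicity of [stirling]. *)
Lemma ln_1p_lower (t : R) : 0 <= t -> 2 * t / (2 + t) <= ln (1 + t).
Proof.
  intros Ht.
  assert (0 <= ln (1 + t) - 2 * t / (2 + t)); [|lra].
  apply (nonneg_of_derive (fun t => ln (1 + t) - 2 * t / (2 + t))
           (fun t => t ^ 2 / ((1 + t) * (2 + t) ^ 2)) 0); [lra| | |].
  - rewrite Rplus_0_r, ln_1. lra.
  - intros x Hx. auto_derive; [lra|]. field. lra.
  - intros x Hx. apply Rmult_le_pos; [nra|]. left. apply Rinv_0_lt_compat.
    apply Rmult_lt_0_compat; [lra|nra].
Qed.

Lemma ln_1p_upper (t : R) : 0 <= t -> ln (1 + t) <= t - t ^ 2 / 2 + t ^ 3 / 3.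
Proof.
  intros Ht.
  assert (0 <= t - t ^ 2 / 2 + t ^ 3 / 3 - ln (1 + t)); [|lra].
  apply (nonneg_of_derive (fun t => t - t ^ 2 / 2 + t ^ 3 / 3 - ln (1 + t))
           (fun t => t ^ 3 / (1 + t)) 0); [lra| | |].
  - rewrite Rplus_0_r, ln_1. lra.
  - intros x Hx. auto_derive; [lra|]. field. lra.
  - intros x Hx. apply Rmult_le_pos; [apply pow_le; lra|]. left. apply Rinv_0_lt_compat. lra.
Qed.

(* The logarithm of n! minus its Stirling main term, up to the constant 1/2 ln (2 pi):
   only differences of its values matter, as all probabilities are quotients. *)
Definition stirling (n : nat) : R :=
  ln (INR (fact n)) - (INR n + / 2) * ln (INR n) + INR n.

(** The difference is (n + 1/2) ln (1 + 1/n) - 1, of order 1 / (12 n^2). The weaker bound 1/n -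
    1/(n+1) is chosen because it telescopes in [stirling_diff]. *)
Lemma stirling_step (n : nat) : (1 <= n)%nat ->
  0 <= stirling n - stirling (S n) <= / INR n - / INR (S n).
Proof.
  intros Hn. assert (H1 : 1 <= INR n) by (apply (le_INR 1); lia).
  assert (Hf : 0 < INR (fact n)) by (apply lt_0_INR, lt_O_fact).
  unfold stirling. rewrite fact_simpl, mult_INR, S_INR, ln_mult by lra.
  set (x := INR n) in *.
  assert (E : ln (x + 1) = ln x + ln (1 + / x)).
  { rewrite <- ln_mult.
    - f_equal. field. lra.
    - lra.
    - assert (0 < / x) by (apply Rinv_0_lt_compat; lra). lra. }
  rewrite E.
  set (L := ln (1 + / x)).
  assert (Hx : 0 < / x <= 1).
  { split; [apply Rinv_0_lt_compat; lra|]. rewrite <- Rinv_1. apply Rinv_le_contravar; lra. }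
  assert (HL := ln_1p_lower (/ x) ltac:(lra)).
  assert (HU := ln_1p_upper (/ x) ltac:(lra)).
  fold L in HL, HU.
  replace (ln (INR (fact n)) - (x + / 2) * ln x + x -
    (ln x + L + ln (INR (fact n)) - (x + 1 + / 2) * (ln x + L) + (x + 1)))
    with ((x + / 2) * L - 1) by field.
  split.
  - assert (2 * / x / (2 + / x) = / (x + / 2)) as E1 by (field; lra).
    rewrite E1 in HL. apply (Rmult_le_compat_l (x + / 2)) in HL; [|lra].
    rewrite Rinv_r in HL by lra. lra.
  - apply (Rmult_le_compat_l (x + / 2)) in HU; [|lra].
    apply Rle_trans with ((x + / 2) * (/ x - (/ x) ^ 2 / 2 + (/ x) ^ 3 / 3) - 1); [lra|].
    apply Rminus_le_0.
    replace (/ x - / (x + 1) - ((x + / 2) * (/ x - (/ x) ^ 2 / 2 + (/ x) ^ 3 / 3) - 1))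
      with ((11 * x ^ 2 - 3 * x - 2) / (12 * x ^ 3 * (x + 1))) by (field; lra).
    apply Rmult_le_pos; [nra|]. left. apply Rinv_0_lt_compat.
    apply Rmult_lt_0_compat; [|lra]. assert (0 < x ^ 3) by (apply pow_lt; lra). lra.
Qed.

Lemma stirling_diff (j N : nat) : (1 <= j <= N)%nat ->
  0 <= stirling j - stirling N <= / INR j.
Proof.
  intros [Hj HN].
  assert (H : 0 <= stirling j - stirling N <= / INR j - / INR N).
  { induction HN as [|N HN IH]; [lra|].
    assert (S1 := stirling_step N ltac:(lia)). lra. }
  assert (0 < / INR N) by (apply Rinv_0_lt_compat, lt_0_INR; lia). lra.
Qed.

(** An identity, not an estimate: the whole error of Stirling's formula sits in the three [stirling]
    terms. *)
Lemma binomial_stirling (N j : nat) (u : R) : (0 < j < N)%nat ->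
  u = (2 * INR j - INR N) / INR N ->
  Binomial.C N j =
  exp (INR N * ln 2 - INR N * Ient u - / 2 * ln (INR N) + ln 2 - / 2 * ln (1 - u ^ 2)
       + (stirling N - stirling j - stirling (N - j))).
Proof.
  intros [Hj HN] ->.
  assert (Hj0 : 0 < INR j) by (apply lt_0_INR; lia).
  assert (HN0 : 0 < INR N) by (apply lt_0_INR; lia).
  assert (Hk0 : 0 < INR (N - j)) by (apply lt_0_INR; lia).
  assert (F : forall n, 0 < INR (fact n)) by (intros; apply lt_0_INR, lt_O_fact).
  unfold Binomial.C. rewrite <- (exp_ln (INR (fact N) / _)).
  2:{ apply Rdiv_lt_0_compat; [apply F|]. apply Rmult_lt_0_compat; apply F. }
  f_equal. rewrite ln_div, ln_mult by (try apply Rmult_lt_0_compat; apply F).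
  unfold stirling, Ient.
  assert (Ek : INR (N - j) = INR N - INR j) by (apply minus_INR; lia).
  set (k := INR (N - j)) in *. set (a := INR j) in *. set (n := INR N) in *.
  replace (1 + (2 * a - n) / n) with (2 * a / n) by (field; lra).
  replace (1 - (2 * a - n) / n) with (2 * k / n) by (rewrite Ek; field; lra).
  replace (1 - ((2 * a - n) / n) ^ 2) with ((2 * a / n) * (2 * k / n)) by (rewrite Ek; field; lra).
  rewrite (ln_mult (2 * a / n) (2 * k / n)) by (apply Rdiv_lt_0_compat; lra).
  rewrite !ln_div, !ln_mult by lra.
  replace n with (a + k) at 3 5 7 9 11 12 13 14 15 by (rewrite Ek; ring).
  rewrite Ek. field. lra.
Qed.

Lemma pow_exp_ln (x : R) (n : nat) : 0 <= x -> (x = 0 -> n = 0%nat) -> x ^ n = exp (INR n * ln x).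
Proof.
  intros [Hx|<-] H0.
  - rewrite <- Rpower_pow by exact Hx. reflexivity.
  - rewrite H0 by reflexivity. simpl. now rewrite Rmult_0_l, exp_0.
Qed.

Lemma binomial_nonneg (N j : nat) : 0 <= Binomial.C N j.
Proof.
  unfold Binomial.C. apply Rmult_le_pos; [apply pos_INR|]. left.
  apply Rinv_0_lt_compat, Rmult_lt_0_compat; apply lt_0_INR, lt_O_fact.
Qed.

Lemma sum_term_le (f : nat -> R) (N j : nat) :
  (forall i, 0 <= f i) -> (j <= N)%nat -> f j <= sum_f_R0 f N.
Proof.
  intros Hf Hj. induction Hj as [|N Hj IH].
  - destruct j as [|j]; simpl; [lra|].
    assert (0 <= sum_f_R0 f j) by (apply cond_pos_sum; exact Hf). lra.
  - simpl. specialize (Hf (S N)). lra.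
Qed.

(* A single term of the binomial expansion of (a + (1 - a))^N at a = j/N is at most 1. *)
Lemma binomial_entropy_bound (N j : nat) (u : R) : (1 <= N)%nat -> (j <= N)%nat ->
  u = (2 * INR j - INR N) / INR N ->
  Binomial.C N j <= exp (INR N * ln 2 - INR N * Ient u).
Proof.
  intros HN Hj ->.
  assert (HN0 : 0 < INR N) by (apply lt_0_INR; lia).
  assert (Hj0 : 0 <= INR j) by apply pos_INR.
  assert (Ek : INR (N - j) = INR N - INR j) by (apply minus_INR; lia).
  assert (Hk0 : 0 <= INR (N - j)) by apply pos_INR.
  set (a := INR j / INR N). set (b := INR (N - j) / INR N).
  assert (Ha : 0 <= a) by (apply Rdiv_le_0_compat; lra).
  assert (Hb : 0 <= b) by (apply Rdiv_le_0_compat; lra).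
  assert (Hab : a + b = 1) by (unfold a, b; rewrite Ek; field; lra).
  assert (T : Binomial.C N j * a ^ j * b ^ (N - j) <= 1).
  { rewrite <- (pow1 N), <- Hab, binomial.
    apply (sum_term_le (fun i => Binomial.C N i * a ^ i * b ^ (N - i)) N j); [|exact Hj].
    intros i. apply Rmult_le_pos; [|now apply pow_le].
    apply Rmult_le_pos; [apply binomial_nonneg|now apply pow_le]. }
  assert (Za : a = 0 -> j = 0%nat).
  { unfold a; intros E. apply INR_eq. simpl.
    apply (f_equal (fun z => z * INR N)) in E. field_simplify in E; lra. }
  assert (Zb : b = 0 -> (N - j = 0)%nat).
  { unfold b; intros E. apply INR_eq. simpl.
    apply (f_equal (fun z => z * INR N)) in E. field_simplify in E; lra. }
  rewrite (pow_exp_ln a j Ha Za), (pow_exp_ln b (N - j) Hb Zb) in T.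
  rewrite Rmult_assoc, <- exp_plus in T.
  apply (Rmult_le_reg_r (exp (INR j * ln a + INR (N - j) * ln b))); [apply exp_pos|].
  eapply Rle_trans; [exact T|]. rewrite <- exp_plus, <- exp_0. right. f_equal.
  unfold Ient.
  replace (1 + (2 * INR j - INR N) / INR N) with (2 * a) by (unfold a; field; lra).
  replace (1 - (2 * INR j - INR N) / INR N) with (2 * b) by (unfold b; rewrite Ek; field; lra).
  (* At z = 0, which occurs for j = 0 and j = N, the factor z makes both sides vanish whatever value
     [ln] takes there. *)
  assert (L2 : forall z, 0 <= z -> 2 * z * ln (2 * z) = 2 * z * (ln 2 + ln z)).
  { intros z [Hz|<-]; [|ring]. now rewrite ln_mult by lra. }
  rewrite (L2 a Ha), (L2 b Hb).
  replace (INR j) with (a * INR N) by (unfold a; field; lra).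
  replace (INR (N - j)) with (b * INR N) by (unfold b; field; lra).
  replace b with (1 - a) by lra. field.
Qed.

(** * Tails of exp (- c y^q) *)

Definition epow (c : R) (q : nat) (y : R) : R := exp (- (c * y ^ q)).

(** The integral of [epow c q] over [y, oo), described by its derivative and its limit, so that
    every estimate is an application of the mean value theorem and no improper integral appears. *)
Definition is_tail (c : R) (q : nat) (T : R -> R) : Prop :=
  (forall y, is_derive T y (- epow c q y)) /\ is_lim T p_infty 0.

Lemma epow_pos (c : R) (q : nat) (y : R) : 0 < epow c q y.
Proof. apply exp_pos. Qed.

Lemma epow_derive (c : R) (r : nat) (y : R) :
  is_derive (epow c (S r)) y (- (c * INR (S r) * y ^ r) * epow c (S r) y).
Proof. unfold epow. auto_derive; [trivial|].
  change (match r with 0%nat => 1 | S _ => INR r + 1 end) with (INR (S r)). simpl pow. ring. Qed.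

Lemma epow_continuous (c : R) (q : nat) (y : R) : continuous (epow c q) y.
Proof.
  apply (ex_derive_continuous (epow c q)). unfold epow. auto_derive. trivial.
Qed.

Lemma exp_le (x y : R) : x <= y -> exp x <= exp y.
Proof. intros [H|<-]; [left; now apply exp_increasing|lra]. Qed.

Lemma epow_decr (c : R) (q : nat) (x y : R) : 0 <= c -> 0 <= x <= y -> epow c q y <= epow c q x.
Proof.
  intros Hc H. apply exp_le, Ropp_le_contravar, Rmult_le_compat_l; [exact Hc|].
  now apply pow_incr.
Qed.

Lemma is_derive_mvt (f df : R -> R) (a b : R) : a < b ->
  (forall x, a <= x <= b -> is_derive f x (df x)) ->
  exists y, a < y < b /\ f b - f a = df y * (b - a).
Proof.
  intros Hab Hd. destruct (MVT_cor2 f df a b Hab) as [y [E Hy]].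
  - intros y Hy. apply is_derive_Reals. now apply Hd.
  - now exists y.
Qed.

(** Comparison at infinity: applied to a difference of two functions vanishing at infinity, it turns
    an inequality between their derivatives into the reverse inequality between the functions. *)
Lemma decr_lim_nonneg (f df : R -> R) (a : R) :
  (forall x, a <= x -> is_derive f x (df x)) -> (forall x, a <= x -> df x <= 0) ->
  is_lim f p_infty 0 -> 0 <= f a.
Proof.
  intros Hd Hn Hl. destruct (Rle_lt_dec 0 (f a)) as [H|H]; [exact H|exfalso].
  apply (is_lim_spec f p_infty 0) in Hl. specialize (Hl (mkposreal (- f a) ltac:(lra))).
  destruct Hl as [M HM]. simpl in HM.
  set (y := Rmax a M + 1).
  assert (Ha : a < y) by (assert (H1 := Rmax_l a M); unfold y; lra).
  assert (HMy : M < y) by (assert (H1 := Rmax_r a M); unfold y; lra).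
  specialize (HM y HMy).
  destruct (is_derive_mvt f df a y Ha) as [z [Hz E]]; [intros; apply Hd; lra|].
  assert (df z <= 0) by (apply Hn; lra).
  rewrite Rminus_0_r in HM. apply Rabs_def2 in HM. nra.
Qed.

Lemma tail_decr (c : R) (q : nat) (T : R -> R) (x y : R) :
  is_tail c q T -> x <= y -> T y <= T x.
Proof.
  intros [Hd _] [H|<-]; [|lra].
  destruct (is_derive_mvt T _ x y H (fun z _ => Hd z)) as [z [Hz E]].
  assert (P := epow_pos c q z). nra.
Qed.

Lemma tail_step (c : R) (q : nat) (T : R -> R) (x y : R) : 0 <= c ->
  is_tail c q T -> 0 <= x <= y ->
  (y - x) * epow c q y <= T x - T y <= (y - x) * epow c q x.
Proof.
  intros Hc [Hd _] [Hx [H|<-]]; [|lra].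
  destruct (is_derive_mvt T _ x y H (fun z _ => Hd z)) as [z [Hz E]].
  assert (P1 := epow_decr c q x z Hc ltac:(lra)).
  assert (P2 := epow_decr c q z y Hc ltac:(lra)).
  split; nra.
Qed.

Lemma tail_pos (c : R) (q : nat) (T : R -> R) (x : R) : is_tail c q T -> 0 < T x.
Proof.
  intros HT. assert (H0 : 0 <= T (x + 1)).
  { destruct HT as [Hd Hl]. apply (decr_lim_nonneg T (fun y => - epow c q y)); [auto| |exact Hl].
    intros y _. assert (P := epow_pos c q y). lra. }
  destruct HT as [Hd _].
  destruct (is_derive_mvt T _ x (x + 1) ltac:(lra) (fun z _ => Hd z)) as [z [Hz E]].
  assert (P := epow_pos c q z). nra.
Qed.

Lemma pow_diff_le (r : nat) (x y : R) : 0 <= x <= y ->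
  y ^ S r - x ^ S r <= INR (S r) * y ^ r * (y - x).
Proof.
  intros [Hx [H|<-]]; [|lra].
  destruct (is_derive_mvt (fun z => z ^ S r) (fun z => INR (S r) * z ^ r) x y H)
    as [z [Hz E]].
  - intros z Hz. auto_derive; [trivial|].
    change (match r with 0%nat => 1 | S _ => INR r + 1 end) with (INR (S r)). ring.
  - rewrite E. apply Rmult_le_compat_r; [lra|]. apply Rmult_le_compat_l; [apply pos_INR|].
    apply pow_incr. lra.
Qed.

(* Compare T x with the mass of an interval of length (1 + x)^-r, on which the density
   drops at most by the factor exp(- c (r + 1)). *)
Lemma tail_mills (c : R) (r : nat) (T : R -> R) (x : R) : 0 <= c -> 0 <= x ->
  is_tail c (S r) T -> epow c (S r) x <= exp (c * INR (S r)) * (1 + x) ^ r * T x.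
Proof.
  intros Hc Hx HT.
  assert (HD : 1 <= (1 + x) ^ r) by (apply pow_R1_Rle; lra).
  set (d := / (1 + x) ^ r).
  assert (Hd : 0 < d <= 1).
  { unfold d. split; [apply Rinv_0_lt_compat; lra|].
    apply Rle_trans with (/ 1); [apply Rinv_le_contravar; lra|lra]. }
  assert (S1 := tail_step c (S r) T x (x + d) Hc HT ltac:(lra)).
  assert (P := tail_pos c (S r) T (x + d) HT).
  replace (x + d - x) with d in S1 by ring.
  assert (B : epow c (S r) x <= exp (c * INR (S r)) * epow c (S r) (x + d)).
  { unfold epow. rewrite <- exp_plus. apply exp_le.
    assert (Q := pow_diff_le r x (x + d) ltac:(lra)).
    assert (Q2 : (x + d) ^ r * d <= 1).
    { apply Rle_trans with ((1 + x) ^ r * d).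
      - apply Rmult_le_compat_r; [lra|]. apply pow_incr; lra.
      - unfold d. rewrite Rinv_r by lra. lra. }
    assert (Hq : 0 <= INR (S r)) by apply pos_INR.
    replace (x + d - x) with d in Q by ring. rewrite Rmult_assoc in Q.
    assert ((x + d) ^ S r - x ^ S r <= INR (S r)) by nra.
    nra. }
  eapply Rle_trans; [exact B|]. rewrite Rmult_assoc.
  apply Rmult_le_compat_l; [left; apply exp_pos|].
  apply (Rmult_le_reg_l d); [lra|].
  replace (d * ((1 + x) ^ r * T x)) with (T x) by (unfold d; field; lra). lra.
Qed.

Lemma is_lim_epow (c : R) (q : nat) : 0 < c -> (1 <= q)%nat -> is_lim (epow c q) p_infty 0.
Proof.
  intros Hc Hq. apply (is_lim_spec (epow c q) p_infty 0). intros eps.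
  exists (Rmax 1 (/ (c * eps))). intros y Hy. simpl.
  assert (H1 := Rmax_l 1 (/ (c * eps))). assert (H2 := Rmax_r 1 (/ (c * eps))).
  rewrite Rminus_0_r, Rabs_pos_eq by (left; apply epow_pos).
  assert (He := cond_pos eps).
  assert (Hy1 : y <= y ^ q).
  { rewrite <- (pow_1 y) at 1. apply Rle_pow; [lra|lia]. }
  unfold epow. rewrite exp_Ropp.
  assert (E := exp_ineq1_le (c * y ^ q)).
  assert (Hce : 0 < c * eps) by nra.
  assert (G : / eps < exp (c * y ^ q)).
  { apply Rlt_le_trans with (c * y ^ q); [|lra].
    apply Rlt_le_trans with (c * y); [|nra].
    apply (Rmult_lt_reg_l (/ c)); [now apply Rinv_0_lt_compat|].
    rewrite <- Rmult_assoc, Rinv_l, Rmult_1_l by lra. rewrite <- Rinv_mult. lra. }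
  rewrite <- (Rinv_inv eps). apply Rinv_lt_contravar; [|exact G].
  apply Rmult_lt_0_compat; [now apply Rinv_0_lt_compat|apply exp_pos].
Qed.

(** The right side has derivative - y^r f, which for y >= 1 is at most the derivative - f of T, and
    both sides vanish at infinity. *)
Lemma tail_upper (c : R) (r : nat) (T : R -> R) (y : R) : 0 < c -> 1 <= y ->
  is_tail c (S r) T -> T y <= epow c (S r) y / (c * INR (S r)).
Proof.
  intros Hc Hy [Hd Hl].
  assert (Hq : 0 < INR (S r)) by (apply lt_0_INR; lia).
  assert (0 <= epow c (S r) y / (c * INR (S r)) - T y); [|lra].
  apply (decr_lim_nonneg (fun y => epow c (S r) y / (c * INR (S r)) - T y)
           (fun z => - (z ^ r) * epow c (S r) z - - epow c (S r) z)).
  - intros z Hz. apply (is_derive_minus (V := R_NormedModule)); [|apply Hd].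
    replace (- z ^ r * epow c (S r) z) with
      (/ (c * INR (S r)) * (- (c * INR (S r) * z ^ r) * epow c (S r) z)) by (field; lra).
    apply (is_derive_ext (fun z => / (c * INR (S r)) * epow c (S r) z)).
    { intros t. apply Rmult_comm. }
    apply is_derive_scal, epow_derive.
  - intros z Hz. assert (P := epow_pos c (S r) z).
    assert (1 <= z ^ r) by (apply pow_R1_Rle; lra). nra.
  - replace (Finite 0) with (Rbar_minus (Rbar_mult (/ (c * INR (S r))) 0) 0).
    2:{ simpl. f_equal. ring. }
    apply (is_lim_minus _ _ _ (Rbar_mult (/ (c * INR (S r))) 0) 0); [|exact Hl|reflexivity].
    apply (is_lim_ext (fun z => / (c * INR (S r)) * epow c (S r) z)).
    { intros t. apply Rmult_comm. }
    apply is_lim_scal_l. apply is_lim_epow; [exact Hc|lia].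
Qed.

(* The term D y^2 f makes - V' dominate y^(r+2) f without any estimate of T. *)
Definition moment_tail (c : R) (r : nat) (T : R -> R) (y : R) : R :=
  let D := 2 / (c * INR (S r)) in
  (1 + 2 * D * (2 * D + 1)) * T y + D * y ^ 2 * epow c (S r) y.

Lemma moment_tail_derive (c : R) (r : nat) (T : R -> R) : 0 < c -> (1 <= r)%nat ->
  is_tail c (S r) T -> exists dV : R -> R,
  (forall y, is_derive (moment_tail c r T) y (dV y)) /\
  (forall y, 0 <= y -> dV y <= - (1 + y ^ S (S r)) * epow c (S r) y).
Proof.
  intros Hc Hr [Hd _].
  assert (Hq : 0 < INR (S r)) by (apply lt_0_INR; lia).
  set (D := 2 / (c * INR (S r))).
  assert (HD : 0 < D) by (apply Rdiv_lt_0_compat; nra).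
  set (B := 1 + 2 * D * (2 * D + 1)).
  exists (fun y => B * - epow c (S r) y
    + (D * (2 * y) * epow c (S r) y + D * y ^ 2 * (- (c * INR (S r) * y ^ r) * epow c (S r) y))).
  split.
  - intros y. unfold moment_tail. fold D. cbv zeta. fold B.
    apply (is_derive_plus (V := R_NormedModule)).
    + apply is_derive_scal, Hd.
    + apply (is_derive_mult (K := R_AbsRing) (fun y => D * y ^ 2) (epow c (S r)));
        [|apply epow_derive|exact Rmult_comm].
      auto_derive; [trivial|]. simpl. ring.
  - intros y Hy. assert (P := epow_pos c (S r) y).
    replace (B * - epow c (S r) y
      + (D * (2 * y) * epow c (S r) y + D * y ^ 2 * (- (c * INR (S r) * y ^ r) * epow c (S r) y)))
      with (- (B - 2 * D * y + 2 * y ^ S (S r)) * epow c (S r) y).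
    2:{ unfold D. simpl pow. field. lra. }
    apply Rmult_le_compat_r; [lra|]. apply Ropp_le_contravar.
    (* The choice of D makes the derivative of D y^2 f equal to (2 D y - 2 y^(r+2)) f. One copy of
       y^(r+2) is the target; the other, or the constant in B when y <= 2 D + 1, absorbs the term 2
       D y. *)
    assert (2 * D * y <= 2 * D * (2 * D + 1) + y ^ S (S r)); [|unfold B; lra].
    destruct (Rle_lt_dec y (2 * D + 1)) as [H|H].
    + assert (0 <= y ^ S (S r)) by now apply pow_le. nra.
    + assert (y ^ 2 <= y ^ S (S r)) by (apply Rle_pow; [lra|lia]). nra.
Qed.

Lemma pow_1p_le (n : nat) (x : R) : 0 <= x -> (1 + x) ^ n <= 2 ^ n * (1 + x ^ n).
Proof.
  intros Hx. assert (0 <= x ^ n) by now apply pow_le.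
  assert (H2 : 1 <= 2 ^ n) by (apply pow_R1_Rle; lra).
  destruct (Rle_lt_dec x 1) as [H1|H1].
  - apply Rle_trans with (2 ^ n); [apply pow_incr; lra|nra].
  - apply Rle_trans with ((2 * x) ^ n); [apply pow_incr; lra|]. rewrite Rpow_mult_distr. nra.
Qed.

(** Used with k = 0 for the boundary cell at x and with k = 2 for the extra term of [moment_tail];
    the Mills bound costs (1 + x)^r, so that at most (1 + x)^(r+2) is spent. *)
Lemma tail_mills_pow (c : R) (r k : nat) (T : R -> R) (x : R) : 0 <= c -> 0 <= x ->
  (k <= 2)%nat -> is_tail c (S r) T ->
  x ^ k * epow c (S r) x <= exp (c * INR (S r)) * 2 ^ S (S r) * (1 + x ^ S (S r)) * T x.
Proof.
  intros Hc Hx Hk HT.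
  assert (P := tail_pos c (S r) T x HT).
  apply Rle_trans with ((1 + x) ^ 2 * epow c (S r) x).
  { apply Rmult_le_compat_r; [left; apply epow_pos|].
    apply Rle_trans with ((1 + x) ^ k); [apply pow_incr; lra|]. apply Rle_pow; [lra|lia]. }
  apply Rle_trans with ((1 + x) ^ 2 * (exp (c * INR (S r)) * (1 + x) ^ r * T x)).
  { apply Rmult_le_compat_l; [apply pow_le; lra|]. now apply tail_mills. }
  replace ((1 + x) ^ 2 * (exp (c * INR (S r)) * (1 + x) ^ r * T x))
    with (exp (c * INR (S r)) * (1 + x) ^ S (S r) * T x) by (simpl; ring).
  apply Rmult_le_compat_r; [lra|]. rewrite Rmult_assoc.
  apply Rmult_le_compat_l; [left; apply exp_pos|]. now apply pow_1p_le.
Qed.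

Lemma moment_tail_bound (c : R) (r : nat) (T : R -> R) : 0 < c ->
  is_tail c (S r) T -> exists K, 0 < K /\ forall x, 0 <= x ->
  moment_tail c r T x <= K * (1 + x ^ S (S r)) * T x.
Proof.
  intros Hc HT.
  assert (Hq : 0 < INR (S r)) by (apply lt_0_INR; lia).
  set (D := 2 / (c * INR (S r))).
  assert (HD : 0 < D) by (apply Rdiv_lt_0_compat; nra).
  assert (HB : 0 < 1 + 2 * D * (2 * D + 1)) by nra.
  set (k := exp (c * INR (S r)) * 2 ^ S (S r)).
  assert (Hk : 0 < k) by (apply Rmult_lt_0_compat; [apply exp_pos|apply pow_lt; lra]).
  exists (1 + 2 * D * (2 * D + 1) + D * k). split; [nra|].
  intros x Hx. unfold moment_tail. fold D. cbv zeta.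
  assert (M := tail_mills_pow c r 2 T x ltac:(lra) Hx ltac:(lia) HT). fold k in M.
  assert (P := tail_pos c (S r) T x HT).
  assert (H0 : 0 <= x ^ S (S r)) by now apply pow_le.
  set (z := x ^ S (S r)) in *. set (B := 1 + 2 * D * (2 * D + 1)) in *.
  assert (B * T x <= B * (1 + z) * T x).
  { apply Rmult_le_compat_r; nra. }
  nra.
Qed.

(** * Comparison of lattice sums with tails *)

Definition restrict (P : Prop) (w : R) : R :=
  if excluded_middle_informative P then w else 0.

Lemma restrict_true (P : Prop) (w : R) : P -> restrict P w = w.
Proof. intros H. unfold restrict. destruct (excluded_middle_informative P); tauto. Qed.

Lemma restrict_false (P : Prop) (w : R) : ~ P -> restrict P w = 0.
Proof. intros H. unfold restrict. destruct (excluded_middle_informative P); tauto. Qed.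

Lemma restrict_nonneg (P : Prop) (w : R) : 0 <= w -> 0 <= restrict P w.
Proof. intros H. unfold restrict. destruct (excluded_middle_informative P); lra. Qed.

Lemma restrict_le (P : Prop) (w : R) : 0 <= w -> restrict P w <= w.
Proof. intros H. unfold restrict. destruct (excluded_middle_informative P); lra. Qed.

Lemma restrict_iff (P Q : Prop) (w : R) : (P <-> Q) -> restrict P w = restrict Q w.
Proof.
  intros H. unfold restrict.
  destruct (excluded_middle_informative P), (excluded_middle_informative Q); tauto.
Qed.

Section LatticeSum.

Variables (c : R) (r : nat) (T : R -> R).
Hypotheses (Hc : 0 < c) (Hr : (1 <= r)%nat) (HT : is_tail c (S r) T).

Let f := epow c (S r).
Let V := moment_tail c r T.

Lemma moment_tail_nonneg (y : R) : 0 <= V y.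
Proof.
  unfold V, moment_tail.
  assert (Hq : 0 < INR (S r)) by (apply lt_0_INR; lia).
  set (D := 2 / (c * INR (S r))).
  assert (HD : 0 < D) by (apply Rdiv_lt_0_compat; nra).
  assert (P := tail_pos c (S r) T y HT). assert (P2 := epow_pos c (S r) y).
  cbv zeta. assert (0 <= D * y ^ 2) by nra. nra.
Qed.

(** The mean value theorem is applied to T + k V as one function, so that the same point z serves
    both derivatives; d is the derivative of V at z. *)
Lemma moment_tail_mvt (k x y : R) : 0 <= x < y ->
  exists z d, x < z < y /\ d <= - (1 + z ^ S (S r)) * f z /\
    (T y + k * V y) - (T x + k * V x) = (- f z + k * d) * (y - x).
Proof.
  intros [Hx H].
  destruct (moment_tail_derive c r T Hc Hr HT) as [dV [D1 D2]].
  destruct HT as [Hd _].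
  destruct (is_derive_mvt (fun t => T t + k * V t)
    (fun t => - f t + k * dV t) x y H) as [z [Hz E]].
  { intros t _. apply (is_derive_plus (V := R_NormedModule)); [apply Hd|].
    apply is_derive_scal, D1. }
  exists z, (dV z). split; [exact Hz|]. split; [apply D2; lra|exact E].
Qed.

Lemma moment_tail_decr (x y : R) : 0 <= x <= y -> V y <= V x.
Proof.
  intros [Hx [H|<-]]; [|lra].
  destruct (moment_tail_derive c r T Hc Hr HT) as [dV [D1 D2]].
  destruct (is_derive_mvt V dV x y H (fun t _ => D1 t)) as [z [Hz E]].
  specialize (D2 z ltac:(lra)). assert (P := epow_pos c (S r) z).
  assert (0 <= z ^ S (S r)) by (apply pow_le; lra).
  assert (dV z <= 0) by nra. clear D2. nra.
Qed.

(** Lattice points v j of mesh h carry weights wt j. Up to Rad the weight is f with relative error k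
    (1 + v^(r+2)); beyond Rad only the bound tau is known. The event E is prescribed strictly
    between x and Rad but left open at v = x, so that strict and weak inequalities are both covered.
    The lower bound is an exponential because 1 - k (1 + v^(r+2)) may be negative. *)
Variables (N : nat) (v wt : nat -> R) (E : nat -> Prop) (h x Rad k bnd tau : R).
Hypotheses (Hh : 0 < h <= 1) (Hx : 0 <= x) (Hk : 0 <= k) (Htau : 0 <= tau).
Hypotheses (Hv0 : v 0%nat < 0) (HvS : forall j, v (S j) = v j + h)
  (HvN : Rad < v N) (HRad : x + h <= Rad).
Hypothesis Hbnd : k * (1 + Rad ^ S (S r)) <= bnd.
Hypothesis Hwt : forall j, (j <= N)%nat -> 0 <= wt j.
Hypothesis Hnear_upper : forall j, (j <= N)%nat -> 0 <= v j <= Rad ->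
  wt j <= f (v j) * (1 + k * (1 + v j ^ S (S r))).
Hypothesis Hnear_lower : forall j, (j <= N)%nat -> 0 <= v j <= Rad ->
  f (v j) * exp (- (k * (1 + v j ^ S (S r)))) <= wt j.
Hypothesis Hfar : forall j, (j <= N)%nat -> E j -> Rad < v j -> wt j <= tau.
Hypothesis HE_ge : forall j, E j -> x <= v j.
Hypothesis HE_near : forall j, (j <= N)%nat -> x < v j <= Rad -> E j.

Let psum (n : nat) : R := sum_f_R0 (fun j => restrict (E j) (wt j)) n.
(** The factor 2^(r+3) pays for replacing 1 + v^(r+2) at the right end of a cell of length at most 1
    by its value at an intermediate point. *)
Let k2 : R := 2 ^ S (S (S r)) * k.
Let Q (y : R) : R := T y + k2 * V y.

Lemma lattice_k2_nonneg : 0 <= k2.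
Proof. unfold k2. apply Rmult_le_pos; [|exact Hk]. left. apply pow_lt. lra. Qed.

Lemma lattice_Q_decr (a b : R) : 0 <= a <= b -> Q b <= Q a.
Proof.
  intros H. unfold Q. assert (H1 := tail_decr c (S r) T a b HT ltac:(lra)).
  assert (H2 := moment_tail_decr a b H). assert (H3 := lattice_k2_nonneg). nra.
Qed.

(** For the upper bound a lattice point is the right end of its cell: f is decreasing, hence f (a +
    h) <= f z at the intermediate point z. *)
Lemma lattice_cell_upper (a : R) : 0 <= a ->
  h * (f (a + h) * (1 + k * (1 + (a + h) ^ S (S r)))) <= Q a - Q (a + h).
Proof.
  intros Ha.
  destruct (moment_tail_mvt k2 a (a + h) ltac:(lra)) as [z [d [Hz [Hd Eq]]]].
  assert (F := epow_decr c (S r) z (a + h) ltac:(lra) ltac:(lra)).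
  assert (P1 := epow_pos c (S r) z). assert (P2 := epow_pos c (S r) (a + h)).
  fold f in F, P1, P2.
  assert (Hz0 : 0 <= z ^ S (S r)) by (apply pow_le; lra).
  assert (B : 1 + (a + h) ^ S (S r) <= 2 ^ S (S (S r)) * (1 + z ^ S (S r))).
  { assert (B1 : (a + h) ^ S (S r) <= (1 + z) ^ S (S r)) by (apply pow_incr; lra).
    assert (B2 := pow_1p_le (S (S r)) z ltac:(lra)).
    assert (1 <= 2 ^ S (S r)) by (apply pow_R1_Rle; lra).
    change (2 ^ S (S (S r))) with (2 * 2 ^ S (S r)). nra. }
  assert (E1 : Q a - Q (a + h) = h * (f z - k2 * d)).
  { unfold Q. replace (a + h - a) with h in Eq by ring. lra. }
  rewrite E1. apply Rmult_le_compat_l; [lra|].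
  assert (H2 := lattice_k2_nonneg).
  assert (B3 : k * (1 + (a + h) ^ S (S r)) <= k2 * (1 + z ^ S (S r))).
  { unfold k2. rewrite (Rmult_comm _ k), Rmult_assoc. now apply Rmult_le_compat_l. }
  apply Rle_trans with (f z * (1 + k2 * (1 + z ^ S (S r)))).
  - assert (0 <= (a + h) ^ S (S r)) by (apply pow_le; lra).
    apply Rmult_le_compat; try lra. nra.
  - assert (k2 * d <= k2 * (- (1 + z ^ S (S r)) * f z)) by now apply Rmult_le_compat_l.
    lra.
Qed.

(** For the lower bound a lattice point is the left end of its cell. Since 1 - t <= exp (- t), the
    derivative of T - k V is controlled by f z exp (- k (1 + z^(r+2))), a product of two positive
    decreasing factors, which can therefore be moved from z to a. *)
Lemma lattice_cell_lower (a : R) : 0 <= a ->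
  (T a - k * V a) - (T (a + h) - k * V (a + h)) <=
  h * (f a * exp (- (k * (1 + a ^ S (S r))))).
Proof.
  intros Ha.
  destruct (moment_tail_mvt (- k) a (a + h) ltac:(lra)) as [z [d [Hz [Hd Eq]]]].
  assert (F := epow_decr c (S r) a z ltac:(lra) ltac:(lra)).
  assert (P1 := epow_pos c (S r) z). fold f in F, P1.
  assert (Hz0 : a ^ S (S r) <= z ^ S (S r)) by (apply pow_incr; lra).
  replace ((T a - k * V a) - (T (a + h) - k * V (a + h))) with (h * (f z + k * d)).
  2:{ replace (a + h - a) with h in Eq by ring. lra. }
  apply Rmult_le_compat_l; [lra|].
  assert (X := exp_ineq1_le (- (k * (1 + z ^ S (S r))))).
  assert (M : exp (- (k * (1 + z ^ S (S r)))) <= exp (- (k * (1 + a ^ S (S r))))).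
  { apply exp_le. nra. }
  assert (P3 := exp_pos (- (k * (1 + z ^ S (S r))))).
  apply Rle_trans with (f z * exp (- (k * (1 + z ^ S (S r))))).
  - assert (k * d <= k * (- (1 + z ^ S (S r)) * f z)) by now apply Rmult_le_compat_l.
    nra.
  - apply Rmult_le_compat; lra.
Qed.

Lemma lattice_psum_zero (n : nat) : (n <= N)%nat -> v n < x -> psum n = 0.
Proof.
  intros Hn. unfold psum. induction n as [|n IH]; intros Hvn; simpl.
  - apply restrict_false. intros HE. specialize (HE_ge _ HE). lra.
  - rewrite HvS in Hvn. rewrite IH by (lia || lra). rewrite restrict_false; [ring|].
    intros HE. specialize (HE_ge _ HE). rewrite HvS in HE_ge. lra.
Qed.

(** The first lattice point in [x, x + h) has no full cell between x and itself and costs (1 + bnd)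
    h f x. Every later point up to Rad is paid by the drop of Q over the cell to its left, every
    point beyond Rad by h tau. *)
Lemma lattice_upper (n : nat) : (n <= N)%nat -> x <= v n ->
  h * psum n <= (1 + bnd) * (h * f x) + (Q x - Q (v n)) + h * INR (S n) * tau.
Proof.
  induction n as [|n IH]; intros Hn Hvn; [lra|].
  assert (PS : psum (S n) = psum n + restrict (E (S n)) (wt (S n))) by reflexivity.
  assert (Pf := epow_pos c (S r) x). fold f in Pf.
  assert (Hw := Hwt (S n) Hn).
  assert (Hre := restrict_le (E (S n)) (wt (S n)) Hw).
  assert (Hb0 : 0 <= bnd).
  { apply Rle_trans with (k * (1 + Rad ^ S (S r))); [|exact Hbnd].
    apply Rmult_le_pos; [exact Hk|]. assert (0 <= Rad ^ S (S r)) by (apply pow_le; lra). lra. }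
  assert (I1 : 0 <= INR (S n)) by apply pos_INR.
  assert (I2 := S_INR (S n)).
  assert (Ht : h * INR (S (S n)) * tau = h * INR (S n) * tau + h * tau) by (rewrite I2; ring).
  assert (Ht0 : 0 <= h * tau) by nra.
  assert (Ht1 : 0 <= h * INR (S n) * tau) by (apply Rmult_le_pos; nra).
  rewrite Ht, PS.
  destruct (Rlt_le_dec (v n) x) as [Hlt|Hge].
  - rewrite (lattice_psum_zero n ltac:(lia) Hlt).
    assert (Hq : Q (v (S n)) <= Q x) by (apply lattice_Q_decr; lra).
    assert (Hv : v (S n) <= Rad) by (rewrite HvS; lra).
    assert (U := Hnear_upper (S n) Hn ltac:(lra)).
    assert (W : wt (S n) <= (1 + bnd) * f x).
    { eapply Rle_trans; [exact U|]. rewrite Rmult_comm.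
      assert (PV : 0 <= v (S n) ^ S (S r)) by (apply pow_le; lra).
      apply Rmult_le_compat.
      - nra.
      - left; apply epow_pos.
      - assert (v (S n) ^ S (S r) <= Rad ^ S (S r)) by (apply pow_incr; lra). nra.
      - apply epow_decr; lra. }
    assert (h * restrict (E (S n)) (wt (S n)) <= h * ((1 + bnd) * f x)).
    { apply Rmult_le_compat_l; lra. }
    lra.
  - specialize (IH ltac:(lia) Hge).
    assert (Hq : Q (v (S n)) <= Q (v n)) by (apply lattice_Q_decr; rewrite HvS; lra).
    destruct (Rle_lt_dec (v (S n)) Rad) as [Hin|Hout].
    + assert (U := Hnear_upper (S n) Hn ltac:(lra)).
      assert (CU := lattice_cell_upper (v n) ltac:(lra)). rewrite <- HvS in CU.
      assert (h * restrict (E (S n)) (wt (S n)) <= h * wt (S n))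
        by (apply Rmult_le_compat_l; lra).
      assert (h * wt (S n) <= h * (f (v (S n)) * (1 + k * (1 + v (S n) ^ S (S r)))))
        by (apply Rmult_le_compat_l; lra).
      lra.
    + assert (h * restrict (E (S n)) (wt (S n)) <= h * tau).
      { apply Rmult_le_compat_l; [lra|]. unfold restrict.
        destruct (excluded_middle_informative (E (S n))) as [HE|HE]; [|exact Htau].
        now apply Hfar. }
      lra.
Qed.

(** The right alternative is the telescoped sum over the cells [v j, v j + h] so far. Once the
    lattice passes Rad, what is missing is at most T Rad; the left alternative then persists,
    because partial sums only grow. *)
Lemma lattice_lower (n : nat) : (n <= N)%nat -> x < v n ->
  T x - h * f x - k * V x - T Rad <= h * psum n \/
  (v n <= Rad /\
   T x - h * f x - k * (V x - V (v n + h)) - T (v n + h) <= h * psum n).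
Proof.
  induction n as [|n IH]; intros Hn Hvn; [lra|].
  assert (PS : psum (S n) = psum n + restrict (E (S n)) (wt (S n))) by reflexivity.
  assert (Hw := Hwt (S n) Hn).
  assert (Hr0 := restrict_nonneg (E (S n)) (wt (S n)) Hw).
  assert (Hp0 : 0 <= h * psum n).
  { apply Rmult_le_pos; [lra|]. unfold psum. clear IH PS Hw Hr0 Hvn.
    induction n as [|n IH]; simpl.
    - apply restrict_nonneg, Hwt. lia.
    - apply Rplus_le_le_0_compat; [apply IH; lia|]. apply restrict_nonneg, Hwt. lia. }
  assert (Hm : h * psum n <= h * psum (S n)) by (rewrite PS; apply Rmult_le_compat_l; lra).
  assert (Hsel : v (S n) <= Rad -> h * psum (S n) >= h * psum n
     + ((T (v (S n)) - k * V (v (S n))) - (T (v (S n) + h) - k * V (v (S n) + h)))).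
  { intros Hin. rewrite PS, restrict_true by (apply HE_near; [exact Hn|lra]).
    assert (L := Hnear_lower (S n) Hn ltac:(lra)).
    assert (CL := lattice_cell_lower (v (S n)) ltac:(lra)).
    apply (Rmult_le_compat_l h) in L; lra. }
  destruct (Rle_lt_dec (v n) x) as [Hle|Hlt].
  (* [v (S n)] is the first point beyond x; the piece of T between x and this point is lost, at a
     cost of at most h f x. *)
  - right. assert (Hin : v (S n) <= Rad) by (rewrite HvS; lra).
    split; [exact Hin|]. specialize (Hsel Hin).
    assert (TS := tail_step c (S r) T x (v (S n)) ltac:(lra) HT ltac:(lra)).
    assert (HV := moment_tail_decr x (v (S n)) ltac:(lra)).
    assert ((v (S n) - x) * epow c (S r) x <= h * f x).
    { apply Rmult_le_compat_r; [left; apply epow_pos|]. rewrite HvS. lra. }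
    assert (k * V (v (S n)) <= k * V x) by now apply Rmult_le_compat_l.
    lra.
  - destruct (IH ltac:(lia) Hlt) as [H|[Hin H]].
    + left. lra.
    + destruct (Rle_lt_dec (v (S n)) Rad) as [Hin'|Hout].
      * right. split; [exact Hin'|]. specialize (Hsel Hin'). rewrite HvS in Hsel |- *. lra.
      * left. rewrite HvS in Hout.
        assert (TD := tail_decr c (S r) T Rad (v n + h) HT ltac:(lra)).
        assert (0 <= k * V (v n + h)) by (apply Rmult_le_pos; [exact Hk|apply moment_tail_nonneg]).
        lra.
Qed.

Lemma lattice_sum :
  Rabs (h * psum N - T x) <=
  (1 + bnd) * (h * f x) + k2 * V x + T Rad + h * INR (S N) * tau.
Proof.
  assert (U := lattice_upper N (le_n N) ltac:(lra)).
  assert (L := lattice_lower N (le_n N) ltac:(lra)).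
  assert (Pf := epow_pos c (S r) x). fold f in Pf.
  assert (PV := moment_tail_nonneg x). assert (PVN := moment_tail_nonneg (v N)).
  assert (PT := tail_pos c (S r) T (v N) HT). assert (PTR := tail_pos c (S r) T Rad HT).
  assert (Hk2 : k <= k2).
  { unfold k2. assert (1 <= 2 ^ S (S (S r))) by (apply pow_R1_Rle; lra). nra. }
  assert (Hb0 : 0 <= bnd).
  { apply Rle_trans with (k * (1 + Rad ^ S (S r))); [|exact Hbnd].
    apply Rmult_le_pos; [exact Hk|]. assert (0 <= Rad ^ S (S r)) by (apply pow_le; lra). lra. }
  assert (Ht1 : 0 <= h * INR (S N) * tau).
  { apply Rmult_le_pos; [|exact Htau]. apply Rmult_le_pos; [lra|apply pos_INR]. }
  assert (Q0 : 0 <= Q (v N)).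
  { unfold Q. assert (0 <= k2 * V (v N)) by (apply Rmult_le_pos; lra). lra. }
  assert (Hhf : 0 < h * f x) by nra.
  assert (Hbf : 0 <= bnd * (h * f x)) by nra.
  assert (HkV : k * V x <= k2 * V x) by (apply Rmult_le_compat_r; lra).
  assert (HkV0 : 0 <= k * V x) by nra.
  (* At n = N the second alternative of [lattice_lower] contradicts Rad < v N. *)
  apply Rabs_le. destruct L as [L|[L _]]; [|lra]. unfold Q in *.
  split; lra.
Qed.

End LatticeSum.

(** * Laplace asymptotics of binomial sums *)

Definition lattice (N j : nat) : R := (2 * INR j - INR N) / INR N.

Definition binomial_sum (N : nat) (F : R -> R) : R :=
  sum_f_R0 (fun j => Binomial.C N j * F (lattice N j)) N.

(* Logarithm of the prefactor of the Gibbs weights at m, up to the term N (g m - Ient m). *)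
Definition log_prefactor (m : R) (N : nat) : R :=
  INR N * ln 2 - / 2 * ln (INR N) + ln 2 - / 2 * ln (1 - m ^ 2) - stirling N.

(** The step 2 / N of the lattice, measured in the coordinate v = (u - m) / s * th^(r+2). *)
Definition spacing (r : nat) (s : R) (N : nat) (th : R) : R := 2 * th ^ S (S r) / (s * INR N).

(** Write exp y as the power n + 1 of exp (y / (n + 1)) and use exp t >= t. *)
Lemma exp_ge_pow (n : nat) (y : R) : 0 <= y -> (y / INR (S n)) ^ S n <= exp y.
Proof.
  intros Hy. assert (Hn : 0 < INR (S n)) by (apply lt_0_INR; lia).
  replace y with (INR (S n) * (y / INR (S n))) at 2 by (field; lra).
  rewrite <- (ln_exp (y / INR (S n))) at 2.
  change (exp (INR (S n) * ln (exp (y / INR (S n))))) with (Rpower (exp (y / INR (S n))) (INR (S n))).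
  rewrite Rpower_pow by apply exp_pos.
  apply pow_incr. split.
  - apply Rdiv_le_0_compat; lra.
  - assert (X := exp_ineq1_le (y / INR (S n))). lra.
Qed.

Lemma pow_le_1_add (n : nat) (x : R) : (1 <= n)%nat -> 0 <= x -> x <= 1 + x ^ n.
Proof.
  intros Hn Hx. assert (0 <= x ^ n) by now apply pow_le.
  destruct (Rle_lt_dec x 1); [lra|].
  assert (x ^ 1 <= x ^ n) by (apply Rle_pow; [lra|exact Hn]). lra.
Qed.

Section LaplaceTail.

Variables (c : R) (r : nat) (s m : R) (g : R -> R) (T : R -> R).
Hypotheses (Hc : 0 < c) (Hr : (1 <= r)%nat) (Hs : 0 < s) (Hm : -1 < m < 1)
  (HT : is_tail c (S r) T).

Let HH (u : R) : R := g u - Ient u.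
Let wt (N j : nat) : R :=
  exp (- (log_prefactor m N + INR N * HH m)) * (Binomial.C N j * exp (INR N * g (lattice N j))).
Let vv (N : nat) (th : R) (j : nat) : R := (lattice N j - m) / s * th ^ S (S r).

(** Up to halfway from m to 1 one has 1 - u^2 >= (1 - m) (1 + m) / 2, which bounds the
    derivative. *)
Lemma ln_one_minus_sqr_lip (u : R) : m <= u <= (1 + m) / 2 ->
  Rabs (ln (1 - u ^ 2) - ln (1 - m ^ 2)) <= 4 / ((1 - m) * (1 + m)) * (u - m).
Proof.
  intros [[H|<-] Hu].
  2:{ rewrite !Rminus_diag, Rabs_R0. lra. }
  destruct (is_derive_mvt (fun u => ln (1 - u ^ 2)) (fun u => - (2 * u) / (1 - u ^ 2)) m u H)
    as [z [Hz E]].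
  - intros t Ht. auto_derive; [nra|]. field. nra.
  - rewrite E, Rabs_mult, (Rabs_pos_eq (u - m)) by lra.
    apply Rmult_le_compat_r; [lra|].
    assert (Hb : (1 - m) / 2 * (1 + m) <= 1 - z ^ 2).
    { replace (1 - z ^ 2) with ((1 - z) * (1 + z)) by ring. apply Rmult_le_compat; lra. }
    assert (Hb0 : 0 < (1 - m) / 2 * (1 + m)) by nra.
    unfold Rdiv at 1. rewrite Rabs_mult, Rabs_inv, (Rabs_pos_eq (1 - z ^ 2)) by lra.
    replace (4 / ((1 - m) * (1 + m))) with (2 * / ((1 - m) / 2 * (1 + m))) by (field; lra).
    apply Rmult_le_compat; [apply Rabs_pos| |apply Rabs_le; lra|].
    + left. apply Rinv_0_lt_compat. lra.
    + apply Rinv_le_contravar; lra.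
Qed.

Variables (K0 d0 : R).
Hypotheses (HK0 : 0 < K0) (Hd0 : 0 < d0).
Hypothesis Hexp : forall u, m <= u <= m + d0 ->
  Rabs (HH u - HH m + c * ((u - m) / s) ^ S r) <= K0 * (u - m) ^ S (S r).

(** The three summands come from the Taylor remainder, from the factor 1 / sqrt (1 - u^2), and from
    the Stirling errors 1/j and 1/(N - j), where j >= N (1 + m) / 2 and N - j >= N (1 - m) / 4. *)
Let k0 : R := K0 * s ^ S (S r) + 2 / ((1 - m) * (1 + m)) * s + (2 / (1 + m) + 4 / (1 - m)).

Lemma k0_pos : 0 < k0.
Proof.
  unfold k0. assert (0 < s ^ S (S r)) by now apply pow_lt.
  assert (0 < 2 / ((1 - m) * (1 + m))) by (apply Rdiv_lt_0_compat; nra).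
  assert (0 < 2 / (1 + m)) by (apply Rdiv_lt_0_compat; lra).
  assert (0 < 4 / (1 - m)) by (apply Rdiv_lt_0_compat; lra). nra.
Qed.

Lemma theta_pos (N : nat) (th : R) : 1 <= th -> th ^ (S r * S (S r)) = INR N ->
  0 < INR N /\ (1 <= N)%nat.
Proof.
  intros Hth HN.
  assert (P : 0 < INR N) by (rewrite <- HN; apply pow_lt; lra).
  split; [exact P|]. apply (INR_lt 0) in P. lia.
Qed.

(** The leading term is exact, since N ((u - m) / s)^(r+1) = v^(r+1). The remainder N (u - m)^(r+2)
    is s^(r+2) v^(r+2) / th^(r+2); the prefactor contributes a multiple of u - m = s v / th^(r+2),
    and Stirling a multiple of 1/N <= 1 / th^(r+2). *)
Lemma near_log_weight (N j : nat) (th : R) :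
  1 <= th -> th ^ (S r * S (S r)) = INR N -> (j <= N)%nat ->
  0 <= vv N th j -> lattice N j <= m + d0 -> lattice N j <= (1 + m) / 2 ->
  exists e, wt N j = exp (- (c * vv N th j ^ S r) + e) /\
    Rabs e <= k0 / th ^ S (S r) * (1 + vv N th j ^ S (S r)).
Proof.
  intros Hth HN Hj Hv Hu1 Hu2.
  destruct (theta_pos N th Hth HN) as [HN0 HN1].
  assert (Hp0 : 0 < th ^ S (S r)) by (apply pow_lt; lra).
  set (u := lattice N j) in *.
  assert (Ev : vv N th j = (u - m) / s * th ^ S (S r)) by reflexivity.
  set (v := vv N th j) in *.
  assert (Eu : u - m = s * v / th ^ S (S r)) by (rewrite Ev; field; lra).
  assert (Hu0 : 0 <= u - m).
  { rewrite Eu. apply Rdiv_le_0_compat; [nra|lra]. }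
  assert (Ej : INR j = INR N * (1 + u) / 2) by (unfold u, lattice; field; lra).
  assert (Hjlt : (0 < j < N)%nat).
  { split; apply INR_lt; rewrite Ej; simpl; nra. }
  assert (Ek : INR (N - j) = INR N * (1 - u) / 2) by (rewrite minus_INR, Ej by lia; field).
  (* [stirling N] occurs twice: once from the binomial coefficient and once from [log_prefactor],
     where it stands in for the limit constant of Stirling's formula. *)
  exists (INR N * (HH u - HH m + c * ((u - m) / s) ^ S r)
     - / 2 * (ln (1 - u ^ 2) - ln (1 - m ^ 2))
     + ((stirling N - stirling j) + (stirling N - stirling (N - j)))).
  split.
  - unfold wt. rewrite (binomial_stirling N j u Hjlt eq_refl), <- !exp_plus. fold u. f_equal.
    replace (c * v ^ S r) with (INR N * (c * ((u - m) / s) ^ S r)).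
    2:{ rewrite Ev, Rpow_mult_distr, <- pow_mult, Nat.mul_comm, HN. ring. }
    unfold log_prefactor, HH. field.
  - assert (B1 : Rabs (INR N * (HH u - HH m + c * ((u - m) / s) ^ S r))
      <= K0 * s ^ S (S r) / th ^ S (S r) * v ^ S (S r)).
    { rewrite Rabs_mult, (Rabs_pos_eq (INR N)) by lra.
      eapply Rle_trans.
      { apply Rmult_le_compat_l; [lra|]. apply Hexp. lra. }
      right. rewrite Eu. unfold Rdiv.
      rewrite !Rpow_mult_distr, pow_inv, <- pow_mult.
      replace (S (S r) * S (S r))%nat with (S r * S (S r) + S (S r))%nat by lia.
      rewrite pow_add, HN. field. lra. }
    assert (B2 := ln_one_minus_sqr_lip u ltac:(lra)).
    assert (B3 : Rabs (stirling N - stirling j) <= / INR N * (2 / (1 + m))).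
    { assert (S1 := stirling_diff j N ltac:(lia)).
      apply Rle_trans with (/ INR j); [apply Rabs_le; lra|].
      replace (/ INR N * (2 / (1 + m))) with (/ (INR N * (1 + m) / 2)) by (field; lra).
      apply Rinv_le_contravar; [nra|]. rewrite Ej. nra. }
    assert (B4 : Rabs (stirling N - stirling (N - j)) <= / INR N * (4 / (1 - m))).
    { assert (S1 := stirling_diff (N - j) N ltac:(lia)).
      apply Rle_trans with (/ INR (N - j)); [apply Rabs_le; lra|].
      replace (/ INR N * (4 / (1 - m))) with (/ (INR N * (1 - m) / 4)) by (field; lra).
      apply Rinv_le_contravar; [nra|]. rewrite Ek. nra. }
    assert (HNp : / INR N <= / th ^ S (S r)).
    { apply Rinv_le_contravar; [lra|]. rewrite <- HN. apply Rle_pow; [lra|lia]. }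
    assert (Hvp : v <= 1 + v ^ S (S r)) by (apply pow_le_1_add; [lia|exact Hv]).
    assert (Hv0 : 0 <= v ^ S (S r)) by now apply pow_le.
    assert (Q1 : 0 < 2 / (1 + m)) by (apply Rdiv_lt_0_compat; lra).
    assert (Q2 : 0 < 4 / (1 - m)) by (apply Rdiv_lt_0_compat; lra).
    assert (Q3 : 0 < 2 / ((1 - m) * (1 + m))) by (apply Rdiv_lt_0_compat; nra).
    set (ep := / th ^ S (S r)) in *.
    assert (Hep : 0 < ep) by now apply Rinv_0_lt_compat.
    assert (B2' : Rabs (/ 2 * (ln (1 - u ^ 2) - ln (1 - m ^ 2)))
       <= 2 / ((1 - m) * (1 + m)) * s * ep * (1 + v ^ S (S r))).
    { rewrite Rabs_mult, (Rabs_pos_eq (/ 2)) by lra.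
      apply Rle_trans with (/ 2 * (4 / ((1 - m) * (1 + m)) * (u - m))); [lra|].
      replace (/ 2 * (4 / ((1 - m) * (1 + m)) * (u - m)))
        with (2 / ((1 - m) * (1 + m)) * s * ep * v).
      - apply Rmult_le_compat_l; [|exact Hvp].
        apply Rmult_le_pos; [nra|lra].
      - rewrite Eu. unfold ep. field. lra. }
    assert (B3' : / INR N * (2 / (1 + m)) + / INR N * (4 / (1 - m))
        <= (2 / (1 + m) + 4 / (1 - m)) * ep * (1 + v ^ S (S r))).
    { apply Rle_trans with ((2 / (1 + m) + 4 / (1 - m)) * ep).
      - rewrite <- Rmult_plus_distr_l, Rmult_comm. apply Rmult_le_compat_l; lra.
      - rewrite <- (Rmult_1_r ((2 / (1 + m) + 4 / (1 - m)) * ep)) at 1.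
        apply Rmult_le_compat_l; [|lra]. apply Rmult_le_pos; lra. }
    assert (B1' : K0 * s ^ S (S r) / th ^ S (S r) * v ^ S (S r)
        <= K0 * s ^ S (S r) * ep * (1 + v ^ S (S r))).
    { unfold Rdiv. fold ep. apply Rmult_le_compat_l; [|lra].
      assert (0 < s ^ S (S r)) by now apply pow_lt.
      apply Rmult_le_pos; [nra|lra]. }
    change (k0 / th ^ S (S r)) with (k0 * ep).
    eapply Rle_trans; [apply Rabs_triang|].
    eapply Rle_trans; [apply Rplus_le_compat; [apply Rabs_triang|apply Rabs_triang]|].
    rewrite Rabs_Ropp. unfold k0. lra.
Qed.

Variable A : R -> Prop.
Hypothesis HA : forall u, m <= u <= m + d0 -> A u.
Hypothesis Hgap : forall d, 0 < d -> exists eta, 0 < eta /\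
  forall u, A u -> m + d <= u <= 1 -> HH u <= HH m - eta.

(* (c / 2) M exceeds by 1 the constant c 2^(r+2) for which T x >= exp (- c 2^(r+2) th^(r+1))
   holds on [0, th]. *)
Let M : R := 2 ^ S (S (S r)) + 2 / c.

Lemma M_ge : 2 <= M.
Proof.
  unfold M. assert (1 <= 2 ^ S (S r)) by (apply pow_R1_Rle; lra).
  change (2 ^ S (S (S r))) with (2 * 2 ^ S (S r)).
  assert (0 < 2 / c) by (apply Rdiv_lt_0_compat; lra). lra.
Qed.

(** T x is at least f (x + 1), and (1 + x)^(r+1) <= 2^(r+2) th^(r+1). The summand 2 / c of M leaves
    the spare factor exp (- th^(r+1)), which [theta_exp_bound] spends on powers of N. *)
Lemma tail_lower (x th : R) : 1 <= th -> 0 <= x <= th ->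
  exp (- (c / 2 * M * th ^ S r)) <= T x * exp (- th ^ S r).
Proof.
  intros Hth Hx.
  assert (T1 := tail_step c (S r) T x (x + 1) ltac:(lra) HT ltac:(lra)).
  assert (P := tail_pos c (S r) T (x + 1) HT).
  assert (E : exp (- (c * 2 ^ S (S r) * th ^ S r)) <= T x).
  { apply Rle_trans with (epow c (S r) (x + 1)).
    - apply exp_le, Ropp_le_contravar. rewrite Rmult_assoc. apply Rmult_le_compat_l; [lra|].
      rewrite (Rplus_comm x 1).
      eapply Rle_trans; [apply pow_1p_le; lra|].
      assert (x ^ S r <= th ^ S r) by now apply pow_incr.
      assert (1 <= th ^ S r) by now apply pow_R1_Rle.
      assert (0 < 2 ^ S r) by (apply pow_lt; lra).
      change (2 ^ S (S r)) with (2 * 2 ^ S r). nra.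
    - lra. }
  apply Rle_trans with (exp (- (c * 2 ^ S (S r) * th ^ S r)) * exp (- th ^ S r)).
  - rewrite <- exp_plus. right. f_equal. unfold M.
    change (2 ^ S (S (S r))) with (2 * 2 ^ S (S r)). field. lra.
  - apply Rmult_le_compat_r; [left; apply exp_pos|exact E].
Qed.

Lemma theta_exp_bound : exists K, 0 < K /\ forall th, 1 <= th ->
  (th ^ (S r * S (S r))) ^ 2 * exp (- th ^ S r) <= K / th ^ S (S r).
Proof.
  (* Here (r + 1) n = 3 (r + 1) (r + 2), at least the exponent 2 (r + 1) (r + 2) + (r + 2) of N^2
     th^(r+2). *)
  set (n := S (3 * r + 5)).
  assert (Hn : 0 < INR n) by (apply lt_0_INR; unfold n; lia).
  exists (INR n ^ n). split; [now apply pow_lt|]. intros th Hth.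
  assert (X := exp_ge_pow (3 * r + 5) (th ^ S r) ltac:(apply pow_le; lra)). fold n in X.
  unfold Rdiv in X. rewrite Rpow_mult_distr, pow_inv, <- pow_mult in X.
  assert (Hnn : 0 < INR n ^ n) by now apply pow_lt.
  assert (Hp : 0 < th ^ S (S r)) by (apply pow_lt; lra).
  assert (L : (th ^ (S r * S (S r))) ^ 2 * th ^ S (S r) <= th ^ (S r * n)).
  { rewrite <- pow_mult, <- pow_add. apply Rle_pow; [lra|]. unfold n. nia. }
  rewrite exp_Ropp.
  assert (HE := exp_pos (th ^ S r)).
  apply (Rmult_le_reg_r (exp (th ^ S r) * th ^ S (S r))); [nra|].
  replace ((th ^ (S r * S (S r))) ^ 2 * / exp (th ^ S r) * (exp (th ^ S r) * th ^ S (S r)))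
    with ((th ^ (S r * S (S r))) ^ 2 * th ^ S (S r)) by (field; lra).
  replace (INR n ^ n / th ^ S (S r) * (exp (th ^ S r) * th ^ S (S r)))
    with (INR n ^ n * exp (th ^ S r)) by (field; lra).
  apply Rle_trans with (th ^ (S r * n)); [exact L|].
  apply (Rmult_le_compat_l (INR n ^ n)) in X; [|lra].
  replace (INR n ^ n * (th ^ (S r * n) * / INR n ^ n)) with (th ^ (S r * n)) in X by (field; lra).
  exact X.
Qed.

(** Two regimes. Within distance d of m the Taylor expansion still gives half of the leading decay;
    farther away the gap eta gives exp (- N eta), with N >= th th^(r+1). The entropy bound on the
    binomial coefficient holds up to j = N and costs only the factor N e. *)
Lemma far_weight : exists th0, forall (N j : nat) (th : R),
  1 <= th -> th0 <= th -> th ^ (S r * S (S r)) = INR N -> (j <= N)%nat ->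
  A (lattice N j) -> M * th < vv N th j ->
  wt N j <= INR N * exp 1 * exp (- (c / 2 * M * th ^ S r)).
Proof.
  assert (Hsq : 0 < s ^ S r) by now apply pow_lt.
  assert (HM := M_ge).
  (* At this distance the Taylor remainder is at most half of the leading term. *)
  set (d := Rmin d0 (c / (2 * K0 * s ^ S r))).
  assert (Hd : 0 < d).
  { apply Rmin_pos; [exact Hd0|]. apply Rdiv_lt_0_compat; nra. }
  destruct (Hgap d Hd) as [eta [Heta Hg]].
  exists (c * M / (2 * eta)). intros N j th Hth Hth0 HN Hj HAu Hv.
  destruct (theta_pos N th Hth HN) as [HN0 HN1].
  assert (Hp0 : 0 < th ^ S (S r)) by (apply pow_lt; lra).
  assert (Hq1 : 1 <= th ^ S r) by now apply pow_R1_Rle.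
  set (u := lattice N j) in *.
  assert (Ev : vv N th j = (u - m) / s * th ^ S (S r)) by reflexivity.
  set (v := vv N th j) in *.
  assert (HMth : 2 * 1 <= M * th) by (apply Rmult_le_compat; lra).
  assert (Hu1 : u <= 1).
  { apply le_INR in Hj. unfold u, lattice. apply (Rmult_le_reg_r (INR N)); [exact HN0|].
    field_simplify; lra. }
  assert (Hu0 : 0 < u - m).
  { replace (u - m) with (s * v / th ^ S (S r)) by (rewrite Ev; field; lra).
    apply Rdiv_lt_0_compat; [|lra]. apply Rmult_lt_0_compat; lra. }
  assert (D : INR N * (HH u - HH m) <= - (c / 2 * M * th ^ S r)).
  { destruct (Rle_lt_dec (m + d) u) as [Hfar|Hnear].
    - specialize (Hg u HAu ltac:(lra)).
      apply Rle_trans with (INR N * - eta); [apply Rmult_le_compat_l; lra|].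
      assert (N1 : th * th ^ S r <= INR N).
      { rewrite <- HN. change (th * th ^ S r) with (th ^ S (S r)). apply Rle_pow; [lra|lia]. }
      assert (c / 2 * M <= eta * th).
      { apply (Rmult_le_compat_l eta) in Hth0; [|lra].
        replace (eta * (c * M / (2 * eta))) with (c / 2 * M) in Hth0 by (field; lra). lra. }
      nra.
    - assert (Hd1 := Rmin_l d0 (c / (2 * K0 * s ^ S r))).
      assert (Hd2 := Rmin_r d0 (c / (2 * K0 * s ^ S r))). fold d in Hd1, Hd2.
      assert (X := Hexp u ltac:(lra)). apply Rabs_le_between in X.
      assert (Y : K0 * (u - m) ^ S (S r) <= c / 2 * ((u - m) / s) ^ S r).
      { unfold Rdiv at 2. rewrite Rpow_mult_distr, pow_inv.
        change ((u - m) ^ S (S r)) with ((u - m) * (u - m) ^ S r).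
        assert (0 < (u - m) ^ S r) by now apply pow_lt.
        apply Rle_trans with (K0 * (c / (2 * K0 * s ^ S r) * (u - m) ^ S r)).
        - apply Rmult_le_compat_l; [lra|]. apply Rmult_le_compat_r; lra.
        - right. field. lra. }
      assert (Z : INR N * ((u - m) / s) ^ S r = v ^ S r).
      { rewrite Ev, Rpow_mult_distr, <- pow_mult, Nat.mul_comm, HN. ring. }
      assert (W : M * th ^ S r <= v ^ S r).
      { apply Rle_trans with ((M * th) ^ S r).
        - rewrite Rpow_mult_distr. apply Rmult_le_compat_r; [lra|].
          rewrite <- (pow_1 M) at 1. apply Rle_pow; [lra|lia].
        - apply pow_incr. lra. }
      apply Rle_trans with (INR N * (- (c / 2) * ((u - m) / s) ^ S r)).
      + apply Rmult_le_compat_l; lra.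
      + replace (INR N * (- (c / 2) * ((u - m) / s) ^ S r))
          with (- (c / 2) * (INR N * ((u - m) / s) ^ S r)) by ring.
        rewrite Z. nra. }
  assert (BE := binomial_entropy_bound N j u HN1 Hj eq_refl).
  unfold wt. fold u.
  apply Rle_trans with (exp (- (log_prefactor m N + INR N * HH m)) *
    (exp (INR N * ln 2 - INR N * Ient u) * exp (INR N * g u))).
  { apply Rmult_le_compat_l; [left; apply exp_pos|].
    apply Rmult_le_compat_r; [left; apply exp_pos|exact BE]. }
  apply Rle_trans with (exp (ln (INR N)) * exp 1 * exp (- (c / 2 * M * th ^ S r)));
    [|rewrite exp_ln by exact HN0; lra].
  rewrite <- !exp_plus. apply exp_le.
  (* [stirling] is decreasing and equals 1 at 1, so [stirling N] <= 1: this is the factor exp 1 of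
     the bound. *)
  assert (S1 := stirling_diff 1 N ltac:(lia)).
  assert (St1 : stirling 1 = 1).
  { unfold stirling. simpl. rewrite ln_1. ring. }
  assert (L1 : ln (1 - m ^ 2) <= 0).
  { rewrite <- ln_1. apply ln_le; nra. }
  assert (L2 : 0 <= ln (INR N)).
  { rewrite <- ln_1. apply ln_le; [lra|]. apply (le_INR 1). lia. }
  assert (L3 : 0 < ln 2) by (rewrite <- ln_1; apply ln_increasing; lra).
  unfold log_prefactor.
  replace (- (INR N * ln 2 - / 2 * ln (INR N) + ln 2 - / 2 * ln (1 - m ^ 2) - stirling N
     + INR N * HH m) + (INR N * ln 2 - INR N * Ient u + INR N * g u))
    with (INR N * (HH u - HH m) + / 2 * ln (INR N) - ln 2 + / 2 * ln (1 - m ^ 2) + stirling N)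
    by (unfold HH; ring).
  lra.
Qed.

(** [lattice_sum] with cut-off Rad = M th; each of its four error terms is bounded by a multiple of
    (1 + x^(r+2)) / th^(r+2) * T x. The event B may be v > x or v >= x; the normalization needs
    both. *)
Lemma laplace_tail_aux : exists K th0, 1 <= th0 /\ forall (N : nat) (th : R),
  th0 <= th -> th ^ (S r * S (S r)) = INR N ->
  forall x, 0 <= x <= th -> forall B : R -> Prop,
  (forall v, x < v -> B v) -> (forall v, B v -> x <= v) ->
  Rabs (spacing r s N th * exp (- (log_prefactor m N + INR N * HH m)) *
        binomial_sum N (fun u => restrict (A u /\ B ((u - m) / s * th ^ S (S r)))
                                          (exp (INR N * g u))) - T x)
  <= K * (1 + x ^ S (S r)) / th ^ S (S r) * T x.
Proof.
  assert (HM := M_ge). assert (Hk0 := k0_pos).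
  destruct far_weight as [thf Hfar].
  destruct theta_exp_bound as [KE [HKE HE]].
  destruct (moment_tail_bound c r T Hc HT) as [KV [HKV HV]].
  (* Z bounds the log-error k0 (1 + v^(r+2)) / th^(r+2) for all v <= M th; it is constant because
     v^(r+2) / th^(r+2) is at most M^(r+2). *)
  set (Z := k0 * (1 + M ^ S (S r))).
  set (bnd := exp Z * Z).
  set (km := exp (c * INR (S r)) * 2 ^ S (S r)).
  (* One summand each for the boundary cell (C1), the relative errors of the weights (C2), and the
     part beyond M th, in the tail (C3) and in the sum (C4). *)
  set (Kb := (1 + bnd) * (2 / s * km) + 2 ^ S (S (S r)) * (exp Z * k0) * KV
             + (/ (c * INR (S r)) + 2 * exp 1) * KE).
  set (dd := Rmin d0 ((1 - m) / 2)).
  assert (Hdd : 0 < dd) by (apply Rmin_pos; lra).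
  assert (Hdd1 := Rmin_l d0 ((1 - m) / 2)). assert (Hdd2 := Rmin_r d0 ((1 - m) / 2)).
  fold dd in Hdd1, Hdd2.
  (* The summands meet the threshold of [far_weight], keep the points with v <= M th within dd of m,
     and make the mesh at most 1. *)
  set (th0 := 1 + Rabs thf + s * M / dd + 2 / s).
  assert (Q1 : 0 < s * M / dd) by (apply Rdiv_lt_0_compat; nra).
  assert (Q2 : 0 < 2 / s) by (apply Rdiv_lt_0_compat; lra).
  assert (Q3 := Rabs_pos thf). assert (Q4 := Rle_abs thf).
  exists Kb, th0. split; [unfold th0; lra|].
  intros N th Hth0 HN x Hx B HB1 HB2. unfold th0 in Hth0.
  assert (Hth : 1 <= th) by lra.
  destruct (theta_pos N th Hth HN) as [HN0 HN1].
  assert (Hp0 : 0 < th ^ S (S r)) by (apply pow_lt; lra).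
  assert (Hp1 : th <= th ^ S (S r)).
  { rewrite <- (pow_1 th) at 1. apply Rle_pow; [lra|lia]. }
  assert (Hq1 : th <= th ^ S r).
  { rewrite <- (pow_1 th) at 1. apply Rle_pow; [lra|lia]. }
  set (ep := / th ^ S (S r)).
  assert (Hep : 0 < ep) by now apply Rinv_0_lt_compat.
  set (h := spacing r s N th).
  assert (Hh0 : 0 < h) by (apply Rdiv_lt_0_compat; nra).
  assert (Hhe : h <= 2 / s * ep).
  { unfold h, spacing, ep. rewrite <- HN.
    replace (2 * th ^ S (S r) / (s * th ^ (S r * S (S r))))
      with (2 / s * (th ^ S (S r) / th ^ (S r * S (S r)))).
    2:{ field. split; [|lra]. apply pow_nonzero. lra. }
    apply Rmult_le_compat_l; [lra|].
    assert (P1 : 0 < th ^ (S r * S (S r))) by (apply pow_lt; lra).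
    apply (Rmult_le_reg_r (th ^ (S r * S (S r)) * th ^ S (S r))); [nra|].
    replace (th ^ S (S r) / th ^ (S r * S (S r)) * (th ^ (S r * S (S r)) * th ^ S (S r)))
      with (th ^ S (S r) * th ^ S (S r)) by (field; lra).
    replace (/ th ^ S (S r) * (th ^ (S r * S (S r)) * th ^ S (S r)))
      with (th ^ (S r * S (S r))) by (field; lra).
    rewrite <- pow_add. apply Rle_pow; [lra|nia]. }
  assert (Hh1 : h <= 1).
  { eapply Rle_trans; [exact Hhe|]. unfold ep.
    apply (Rmult_le_reg_r (th ^ S (S r))); [lra|].
    rewrite Rmult_assoc, Rinv_l by lra. lra. }
  assert (Hloc : forall j, 0 <= vv N th j <= M * th -> m <= lattice N j <= m + dd).
  { intros j Hv. set (v := vv N th j) in *.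
    assert (Eu : lattice N j - m = s * v / th ^ S (S r)) by (unfold v, vv; field; lra).
    split.
    - assert (0 <= s * v / th ^ S (S r)) by (apply Rdiv_le_0_compat; nra). lra.
    - assert (s * v / th ^ S (S r) <= dd); [|lra].
      apply (Rmult_le_reg_r (th ^ S (S r))); [lra|].
      unfold Rdiv. rewrite Rmult_assoc, Rinv_l, Rmult_1_r by lra.
      change (th ^ S (S r)) with (th * th ^ S r).
      assert (s * M <= dd * th ^ S r).
      { replace (s * M) with (dd * (s * M / dd)) by (field; lra).
        apply Rmult_le_compat_l; lra. }
      assert (s * v <= s * (M * th)) by (apply Rmult_le_compat_l; lra).
      apply Rle_trans with (s * M * th); [lra|].
      replace (dd * (th * th ^ S r)) with (dd * th ^ S r * th) by ring.
      apply Rmult_le_compat_r; lra. }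
  assert (HeZ : 1 <= exp Z).
  { rewrite <- exp_0. apply exp_le. unfold Z. apply Rmult_le_pos; [lra|].
    assert (0 <= M ^ S (S r)) by (apply pow_le; lra). lra. }
  assert (HMp : 0 <= M ^ S (S r)) by (apply pow_le; lra).
  assert (HZ : 0 <= Z) by (apply Rmult_le_pos; lra).
  set (k := exp Z * (k0 * ep)).
  assert (Hk : 0 <= k) by (apply Rmult_le_pos; nra).
  assert (HepZ : k0 * ep * (1 + (M * th) ^ S (S r)) <= Z).
  { unfold Z. rewrite Rmult_assoc. apply Rmult_le_compat_l; [lra|].
    rewrite Rpow_mult_distr. unfold ep.
    replace (/ th ^ S (S r) * (1 + M ^ S (S r) * th ^ S (S r)))
      with (/ th ^ S (S r) + M ^ S (S r)) by (field; lra).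
    assert (/ th ^ S (S r) <= / 1) by (apply Rinv_le_contravar; lra). lra. }
  set (tau := INR N * exp 1 * exp (- (c / 2 * M * th ^ S r))).
  assert (L := lattice_sum c r T Hc Hr HT N (vv N th) (wt N)
    (fun j => A (lattice N j) /\ B (vv N th j)) h x (M * th) k bnd tau).
  assert (LS : h * sum_f_R0 (fun j => restrict (A (lattice N j) /\ B (vv N th j)) (wt N j)) N
     = h * exp (- (log_prefactor m N + INR N * HH m)) *
        binomial_sum N (fun u => restrict (A u /\ B ((u - m) / s * th ^ S (S r)))
                                          (exp (INR N * g u)))).
  { unfold binomial_sum. rewrite Rmult_assoc. f_equal. rewrite scal_sum.
    apply sum_eq. intros j Hj. unfold wt. fold (vv N th j). unfold restrict.
    destruct (excluded_middle_informative (A (lattice N j) /\ B (vv N th j))); ring. }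
  cbv zeta beta in L. rewrite LS in L. clear LS.
  eapply Rle_trans; [apply L; clear L|].
  - lra.
  - lra.
  - exact Hk.
  - unfold tau. apply Rmult_le_pos; [|left; apply exp_pos].
    apply Rmult_le_pos; [lra|left; apply exp_pos].
  - unfold vv, lattice. change (INR 0) with 0.
    replace ((2 * 0 - INR N) / INR N) with (-1) by (field; lra).
    assert (0 < (1 + m) / s * th ^ S (S r)).
    { apply Rmult_lt_0_compat; [|lra]. apply Rdiv_lt_0_compat; lra. }
    replace ((-1 - m) / s * th ^ S (S r)) with (- ((1 + m) / s * th ^ S (S r))) by (field; lra).
    lra.
  - intros j. unfold vv, lattice, h, spacing. rewrite S_INR. field. lra.
  - destruct (Rle_lt_dec (vv N th N) (M * th)) as [Hle|]; [|assumption].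
    exfalso.
    assert (Ev : vv N th N = (1 - m) / s * th ^ S (S r)).
    { unfold vv, lattice. field. lra. }
    assert (H0 : 0 <= vv N th N).
    { rewrite Ev. apply Rmult_le_pos; [|lra]. apply Rdiv_le_0_compat; lra. }
    specialize (Hloc N (conj H0 Hle)). unfold lattice in Hloc.
    replace ((2 * INR N - INR N) / INR N) with 1 in Hloc by (field; lra). lra.
  - nra.
  - unfold bnd, k. rewrite Rmult_assoc. apply Rmult_le_compat_l; [lra|exact HepZ].
  - intros j _. unfold wt. apply Rmult_le_pos; [left; apply exp_pos|].
    apply Rmult_le_pos; [apply binomial_nonneg|left; apply exp_pos].
  - intros j Hj Hv. specialize (Hloc j Hv).
    destruct (near_log_weight N j th Hth HN Hj ltac:(lra) ltac:(lra) ltac:(lra)) as [e [-> He]].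
    set (v := vv N th j) in *. unfold Rdiv in He. fold ep in He.
    assert (Hzv : k0 * ep * (1 + v ^ S (S r)) <= Z).
    { eapply Rle_trans; [|exact HepZ]. apply Rmult_le_compat_l; [nra|].
      apply Rplus_le_compat_l. apply pow_incr. lra. }
    rewrite exp_plus. apply Rmult_le_compat_l; [left; apply exp_pos|].
    set (z := k0 * ep * (1 + v ^ S (S r))) in *.
    assert (Hz0 : 0 <= z) by (assert (P := Rabs_pos e); lra).
    apply Rle_trans with (exp z).
    { apply exp_le. assert (P := Rle_abs e). lra. }
    replace (k * (1 + v ^ S (S r))) with (exp Z * z) by (unfold k, z; ring).
    (* From 1 - z <= exp (- z) follows exp z <= 1 + z exp z <= 1 + z exp Z, so the log-error becomes
       a relative error at the price of exp Z. *)
    assert (X := exp_ineq1_le (- z)).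
    assert (Y : exp z * exp (- z) = 1) by (rewrite <- exp_plus, Rplus_opp_r; apply exp_0).
    assert (W : exp z <= exp Z) by now apply exp_le.
    assert (P := exp_pos z). nra.
  - intros j Hj Hv. specialize (Hloc j Hv).
    destruct (near_log_weight N j th Hth HN Hj ltac:(lra) ltac:(lra) ltac:(lra)) as [e [-> He]].
    set (v := vv N th j) in *. unfold Rdiv in He. fold ep in He.
    rewrite exp_plus. apply Rmult_le_compat_l; [left; apply exp_pos|].
    apply exp_le.
    assert (P := Rle_abs (- e)). rewrite Rabs_Ropp in P.
    assert (0 <= v ^ S (S r)) by (apply pow_le; lra).
    assert (k0 * ep * (1 + v ^ S (S r)) <= k * (1 + v ^ S (S r))); [|lra].
    apply Rmult_le_compat_r; [lra|]. unfold k.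
    assert (0 < k0 * ep) by nra. nra.
  - intros j Hj [HAu _] Hv. apply Hfar; auto. lra.
  - intros j [_ HBv]. now apply HB2.
  - intros j Hj Hv. split; [|apply HB1; lra].
    apply HA. specialize (Hloc j ltac:(lra)). lra.
  - assert (TP := tail_pos c (S r) T x HT).
    assert (Hxp : 0 <= x ^ S (S r)) by (apply pow_le; lra).
    assert (Hkm : 0 < km).
    { apply Rmult_lt_0_compat; [apply exp_pos|apply pow_lt; lra]. }
    assert (Hb : 0 <= bnd) by (apply Rmult_le_pos; lra).
    set (W := ep * (1 + x ^ S (S r)) * T x).
    assert (HW : 0 < W) by (apply Rmult_lt_0_compat; nra).
    assert (HWe : ep * T x <= W).
    { unfold W. apply Rmult_le_compat_r; [lra|].
      rewrite <- (Rmult_1_r ep) at 1. apply Rmult_le_compat_l; lra. }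
    assert (C1 : h * epow c (S r) x <= 2 / s * km * W).
    { assert (X := tail_mills_pow c r 0 T x ltac:(lra) ltac:(lra) ltac:(lia) HT).
      fold km in X. simpl (x ^ 0) in X. rewrite Rmult_1_l in X.
      apply Rle_trans with (2 / s * ep * (km * (1 + x ^ S (S r)) * T x)).
      - apply Rmult_le_compat; [lra|left; apply epow_pos|exact Hhe|exact X].
      - right. unfold W. ring. }
    assert (C2 : 2 ^ S (S (S r)) * k * moment_tail c r T x
        <= 2 ^ S (S (S r)) * (exp Z * k0) * KV * W).
    { assert (0 < 2 ^ S (S (S r))) by (apply pow_lt; lra).
      apply Rle_trans with (2 ^ S (S (S r)) * k * (KV * (1 + x ^ S (S r)) * T x)).
      - apply Rmult_le_compat_l; [nra|]. apply HV. lra.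
      - right. unfold W, k. ring. }
    assert (TL := tail_lower x th Hth Hx).
    assert (HEth := HE th Hth). rewrite HN in HEth.
    change (KE / th ^ S (S r)) with (KE * ep) in HEth.
    assert (HN1' : 1 <= INR N) by (apply (le_INR 1); exact HN1).
    assert (TL2 : INR N ^ 2 * exp (- (c / 2 * M * th ^ S r)) <= KE * W).
    { apply Rle_trans with (INR N ^ 2 * (T x * exp (- th ^ S r))).
      - apply Rmult_le_compat_l; [nra|exact TL].
      - apply Rle_trans with (T x * (KE * ep)); [|nra].
        replace (INR N ^ 2 * (T x * exp (- th ^ S r)))
          with (T x * (INR N ^ 2 * exp (- th ^ S r))) by ring.
        apply Rmult_le_compat_l; lra. }
    assert (Hq0 : 0 < INR (S r)) by (apply lt_0_INR; lia).
    assert (Hcq : 0 < / (c * INR (S r))) by (apply Rinv_0_lt_compat; nra).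
    assert (HX := exp_pos (- (c / 2 * M * th ^ S r))).
    assert (C3 : T (M * th) <= / (c * INR (S r)) * KE * W).
    { eapply Rle_trans; [apply (tail_upper c r T (M * th) Hc); [nra|exact HT]|].
      unfold Rdiv. rewrite Rmult_comm, Rmult_assoc. apply Rmult_le_compat_l; [lra|].
      apply Rle_trans with (exp (- (c / 2 * M * th ^ S r))).
      - apply exp_le, Ropp_le_contravar. rewrite Rpow_mult_distr.
        assert (M <= M ^ S r) by (rewrite <- (pow_1 M) at 1; apply Rle_pow; [lra|lia]).
        assert (c / 2 * (M * th ^ S r) <= c * (M ^ S r * th ^ S r)); [|lra].
        apply Rmult_le_compat; nra.
      - assert (1 <= INR N ^ 2) by nra. nra. }
    (* The number of far points is at most N + 1 and tau carries another factor N; hence the square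
       of N in [theta_exp_bound]. *)
    assert (C4 : h * INR (S N) * tau <= 2 * exp 1 * KE * W).
    { apply Rle_trans with (2 * INR N * tau).
      - apply Rmult_le_compat_r.
        + unfold tau. apply Rmult_le_pos; [|lra]. apply Rmult_le_pos; [lra|left; apply exp_pos].
        + rewrite S_INR. nra.
      - unfold tau. assert (E1 := exp_pos 1).
        replace (2 * INR N * (INR N * exp 1 * exp (- (c / 2 * M * th ^ S r))))
          with (2 * exp 1 * (INR N ^ 2 * exp (- (c / 2 * M * th ^ S r)))) by ring.
        rewrite (Rmult_assoc _ KE W). apply Rmult_le_compat_l; lra. }
    replace (Kb * (1 + x ^ S (S r)) / th ^ S (S r) * T x) with (Kb * W)
      by (unfold W, ep; field; lra).
    assert (C1' : (1 + bnd) * (h * epow c (S r) x) <= (1 + bnd) * (2 / s * km * W))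
      by (apply Rmult_le_compat_l; lra).
    unfold Kb. lra.
Qed.

End LaplaceTail.

(** * Maximizers of H *)

(** One step of the Taylor estimate, on both sides of m: the mean value theorem gains a power and
    keeps K, the factor 1 / (n + 1) of an integration being given up. *)
Lemma integrate_pow_bound (phi psi : R -> R) (m d K : R) (n : nat) :
  (forall u, Rabs (u - m) <= d -> is_derive phi u (psi u)) -> phi m = 0 -> 0 <= K ->
  (forall u, Rabs (u - m) <= d -> Rabs (psi u) <= K * Rabs (u - m) ^ n) ->
  forall u, Rabs (u - m) <= d -> Rabs (phi u) <= K * Rabs (u - m) ^ S n.
Proof.
  intros Hd H0 HK Hb u Hu.
  assert (B : forall x, Rmin m u <= x <= Rmax m u -> Rabs (x - m) <= Rabs (u - m)).
  { intros x. unfold Rmin, Rmax, Rabs.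
    destruct (Rle_dec m u); destruct (Rcase_abs (x - m)); destruct (Rcase_abs (u - m)); lra. }
  destruct (MVT_gen phi m u psi) as [x [Hx E]].
  - intros x Hx. apply Hd. assert (X := B x ltac:(lra)). lra.
  - intros x Hx. apply continuity_pt_filterlim.
    apply (ex_derive_continuous phi). exists (psi x). apply Hd. assert (X := B x Hx). lra.
  - rewrite H0, Rminus_0_r in E. rewrite E, Rabs_mult. simpl.
    assert (X := B x Hx).
    replace (K * (Rabs (u - m) * Rabs (u - m) ^ n))
      with (K * Rabs (u - m) ^ n * Rabs (u - m)) by ring.
    apply Rmult_le_compat_r; [apply Rabs_pos|].
    eapply Rle_trans; [apply Hb; lra|]. apply Rmult_le_compat_l; [exact HK|].
    apply pow_incr. split; [apply Rabs_pos|exact X].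
Qed.

(** F lists the successive derivatives; the induction on n passes to the shifted list, whose
    expansion at order n is then integrated once. *)
Lemma taylor_degenerate (n : nat) (F : nat -> R -> R) (m d K : R) : (1 <= n)%nat -> 0 <= K ->
  (forall k u, (k <= n)%nat -> Rabs (u - m) <= d -> is_derive (F k) u (F (S k) u)) ->
  (forall k, (1 <= k < n)%nat -> F k m = 0) ->
  (forall u, Rabs (u - m) <= d -> Rabs (F (S n) u) <= K) ->
  forall u, Rabs (u - m) <= d ->
  Rabs (F O u - F O m - F n m / INR (fact n) * (u - m) ^ n) <= K * Rabs (u - m) ^ S n.
Proof.
  intros Hn HK. revert F. induction Hn as [|n Hn IH]; intros F Hd Hz Hb.
  - apply (integrate_pow_bound _ (fun u => F 1%nat u - F 1%nat m)); [|simpl; field|exact HK|].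
    + intros u Hu. assert (D := Hd O u ltac:(lia) Hu).
      replace (F 1%nat u - F 1%nat m)
        with (F 1%nat u - 0 - F 1%nat m / INR (fact 1) * 1) by (simpl; field).
      apply (is_derive_minus (V := R_NormedModule)).
      * apply (is_derive_minus (V := R_NormedModule)); [exact D|].
        apply (is_derive_const (V := R_NormedModule)).
      * apply is_derive_scal. simpl. auto_derive; [trivial|ring].
    + apply (integrate_pow_bound _ (F 2%nat)); [|ring|exact HK|].
      * intros u Hu. rewrite <- (Rminus_0_r (F 2%nat u)).
        apply (is_derive_minus (V := R_NormedModule)); [apply Hd; [lia|exact Hu]|].
        apply (is_derive_const (V := R_NormedModule)).
      * intros u Hu. simpl. rewrite Rmult_1_r. now apply Hb.
  - assert (Hf : 0 < INR (fact n)) by (apply lt_0_INR, lt_O_fact).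
    assert (Hn1 : 0 < INR (S n)) by (apply lt_0_INR; lia).
    apply (integrate_pow_bound _ (fun u => F 1%nat u - F (S n) m / INR (fact n) * (u - m) ^ n));
      [| |exact HK|].
    + intros u Hu. assert (D := Hd O u ltac:(lia) Hu).
      replace (F 1%nat u - F (S n) m / INR (fact n) * (u - m) ^ n) with
        (F 1%nat u - 0 - F (S n) m / INR (fact (S n)) * (INR (S n) * (u - m) ^ n)).
      2:{ rewrite fact_simpl, mult_INR. field. lra. }
      apply (is_derive_minus (V := R_NormedModule)).
      * apply (is_derive_minus (V := R_NormedModule)); [exact D|].
        apply (is_derive_const (V := R_NormedModule)).
      * apply is_derive_scal. auto_derive; [trivial|].
        change (match n with 0%nat => 1 | S _ => INR n + 1 end) with (INR (S n)).
        change (u + - m) with (u - m). ring.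
    + rewrite !Rminus_diag. simpl pow. ring.
    + intros u Hu.
      assert (X := IH (fun k => F (S k)) ltac:(intros; apply Hd; [lia|assumption])
        ltac:(intros; apply Hz; lia) Hb u Hu). cbv beta in X.
      rewrite (Hz 1%nat ltac:(lia)), Rminus_0_r in X. exact X.
Qed.

Lemma local_max_coef (f : R -> R) (m a K d : R) (n : nat) : (1 <= n)%nat -> 0 < d -> 0 <= K ->
  (forall u, Rabs (u - m) <= d -> f u <= f m) ->
  (forall u, Rabs (u - m) <= d -> Rabs (f u - f m - a * (u - m) ^ n) <= K * Rabs (u - m) ^ S n) ->
  a <= 0 /\ (Nat.Odd n -> a = 0).
Proof.
  intros Hn Hd HK Hmax HT.
  assert (G : forall sg b : R, Rabs sg = 1 -> b = a * sg ^ n -> b <= 0).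
  { intros sg b Hsg Hb. destruct (Rle_lt_dec b 0) as [H|H]; [exact H|exfalso].
    (* For such t the remainder K t^(n+1) is below half of b t^n, so f would exceed f m at m + sg
       t. *)
    set (t := Rmin d (b / (2 * (K + 1)))).
    assert (Hq : 0 < b / (2 * (K + 1))) by (apply Rdiv_lt_0_compat; lra).
    assert (Ht : 0 < t) by (apply Rmin_pos; lra).
    assert (T1 := Rmin_l d (b / (2 * (K + 1)))). assert (T2 := Rmin_r d (b / (2 * (K + 1)))).
    fold t in T1, T2.
    assert (Ea : Rabs (m + sg * t - m) = t).
    { replace (m + sg * t - m) with (sg * t) by ring. rewrite Rabs_mult, Hsg, Rabs_pos_eq; lra. }
    assert (X := HT (m + sg * t) ltac:(lra)). assert (Y := Hmax (m + sg * t) ltac:(lra)).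
    rewrite Ea in X. replace (m + sg * t - m) with (sg * t) in X by ring.
    rewrite Rpow_mult_distr, <- Rmult_assoc, <- Hb in X. simpl in X.
    apply Rabs_le_between in X.
    assert (Htn : 0 < t ^ n) by now apply pow_lt.
    assert (Z : b * t ^ n <= K * t * t ^ n) by lra.
    apply Rmult_le_reg_r in Z; [|exact Htn].
    assert (W : (K + 1) * t <= (K + 1) * (b / (2 * (K + 1)))) by (apply Rmult_le_compat_l; lra).
    replace ((K + 1) * (b / (2 * (K + 1)))) with (b / 2) in W by (field; lra). lra. }
  split.
  - apply (G 1); [apply Rabs_R1|rewrite pow1; ring].
  - intros [k Hk].
    assert (a <= 0) by (apply (G 1); [apply Rabs_R1|rewrite pow1; ring]).
    assert (- a <= 0); [|lra].
    apply (G (-1)); [rewrite Rabs_left; lra|].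
    rewrite Hk, pow_add, pow_1_even. ring.
Qed.

(** [ln] is 0 on nonpositive numbers, so the function vanishes left of 0; right of 0, with t = s^2 <
    1, its absolute value is at most 2 s. This yields the continuity of H at -1 and 1 that the
    compactness argument of [max_gap] needs. *)
Lemma continuous_xlnx (x : R) : continuous (fun t => t * ln t) x.
Proof.
  destruct (total_order_T x 0) as [[Hx|Hx]|Hx].
  - apply (continuous_ext_loc _ (fun _ => 0)); [|apply continuous_const].
    exists (mkposreal (- x) ltac:(lra)). intros y Hy.
    change (Rabs (y - x) < - x) in Hy. apply Rabs_def2 in Hy.
    unfold ln. destruct (Rlt_dec 0 y); [exfalso; lra|symmetry; apply Rmult_0_r].
  - subst x. apply continuity_pt_filterlim. intros eps Heps.
    set (e2 := Rmin 1 ((eps / 2) ^ 2)).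
    assert (M1 := Rmin_l 1 ((eps / 2) ^ 2)). assert (M2 := Rmin_r 1 ((eps / 2) ^ 2)).
    fold e2 in M1, M2.
    assert (He2 : 0 < e2) by (apply Rmin_pos; nra).
    exists e2. split; [exact He2|]. intros t [_ Ht]. simpl in *. unfold Rdist in *.
    rewrite Rminus_0_r in Ht. rewrite Rmult_0_l, Rminus_0_r.
    destruct (Rle_lt_dec t 0) as [Hle|Hpos].
    { unfold ln. destruct (Rlt_dec 0 t); [exfalso; lra|]. rewrite Rmult_0_r, Rabs_R0. lra. }
    rewrite Rabs_pos_eq in Ht by lra.
    assert (Hs := sqrt_lt_R0 t Hpos). assert (Ess := sqrt_sqrt t ltac:(lra)).
    set (s := sqrt t) in *.
    assert (Hse : s < eps / 2).
    { apply Rnot_le_lt. intros Hc. assert ((eps / 2) ^ 2 <= s ^ 2) by (apply pow_incr; lra).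
      simpl in *. lra. }
    assert (Hl : ln t <= 0) by (rewrite <- ln_1; apply ln_le; lra).
    assert (Hs0 : - ln s <= / s).
    { rewrite <- ln_Rinv by lra.
      assert (X := exp_ineq1_le (ln (/ s))).
      rewrite exp_ln in X by now apply Rinv_0_lt_compat. lra. }
    assert (El : ln t = 2 * ln s) by (rewrite <- Ess, ln_mult by lra; ring).
    rewrite Rabs_mult, (Rabs_pos_eq t), (Rabs_left1 (ln t)) by lra.
    apply Rle_lt_trans with (t * (2 * / s)).
    + apply Rmult_le_compat_l; lra.
    + rewrite <- Ess. replace (s * s * (2 * / s)) with (2 * s) by (field; lra). lra.
  - apply (ex_derive_continuous (fun t => t * ln t)). auto_derive. lra.
Qed.

(** * Continuity, derivatives and Taylor expansion of H *)

Lemma Ient_even (u : R) : Ient (- u) = Ient u.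
Proof.
  unfold Ient. replace (1 + - u) with (1 - u) by ring.
  replace (1 - - u) with (1 + u) by ring. ring.
Qed.

Lemma continuous_Hfun (beta h : R) (p : nat) (x : R) : continuous (Hfun beta h p) x.
Proof.
  unfold Hfun, Ient.
  apply (continuous_minus (V := R_NormedModule) (fun x => beta * x ^ p + h * x)).
  - apply (ex_derive_continuous (fun x => beta * x ^ p + h * x)). auto_derive. trivial.
  - apply (continuous_scal_r (V := R_NormedModule) (/ 2)
      (fun x => (1 + x) * ln (1 + x) + (1 - x) * ln (1 - x))).
    apply (continuous_plus (V := R_NormedModule)
      (fun x => (1 + x) * ln (1 + x)) (fun x => (1 - x) * ln (1 - x))).
    + apply (continuous_comp (fun x => 1 + x) (fun t => t * ln t)); [|apply continuous_xlnx].
      apply (ex_derive_continuous (fun x => 1 + x)). auto_derive. trivial.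
    + apply (continuous_comp (fun x => 1 - x) (fun t => t * ln t)); [|apply continuous_xlnx].
      apply (ex_derive_continuous (fun x => 1 - x)). auto_derive. trivial.
Qed.

(** Closed forms of the derivatives of H up to order five. Where the exponent p - k is truncated to
    0, the coefficient already contains a factor [INR 0]. *)
Definition Hd (beta h : R) (p k : nat) (x : R) : R :=
  match k with
  | 0%nat => Hfun beta h p x
  | 1%nat => beta * INR p * x ^ (p - 1) + h - / 2 * (ln (1 + x) - ln (1 - x))
  | 2%nat => beta * INR p * INR (p - 1) * x ^ (p - 2) - 1 / (1 - x ^ 2)
  | 3%nat => beta * INR p * INR (p - 1) * INR (p - 2) * x ^ (p - 3) - 2 * x / (1 - x ^ 2) ^ 2
  | 4%nat => beta * INR p * INR (p - 1) * INR (p - 2) * INR (p - 3) * x ^ (p - 4)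
         - (2 + 6 * x ^ 2) / (1 - x ^ 2) ^ 3
  | _ => beta * INR p * INR (p - 1) * INR (p - 2) * INR (p - 3) * INR (p - 4) * x ^ (p - 5)
         - (24 * x + 24 * x ^ 3) / (1 - x ^ 2) ^ 4
  end.

Lemma Hd_derive (beta h : R) (p k : nat) (x : R) : (k <= 4)%nat -> -1 < x < 1 ->
  is_derive (Hd beta h p k) x (Hd beta h p (S k) x).
Proof.
  intros Hk Hx. assert (Hx2 : 1 - x ^ 2 <> 0) by nra.
  assert (Hx2' : 1 - x * x <> 0) by nra.
  destruct k as [|[|[|[|[|k]]]]]; [| | | | |lia]; unfold Hd.
  - unfold Hfun, Ient. auto_derive; [lra|].
    replace (pred p) with (p - 1)%nat by lia. change (1 + - x) with (1 - x). field. lra.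
  - auto_derive; [lra|]. replace (pred (p - 1)) with (p - 2)%nat by lia. field. simpl. nra.
  - auto_derive; [simpl; lra|]. replace (pred (p - 2)) with (p - 3)%nat by lia. simpl. field. nra.
  - auto_derive. { simpl. intros E. apply Hx2'. nra. }
    replace (pred (p - 3)) with (p - 4)%nat by lia. simpl. field. nra.
  - auto_derive. { apply (pow_nonzero _ 3 Hx2). }
    replace (pred (p - 4)) with (p - 5)%nat by lia. simpl. field. nra.
Qed.

Lemma Hder_Hd (beta h : R) (p k : nat) (x : R) : (k <= 4)%nat -> -1 < x < 1 ->
  Hder beta h p k x = Hd beta h p k x.
Proof.
  unfold Hder. revert x. induction k as [|k IH]; intros x Hk Hx; [reflexivity|].
  simpl Derive_n. rewrite (Derive_ext_loc _ (Hd beta h p k)).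
  - apply is_derive_unique, Hd_derive; [lia|exact Hx].
  - assert (Hr : 0 < Rmin (1 - x) (1 + x)) by (apply Rmin_pos; lra).
    exists (mkposreal _ Hr). intros y Hy.
    change (Rabs (y - x) < Rmin (1 - x) (1 + x)) in Hy. apply Rabs_def2 in Hy.
    assert (R1 := Rmin_l (1 - x) (1 + x)). assert (R2 := Rmin_r (1 - x) (1 + x)).
    apply IH; [lia|lra].
Qed.

Lemma Hd_bounded (beta h : R) (p k : nat) (m : R) : (k <= 5)%nat -> -1 < m < 1 ->
  exists K d, 0 < K /\ 0 < d /\ (forall u, Rabs (u - m) <= d -> -1 < u < 1) /\
  forall u, Rabs (u - m) <= d -> Rabs (Hd beta h p k u) <= K.
Proof.
  intros Hk Hm.
  assert (Cn : continuous (Hd beta h p k) m).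
  { destruct (Nat.eq_dec k 5) as [->|Hk5].
    - apply (ex_derive_continuous (Hd beta h p 5)). unfold Hd. auto_derive.
      apply (pow_nonzero _ 4). nra.
    - apply (ex_derive_continuous (Hd beta h p k)). eexists. apply Hd_derive; [lia|exact Hm]. }
  apply continuity_pt_filterlim in Cn. destruct (Cn 1 Rlt_0_1) as [a [Ha Hc]].
  exists (Rabs (Hd beta h p k m) + 1), (Rmin (a / 2) (Rmin ((1 - m) / 2) ((1 + m) / 2))).
  set (d := Rmin (a / 2) _).
  assert (D1 : d <= a / 2) by apply Rmin_l.
  assert (D2 : d <= Rmin ((1 - m) / 2) ((1 + m) / 2)) by apply Rmin_r.
  assert (D3 := Rmin_l ((1 - m) / 2) ((1 + m) / 2)).
  assert (D4 := Rmin_r ((1 - m) / 2) ((1 + m) / 2)).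
  assert (P := Rabs_pos (Hd beta h p k m)).
  split; [lra|]. split; [|split].
  - unfold d. repeat apply Rmin_pos; lra.
  - intros u Hu. apply Rabs_le_between in Hu. lra.
  - intros u Hu. destruct (Req_dec u m) as [->|Hne]; [lra|].
    assert (X : Rabs (Hd beta h p k u - Hd beta h p k m) < 1).
    { apply (Hc u). split; [split; [exact I|intros E; apply Hne; now symmetry]|].
      simpl. unfold Rdist. lra. }
    assert (Y := Rabs_triang (Hd beta h p k u - Hd beta h p k m) (Hd beta h p k m)).
    replace (Hd beta h p k u - Hd beta h p k m + Hd beta h p k m)
      with (Hd beta h p k u) in Y by ring. lra.
Qed.

Lemma Hfun_taylor (beta h : R) (p n : nat) (m : R) : (1 <= n <= 4)%nat -> -1 < m < 1 ->
  (forall k, (1 <= k < n)%nat -> Hd beta h p k m = 0) ->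
  exists K d, 0 < K /\ 0 < d /\ (forall u, Rabs (u - m) <= d -> -1 < u < 1) /\
  forall u, Rabs (u - m) <= d ->
  Rabs (Hfun beta h p u - Hfun beta h p m - Hd beta h p n m / INR (fact n) * (u - m) ^ n)
  <= K * Rabs (u - m) ^ S n.
Proof.
  intros Hn Hm Hz.
  destruct (Hd_bounded beta h p (S n) m ltac:(lia) Hm) as [K [d [HK [Hd0 [Hin Hb]]]]].
  exists K, d. split; [exact HK|]. split; [exact Hd0|]. split; [exact Hin|].
  apply (taylor_degenerate n (Hd beta h p)); [lia|lra| |exact Hz|exact Hb].
  intros k u Hk Hu. apply Hd_derive; [lia|]. now apply Hin.
Qed.

Section Maximizers.

Variables (beta h : R) (p : nat).
Hypotheses (Hp : (3 <= p)%nat) (Hbeta : 0 < beta) (Hh : 0 < h).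

Lemma max_coef (m : R) (n : nat) : (1 <= n <= 4)%nat -> -1 < m < 1 -> is_global_max beta h p m ->
  (forall k, (1 <= k < n)%nat -> Hd beta h p k m = 0) ->
  Hd beta h p n m <= 0 /\ (Nat.Odd n -> Hd beta h p n m = 0).
Proof.
  intros Hn Hm [_ Hmax] Hz.
  destruct (Hfun_taylor beta h p n m Hn Hm Hz) as [K [d [HK [Hd0 [Hin HT]]]]].
  assert (Hf : 0 < INR (fact n)) by (apply lt_0_INR, lt_O_fact).
  destruct (local_max_coef (Hfun beta h p) m (Hd beta h p n m / INR (fact n)) K d n)
    as [L1 L2]; [lia|lra|lra| |exact HT|].
  - intros u Hu. apply Hmax. specialize (Hin u Hu). lra.
  - replace (Hd beta h p n m) with (Hd beta h p n m / INR (fact n) * INR (fact n)) by (field; lra).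
    split; [nra|]. intros Ho. rewrite (L2 Ho). ring.
Qed.

(** The entropy has infinite slope at 1, so a small step inwards gains more than the energy
    loses. *)
Lemma Hfun_1_not_max : ~ is_global_max beta h p 1.
Proof.
  intros [_ Hmax].
  (* By Bernoulli's inequality the energy loses at most (beta p + h) t, while - t ln t / 2 equals
     (beta p + h + 1/2) t. *)
  set (t := exp (- (2 * (beta * INR p + h) + 1))).
  assert (Hpp : 0 < INR p) by (apply lt_0_INR; lia).
  assert (Ht0 : 0 < t) by apply exp_pos.
  assert (Hbp : 0 < beta * INR p) by nra.
  assert (Ht1 : t < 1) by (rewrite <- exp_0; apply exp_increasing; lra).
  specialize (Hmax (1 - t) ltac:(lra)). unfold Hfun, Ient in Hmax.
  rewrite pow1 in Hmax.
  replace (1 + (1 - t)) with (2 - t) in Hmax by ring.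
  replace (1 - (1 - t)) with t in Hmax by ring.
  replace (1 + 1) with 2 in Hmax by ring. rewrite (Rminus_diag 1), Rmult_0_l in Hmax.
  assert (Et : ln t = - (2 * (beta * INR p + h) + 1)) by apply ln_exp.
  assert (L2 : 0 < ln 2) by (rewrite <- ln_1; apply ln_increasing; lra).
  assert (L3 : ln (2 - t) <= ln 2) by (apply ln_le; lra).
  assert (L4 : (2 - t) * ln (2 - t) <= 2 * ln 2).
  { apply Rle_trans with ((2 - t) * ln 2); [apply Rmult_le_compat_l; lra|nra]. }
  assert (Bern : 1 - INR p * t <= (1 - t) ^ p).
  { assert (X := pow_diff_le (p - 1) (1 - t) 1 ltac:(lra)).
    replace (S (p - 1)) with p in X by lia. rewrite !pow1 in X. lra. }
  rewrite Et in Hmax. nra.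
Qed.

(** For m < 0 the field h makes H (- m) > H m, and H' (0) = h > 0 excludes 0. *)
Lemma max_interior (m : R) : is_global_max beta h p m -> 0 < m < 1.
Proof.
  intros HG. assert (HG' := HG). destruct HG' as [Hm Hmax].
  assert (Hm1 : m <> 1) by (intros ->; now apply Hfun_1_not_max).
  destruct (Rlt_le_dec 0 m) as [H|[H|H]]; [lra| |].
  - exfalso. specialize (Hmax (- m) ltac:(lra)). unfold Hfun in Hmax.
    rewrite Ient_even in Hmax.
    assert (X : m ^ p <= (- m) ^ p).
    { rewrite <- (Rabs_pos_eq (- m)), Rabs_Ropp by lra. rewrite RPow_abs. apply Rle_abs. }
    nra.
  - exfalso. subst m.
    destruct (max_coef 0 1 ltac:(lia) ltac:(lra) HG ltac:(lia)) as [_ Ho].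
    specialize (Ho ltac:(now exists 0%nat)). unfold Hd in Ho.
    rewrite pow_i in Ho by lia. rewrite Rplus_0_r, Rminus_0_r, Rminus_diag in Ho. lra.
Qed.

Lemma max_critical (m : R) : is_global_max beta h p m -> Hd beta h p 1 m = 0.
Proof.
  intros HG. assert (Hm := max_interior m HG).
  destruct (max_coef m 1 ltac:(lia) ltac:(lra) HG ltac:(lia)) as [_ Ho].
  apply Ho. now exists 0%nat.
Qed.

(** At a maximum the first nonvanishing derivative has even order, so H''' vanishes too; dividing
    H''' = 0 by H'' = 0 leaves a relation between p and m alone. *)
Lemma max_degenerate (m : R) : is_global_max beta h p m -> Hd beta h p 2 m = 0 ->
  Hd beta h p 3 m = 0 /\ beta * INR p * INR (p - 1) * (m ^ (p - 2) * (1 - m ^ 2)) = 1 /\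
  INR (p - 2) * (1 - m ^ 2) = 2 * m ^ 2.
Proof.
  intros HG H2. assert (Hm := max_interior m HG).
  assert (Hm2 : 0 < 1 - m ^ 2) by nra.
  destruct (max_coef m 3 ltac:(lia) ltac:(lra) HG) as [_ Ho].
  { intros k Hk. assert (k = 1 \/ k = 2)%nat as [-> | ->] by lia; [|exact H2].
    now apply max_critical. }
  assert (H3 : Hd beta h p 3 m = 0) by (apply Ho; now exists 1%nat).
  split; [exact H3|].
  assert (E2 : beta * INR p * INR (p - 1) * m ^ (p - 2) = 1 / (1 - m ^ 2)) by (unfold Hd in H2; lra).
  split.
  - rewrite <- Rmult_assoc, E2. field. lra.
  - unfold Hd in H3.
    replace (p - 2)%nat with (S (p - 3)) in E2 by lia. simpl pow in E2 at 1.
    apply (f_equal (fun z => z * m * (1 - m ^ 2) ^ 2)) in H3.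
    rewrite Rmult_0_l, Rmult_0_l in H3.
    replace ((beta * INR p * INR (p - 1) * INR (p - 2) * m ^ (p - 3)
      - 2 * m / (1 - m ^ 2) ^ 2) * m * (1 - m ^ 2) ^ 2) with
      (beta * INR p * INR (p - 1) * (m * m ^ (p - 3)) * INR (p - 2) * (1 - m ^ 2) ^ 2
       - 2 * m ^ 2) in H3 by (field; lra).
    rewrite E2 in H3.
    replace (1 / (1 - m ^ 2) * INR (p - 2) * (1 - m ^ 2) ^ 2)
      with (INR (p - 2) * (1 - m ^ 2)) in H3 by (field; lra). lra.
Qed.

(** The relations of [max_degenerate] express everything through w = m^2 and give H^(4) (m) w = - 4
    w / (1 - w)^3. *)
Lemma max_degenerate_fourth (m : R) : is_global_max beta h p m -> Hd beta h p 2 m = 0 ->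
  Hd beta h p 4 m < 0.
Proof.
  intros HG H2. assert (Hm := max_interior m HG).
  destruct (max_degenerate m HG H2) as [_ [E2 E3]].
  assert (Hm2 : 0 < 1 - m ^ 2) by nra.
  assert (Ep : INR (p - 3) = INR (p - 2) - 1).
  { replace (p - 2)%nat with (S (p - 3)) by lia. rewrite S_INR. ring. }
  assert (E4 : Hd beta h p 4 m * m ^ 2 =
    beta * INR p * INR (p - 1) * m ^ (p - 2) * INR (p - 2) * INR (p - 3)
    - (2 + 6 * m ^ 2) * m ^ 2 / (1 - m ^ 2) ^ 3).
  { unfold Hd. destruct (Nat.eq_dec p 3) as [-> | Hne].
    - simpl. field. nra.
    - replace (p - 2)%nat with (S (S (p - 4))) at 2 by lia. simpl. field. nra. }
  set (w := m ^ 2) in *.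
  assert (F1 : beta * INR p * INR (p - 1) * m ^ (p - 2) = / (1 - w)).
  { apply (Rmult_eq_reg_r (1 - w)); [|lra]. rewrite Rinv_l by lra. lra. }
  assert (F2 : INR (p - 2) = 2 * w / (1 - w)).
  { apply (Rmult_eq_reg_r (1 - w)); [|lra]. rewrite E3. field. lra. }
  rewrite F1, Ep, F2 in E4.
  replace (/ (1 - w) * (2 * w / (1 - w)) * (2 * w / (1 - w) - 1) -
     (2 + 6 * w) * w / (1 - w) ^ 3) with (- (4 * w / (1 - w) ^ 3)) in E4 by (field; lra).
  assert (Hw : 0 < w) by (unfold w; nra).
  assert (P : 0 < 4 * w / (1 - w) ^ 3) by (apply Rdiv_lt_0_compat; [lra|now apply pow_lt]).
  nra.
Qed.

(* At a degenerate maximizer, x^(p-2) (1 - x^2) attains its maximum, so H is strictly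
   concave elsewhere on (0, 1). *)
Lemma degenerate_concave (m x : R) : is_global_max beta h p m -> Hd beta h p 2 m = 0 ->
  0 < x < 1 -> x <> m -> Hd beta h p 2 x < 0.
Proof.
  intros HG H2 Hx Hne. assert (Hm := max_interior m HG).
  destruct (max_degenerate m HG H2) as [_ [E2 E3]].
  set (G := fun x => x ^ (p - 2) * (1 - x ^ 2)).
  (* By [E3] the bracket vanishes at m, and it decreases in x^2; hence G increases up to m and
     decreases after it. *)
  set (dG := fun x => x ^ (p - 3) * (INR (p - 2) * (1 - x ^ 2) - 2 * x ^ 2)).
  assert (HdG : forall t, is_derive G t (dG t)).
  { intros t. unfold G, dG. replace (p - 2)%nat with (S (p - 3)) by lia.
    auto_derive; [trivial|].
    change (match (p - 3)%nat with 0%nat => 1 | S _ => INR (p - 3) + 1 end) with (INR (S (p - 3))).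
    simpl. ring. }
  assert (Hq : 0 < INR (p - 2)) by (apply lt_0_INR; lia).
  assert (HGx : G x < G m).
  { destruct (Rtotal_order x m) as [H|[H|H]]; [|contradiction|].
    - destruct (is_derive_mvt G dG x m H (fun t _ => HdG t)) as [z [Hz E]].
      assert (0 < z ^ (p - 3)) by (apply pow_lt; lra).
      assert (0 < INR (p - 2) * (1 - z ^ 2) - 2 * z ^ 2).
      { assert (z ^ 2 < m ^ 2) by nra. nra. }
      assert (0 < dG z) by (apply Rmult_lt_0_compat; lra). nra.
    - destruct (is_derive_mvt G dG m x H (fun t _ => HdG t)) as [z [Hz E]].
      assert (0 < z ^ (p - 3)) by (apply pow_lt; lra).
      assert (INR (p - 2) * (1 - z ^ 2) - 2 * z ^ 2 < 0).
      { assert (m ^ 2 < z ^ 2) by nra. nra. }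
      assert (dG z < 0) by (unfold dG; nra). nra. }
  assert (HA : 0 < beta * INR p * INR (p - 1)).
  { apply Rmult_lt_0_compat; [apply Rmult_lt_0_compat; [exact Hbeta|]|]; apply lt_0_INR; lia. }
  fold (G m) in E2.
  assert (Hx2 : 0 < 1 - x ^ 2) by nra.
  replace (Hd beta h p 2 x) with ((beta * INR p * INR (p - 1) * G x - 1) / (1 - x ^ 2)).
  2:{ unfold Hd, G. field. lra. }
  apply Rmult_neg_pos; [|now apply Rinv_0_lt_compat].
  assert (beta * INR p * INR (p - 1) * G x < beta * INR p * INR (p - 1) * G m)
    by (apply Rmult_lt_compat_l; lra). lra.
Qed.

Lemma critical_max_nondegenerate (m : R) : p_critical beta h p -> is_global_max beta h p m ->
  Hd beta h p 2 m < 0.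
Proof.
  intros [m1 [m2 [Hne [HG1 HG2]]]] HG.
  assert (Hm := max_interior m HG).
  assert (exists m', m' <> m /\ is_global_max beta h p m') as [m' [Hm' HG']].
  { destruct (Req_dec m1 m) as [->|H]; [|now exists m1]. exists m2. split; [|exact HG2].
    intros E; apply Hne; now symmetry. }
  destruct (max_coef m 2 ltac:(lia) ltac:(lra) HG) as [[Hlt|H2] _]; [|exact Hlt|exfalso].
  { intros k Hk. assert (k = 1)%nat as -> by lia. now apply max_critical. }
  assert (Hmi := max_interior m' HG').
  assert (Z := max_critical m HG). assert (Z' := max_critical m' HG').
  assert (D : forall t, 0 < t < 1 -> is_derive (Hd beta h p 1) t (Hd beta h p 2 t))
    by (intros t Ht; apply Hd_derive; [lia|lra]).
  (* H' vanishes at both maximizers, so H'' would vanish at a point strictly between them, where it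
     is negative. *)
  destruct (Rtotal_order m m') as [H|[H|H]]; [|now apply Hm'; symmetry|].
  - destruct (is_derive_mvt _ (Hd beta h p 2) m m' H ltac:(intros; apply D; lra)) as [z [Hz E]].
    assert (X := degenerate_concave m z HG H2 ltac:(lra) ltac:(lra)). nra.
  - destruct (is_derive_mvt _ (Hd beta h p 2) m' m H ltac:(intros; apply D; lra)) as [z [Hz E]].
    assert (X := degenerate_concave m z HG H2 ltac:(lra) ltac:(lra)). nra.
Qed.

(** Compactness: without a gap, points of A at distance at least d from m with H tending to the
    maximum accumulate at another global maximizer, which lies in the closure of A. *)
Lemma max_gap (m : R) (A : R -> Prop) (d : R) : is_global_max beta h p m -> 0 < d ->
  (forall m', is_global_max beta h p m' -> m' <> m -> ~ in_closure A m') ->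
  exists eta, 0 < eta /\ forall u, A u -> -1 <= u <= 1 -> d <= Rabs (u - m) ->
  Hfun beta h p u <= Hfun beta h p m - eta.
Proof.
  clear Hp Hbeta Hh. intros HG Hd0 HA.
  destruct (excluded_middle_informative (exists eta, 0 < eta /\ forall u, A u -> -1 <= u <= 1 ->
    d <= Rabs (u - m) -> Hfun beta h p u <= Hfun beta h p m - eta)) as [H|H]; [exact H|exfalso].
  assert (S : forall n : nat, exists u, A u /\ -1 <= u <= 1 /\ d <= Rabs (u - m) /\
    Hfun beta h p m - / INR (S n) < Hfun beta h p u).
  { intros n. destruct (excluded_middle_informative (exists u, A u /\ -1 <= u <= 1 /\
      d <= Rabs (u - m) /\ Hfun beta h p m - / INR (S n) < Hfun beta h p u)) as [E|E]; [exact E|].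
    exfalso. apply H. exists (/ INR (S n)). split; [apply Rinv_0_lt_compat, lt_0_INR; lia|].
    intros u H1 H2 H3. destruct (Rle_lt_dec (Hfun beta h p u) (Hfun beta h p m - / INR (S n)));
      [assumption|]. exfalso. apply E. now exists u. }
  destruct (choice (fun n u => A u /\ -1 <= u <= 1 /\ d <= Rabs (u - m) /\
    Hfun beta h p m - / INR (Datatypes.S n) < Hfun beta h p u) S) as [un Hun].
  destruct (Bolzano_Weierstrass un (fun x => -1 <= x <= 1)) as [l Hl].
  { apply compact_P3. }
  { intros n. apply Hun. }
  assert (near : forall e n, 0 < e -> exists k, (n <= k)%nat /\ Rabs (un k - l) < e).
  { intros e n He. destruct (Hl (disc l (mkposreal e He)) n) as [k [Hk Hk2]].
    - exists (mkposreal e He). intros y Hy. exact Hy.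
    - exists k. split; [lia|exact Hk2]. }
  assert (Hl1 : -1 <= l <= 1).
  { split; apply Rnot_lt_le; intros Hlt.
    - destruct (near (-1 - l) O ltac:(lra)) as [k [_ Hk]]. apply Rabs_def2 in Hk.
      destruct (Hun k) as [_ [Hb _]]. lra.
    - destruct (near (l - 1) O ltac:(lra)) as [k [_ Hk]]. apply Rabs_def2 in Hk.
      destruct (Hun k) as [_ [Hb _]]. lra. }
  assert (Hlm : l <> m).
  { intros ->. destruct (near d O Hd0) as [k [_ Hk]].
    destruct (Hun k) as [_ [_ [Hb _]]]. lra. }
  assert (HlA : in_closure A l).
  { intros e He. destruct (near e O He) as [k [_ Hk]]. exists (un k).
    split; [apply Hun|exact Hk]. }
  assert (HlH : Hfun beta h p m <= Hfun beta h p l).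
  { apply Rnot_lt_le. intros Hlt.
    set (gam := (Hfun beta h p m - Hfun beta h p l) / 2).
    assert (Hgam : 0 < gam) by (unfold gam; lra).
    assert (Cn := continuous_Hfun beta h p l). apply continuity_pt_filterlim in Cn.
    destruct (Cn gam Hgam) as [a [Ha Hc]].
    destruct (archimed_cor1 gam Hgam) as [n0 [Hn0 Hn0']].
    destruct (near a n0 Ha) as [k [Hk1 Hk2]].
    destruct (Hun k) as [_ [_ [_ Hb]]].
    assert (Hin : / INR (Datatypes.S k) <= / INR n0).
    { apply Rinv_le_contravar; [apply lt_0_INR; lia|]. apply le_INR. lia. }
    destruct (Req_dec (un k) l) as [E|E].
    - rewrite E in Hb. unfold gam in *. lra.
    - assert (X : Rabs (Hfun beta h p (un k) - Hfun beta h p l) < gam).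
      { apply (Hc (un k)). split; [split; [exact I|intros E'; apply E; now symmetry]|exact Hk2]. }
      apply Rabs_def2 in X. unfold gam in *. lra. }
  apply (HA l); [|exact Hlm|exact HlA].
  split; [exact Hl1|]. intros y Hy. destruct HG as [_ Hmax]. specialize (Hmax y Hy). lra.
Qed.

End Maximizers.

(** * Gaussian and Gamma integrals *)

Lemma is_derive_RInt_continuous (f : R -> R) (a x : R) : (forall y, continuous f y) ->
  is_derive (fun b => RInt f a b) x (f x).
Proof.
  intros Hf. apply (is_derive_RInt f (fun b => RInt f a b) a x); [|apply Hf].
  apply filter_forall. intros b. apply (RInt_correct (V := R_CompleteNormedModule)).
  apply (ex_RInt_continuous (V := R_CompleteNormedModule)). intros; apply Hf.
Qed.

(** The majorant has a bounded explicit antiderivative, a multiple of [atan]; this gives convergence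
    in [tail_exists]. *)
Lemma epow_le_cauchy (c : R) (q : nat) (x : R) : 0 < c -> (2 <= q)%nat -> 0 <= x ->
  epow c q x <= 2 * (1 + / c) * / (1 + x ^ 2).
Proof.
  intros Hc Hq Hx. unfold epow. rewrite exp_Ropp.
  assert (E := exp_ineq1_le (c * x ^ q)).
  assert (Hx0 : 0 <= x ^ q) by now apply pow_le.
  assert (Hic : 0 < / c) by now apply Rinv_0_lt_compat.
  assert (B : 1 + x ^ 2 <= 2 * (1 + x ^ q)).
  { destruct (Rle_lt_dec x 1); [simpl; nra|].
    assert (x ^ 2 <= x ^ q) by (apply Rle_pow; [lra|exact Hq]). nra. }
  assert (B2 : 1 + x ^ q <= (1 + / c) * (1 + c * x ^ q)).
  { replace ((1 + / c) * (1 + c * x ^ q)) with (1 + x ^ q + / c + c * x ^ q) by (field; lra). nra. }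
  assert (Hp : 0 < 1 + x ^ 2) by nra.
  apply (Rmult_le_reg_r (exp (c * x ^ q) * (1 + x ^ 2))).
  - apply Rmult_lt_0_compat; [apply exp_pos|exact Hp].
  - assert (P := exp_pos (c * x ^ q)).
    replace (/ exp (c * x ^ q) * (exp (c * x ^ q) * (1 + x ^ 2))) with (1 + x ^ 2) by (field; lra).
    replace (2 * (1 + / c) * / (1 + x ^ 2) * (exp (c * x ^ q) * (1 + x ^ 2)))
      with (2 * ((1 + / c) * exp (c * x ^ q))) by (field; lra).
    apply Rle_trans with (2 * ((1 + / c) * (1 + c * x ^ q))); [lra|].
    apply Rmult_le_compat_l; [lra|]. apply Rmult_le_compat_l; lra.
Qed.

Lemma tail_exists (c : R) (q : nat) : 0 < c -> (2 <= q)%nat -> exists T, is_tail c q T.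
Proof.
  intros Hc Hq.
  set (F := fun x => RInt (epow c q) 0 x).
  assert (HF : forall x, is_derive F x (epow c q x)).
  { intros x. apply is_derive_RInt_continuous. intros; apply epow_continuous. }
  assert (HF0 : F 0 = 0) by (unfold F; apply (RInt_point (V := R_CompleteNormedModule))).
  assert (Hinc : forall x y, x <= y -> F x <= F y).
  { intros x y [H|<-]; [|lra].
    destruct (is_derive_mvt F _ x y H (fun z _ => HF z)) as [z [Hz E]].
    assert (P := epow_pos c q z). nra. }
  set (K := 2 * (1 + / c)).
  assert (HK : 0 < K) by (assert (Hic := Rinv_0_lt_compat c Hc); unfold K; lra).
  assert (HB : forall x, 0 <= x -> F x <= K * (PI / 2)).
  { intros x Hx. apply Rle_trans with (K * atan x).
    - assert (0 <= K * atan x - F x); [|lra].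
      apply (nonneg_of_derive (fun x => K * atan x - F x)
        (fun x => K * / (1 + x ^ 2) - epow c q x) 0 x Hx).
      + rewrite HF0, atan_0. lra.
      + intros y _. apply (is_derive_minus (V := R_NormedModule)); [|apply HF].
        apply is_derive_scal. auto_derive; [trivial|]. simpl. field. nra.
      + intros y Hy. assert (X := epow_le_cauchy c q y Hc Hq ltac:(lra)). fold K in X. lra.
    - apply Rmult_le_compat_l; [lra|]. assert (X := atan_bound x). lra. }
  destruct (completeness (fun z => exists x, 0 <= x /\ z = F x)) as [L [HL1 HL2]].
  { exists (K * (PI / 2)). intros z [x [Hx ->]]. now apply HB. }
  { exists (F 0). exists 0. split; [lra|reflexivity]. }
  exists (fun x => L - F x). split.
  - intros y. replace (- epow c q y) with (0 - epow c q y) by ring.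
    apply (is_derive_minus (V := R_NormedModule)); [|apply HF].
    apply (is_derive_const (V := R_NormedModule)).
  - apply (is_lim_spec (fun x => L - F x) p_infty 0). intros eps.
    assert (He := cond_pos eps).
    assert (exists x0, 0 <= x0 /\ L - eps < F x0) as [x0 [Hx0 HFx0]].
    { destruct (excluded_middle_informative (exists x0, 0 <= x0 /\ L - eps < F x0)) as [H|H];
        [exact H|exfalso].
      assert (L <= L - eps); [|lra]. apply HL2. intros z [x [Hx ->]].
      apply Rnot_lt_le. intros Hlt. apply H. now exists x. }
    exists x0. intros x Hx. simpl. rewrite Rminus_0_r.
    assert (F x <= L) by (apply HL1; exists x; split; [lra|reflexivity]).
    assert (X := Hinc x0 x ltac:(lra)). rewrite Rabs_pos_eq; lra.
Qed.

(** The fundamental theorem is required only eventually along the filters, which admits the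
    singularity at 0 of the Gamma integrand. *)
Lemma is_RInt_gen_antiderivative (f F : R -> R) (Fa Fb : (R -> Prop) -> Prop) (la lb : R) :
  Filter Fa -> Filter Fb ->
  filter_prod Fa Fb (fun ab => is_RInt f (fst ab) (snd ab) (F (snd ab) - F (fst ab))) ->
  filterlim F Fa (locally la) -> filterlim F Fb (locally lb) ->
  is_RInt_gen f Fa Fb (lb - la).
Proof.
  intros FFa FFb HI Ha Hb P HP.
  assert (HL : filterlim (fun ab : R * R => F (snd ab) - F (fst ab)) (filter_prod Fa Fb)
                 (locally (lb - la))).
  { apply (filterlim_comp_2 (F := filter_prod Fa Fb) (G := locally lb)
      (H := locally (- la)) (fun ab : R * R => F (snd ab)) (fun ab => - F (fst ab)) Rplus).
    - eapply filterlim_comp; [apply filterlim_snd|exact Hb].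
    - eapply (filterlim_comp _ _ _ (fun ab : R * R => F (fst ab)) Ropp).
      + eapply filterlim_comp; [apply filterlim_fst|exact Ha].
      + apply (filterlim_opp (V := R_NormedModule)).
    - apply (filterlim_plus (V := R_NormedModule) lb (- la)). }
  specialize (HL P HP). unfold filtermap in HL.
  change (filter_prod Fa Fb (fun ab => exists y, is_RInt f (fst ab) (snd ab) y /\ P y)).
  generalize (filter_and _ _ HI HL). apply filter_imp. intros ab [H1 H2].
  now exists (F (snd ab) - F (fst ab)).
Qed.

Section Cdf.

Variables (c : R) (q : nat) (T : R -> R).
Hypotheses (Hc : 0 < c) (Hq : Nat.Even q) (HT : is_tail c q T).

Lemma epow_even (y : R) : epow c q (- y) = epow c q y.
Proof.
  unfold epow. destruct Hq as [k ->]. now rewrite !pow_mult, <- !Rsqr_pow2, <- Rsqr_neg.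
Qed.

(** Since [epow] is even, T (- z) + T z has derivative 0. *)
Lemma tail_reflect (y : R) : T (- y) = 2 * T 0 - T y.
Proof.
  destruct HT as [Hd _].
  assert (D : forall z, is_derive (fun z => T (- z) + T z) z 0).
  { intros z. replace 0 with (- 1 * - epow c q (- z) + - epow c q z) by (rewrite epow_even; ring).
    apply (is_derive_plus (V := R_NormedModule)); [|apply Hd].
    apply (is_derive_comp T Ropp z (- epow c q (- z)) (- 1)); [apply Hd|].
    auto_derive; [trivial|ring]. }
  assert (E : forall a b, a < b -> T (- b) + T b = T (- a) + T a).
  { intros a b Hab.
    destruct (is_derive_mvt _ (fun _ => 0) a b Hab (fun z _ => D z)) as [z [_ E]]. lra. }
  destruct (Rtotal_order 0 y) as [H|[<-|H]].
  - specialize (E 0 y H). rewrite Ropp_0 in E. lra.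
  - rewrite Ropp_0. ring.
  - specialize (E y 0 H). rewrite Ropp_0 in E. lra.
Qed.

Lemma tail_lim_minus_infty : is_lim T m_infty (2 * T 0).
Proof.
  destruct HT as [Hd Hl]. apply (is_lim_spec T m_infty (2 * T 0)). intros eps.
  apply (is_lim_spec T p_infty 0) in Hl. destruct (Hl eps) as [M HM].
  exists (- M). intros y Hy. simpl.
  assert (X := tail_reflect (- y)). rewrite Ropp_involutive in X. rewrite X.
  replace (2 * T 0 - T (- y) - 2 * T 0) with (- (T (- y) - 0)) by ring.
  rewrite Rabs_Ropp. apply HM. lra.
Qed.

Lemma cdf_tail (k x : R) (f : R -> R) : k = / (2 * T 0) -> (forall t, f t = k * epow c q t) ->
  RInt_gen f (Rbar_locally m_infty) (at_point x) = 1 - T x / (2 * T 0).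
Proof.
  intros -> Hf. assert (P := tail_pos c q T 0 HT).
  apply (is_RInt_gen_unique (V := R_CompleteNormedModule)).
  replace (1 - T x / (2 * T 0)) with (- (/ (2 * T 0) * T x) - - (/ (2 * T 0) * (2 * T 0)))
    by (field; lra).
  assert (D : forall t, is_derive (fun t => - (/ (2 * T 0) * T t)) t (f t)).
  { intros t. rewrite Hf. destruct HT as [Hd _].
    replace (/ (2 * T 0) * epow c q t) with (- (/ (2 * T 0) * - epow c q t)) by ring.
    apply (is_derive_opp (V := R_NormedModule)). apply is_derive_scal, Hd. }
  apply (is_RInt_gen_antiderivative f (fun t => - (/ (2 * T 0) * T t))).
  - apply Rbar_locally_filter.
  - apply at_point_filter.
  - apply filter_forall. intros [a b]. simpl.
    apply (is_RInt_derive (V := R_CompleteNormedModule) (fun t => - (/ (2 * T 0) * T t)) f).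
    + intros t _. apply D.
    + intros t _. apply (continuous_ext (fun t => / (2 * T 0) * epow c q t)).
      { intros z. now rewrite Hf. }
      apply (continuous_scal_r (V := R_NormedModule)), epow_continuous.
  - assert (L := tail_lim_minus_infty).
    apply (is_lim_scal_l T (/ (2 * T 0)) m_infty) in L.
    apply is_lim_opp in L. exact L.
  - intros Q HQ. apply locally_singleton in HQ. exact HQ.
Qed.

End Cdf.

Lemma gaussian_param_derive (x : R) :
  is_derive (fun x => RInt (fun t => exp (- (/ 2 * x ^ 2 * (1 + t ^ 2))) / (1 + t ^ 2)) 0 1) x
    (RInt (fun t => - x * exp (- (/ 2 * x ^ 2 * (1 + t ^ 2)))) 0 1).
Proof.
  assert (Hpos : forall t, 1 + t ^ 2 <> 0) by (intros t; nra).
  assert (D : forall t u, is_derive (fun z => exp (- (/ 2 * z ^ 2 * (1 + t ^ 2))) / (1 + t ^ 2)) u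
     (- u * exp (- (/ 2 * u ^ 2 * (1 + t ^ 2))))).
  { intros t u. auto_derive; [trivial|]. simpl. field. assert (X := Hpos t); simpl in X; lra. }
  assert (X := is_derive_RInt_param
    (fun x t => exp (- (/ 2 * x ^ 2 * (1 + t ^ 2))) / (1 + t ^ 2)) 0 1 x).
  rewrite (RInt_ext (fun t => - x * exp (- (/ 2 * x ^ 2 * (1 + t ^ 2))))
    (fun t => Derive (fun u => exp (- (/ 2 * u ^ 2 * (1 + t ^ 2))) / (1 + t ^ 2)) x)).
  2:{ intros t _. symmetry. apply is_derive_unique, D. }
  apply X; clear X.
  - apply filter_forall. intros u t _. eexists. apply D.
  - intros t _. apply (continuity_2d_pt_ext (fun u v => - u * exp (- (/ 2 * (u * u) * (1 + v * v))))).
    { intros u v. symmetry. etransitivity; [apply is_derive_unique, (D v u)|]. simpl.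
      now rewrite !Rmult_1_r. }
    apply continuity_2d_pt_mult.
    + apply continuity_2d_pt_opp, continuity_2d_pt_id1.
    + apply (continuity_1d_2d_pt_comp exp).
      { apply derivable_continuous_pt, derivable_pt_exp. }
      apply continuity_2d_pt_opp. apply continuity_2d_pt_mult.
      * apply continuity_2d_pt_mult; [apply continuity_2d_pt_const|].
        apply continuity_2d_pt_mult; apply continuity_2d_pt_id1.
      * apply continuity_2d_pt_plus; [apply continuity_2d_pt_const|].
        apply continuity_2d_pt_mult; apply continuity_2d_pt_id2.
  - apply filter_forall. intros y. apply (ex_RInt_continuous (V := R_CompleteNormedModule)).
    intros t _. apply (ex_derive_continuous (fun t => exp (- (/ 2 * y ^ 2 * (1 + t ^ 2))) / (1 + t ^ 2))).
    auto_derive. apply Hpos.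
Qed.

(* (T 0 - T x)^2 + 2 int_0^1 exp (- x^2 (1 + t^2) / 2) / (1 + t^2) dt does not depend on x;
   compare its values at 0 and at infinity. *)
Lemma gaussian_integral (T : R -> R) : is_tail (/ 2) 2 T -> 2 * T 0 = sqrt (2 * PI).
Proof.
  intros HT. assert (HT' := HT). destruct HT' as [Hd Hl].
  set (G := fun x => RInt (fun t => exp (- (/ 2 * x ^ 2 * (1 + t ^ 2))) / (1 + t ^ 2)) 0 1).
  set (W := fun x => (T 0 - T x) ^ 2 + 2 * G x).
  (* The integrand is the t-derivative of exp (- x^2 / 2) T (x t), which is the substitution y = x
     t. *)
  assert (HG' : forall x, RInt (fun t => - x * exp (- (/ 2 * x ^ 2 * (1 + t ^ 2)))) 0 1
      = - exp (- (/ 2 * x ^ 2)) * (T 0 - T x)).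
  { intros x. apply (is_RInt_unique (V := R_CompleteNormedModule)).
    replace (- exp (- (/ 2 * x ^ 2)) * (T 0 - T x))
      with (exp (- (/ 2 * x ^ 2)) * T (x * 1) - exp (- (/ 2 * x ^ 2)) * T (x * 0)).
    2:{ rewrite Rmult_1_r, Rmult_0_r. ring. }
    apply (is_RInt_derive (V := R_CompleteNormedModule)
      (fun t => exp (- (/ 2 * x ^ 2)) * T (x * t))).
    - intros t _.
      replace (- x * exp (- (/ 2 * x ^ 2 * (1 + t ^ 2))))
        with (exp (- (/ 2 * x ^ 2)) * (x * - epow (/ 2) 2 (x * t))).
      2:{ unfold epow. replace (- (/ 2 * x ^ 2 * (1 + t ^ 2)))
            with (- (/ 2 * x ^ 2) + - (/ 2 * (x * t) ^ 2)) by ring. rewrite exp_plus. ring. }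
      apply is_derive_scal.
      apply (is_derive_comp T (fun t => x * t) t (- epow (/ 2) 2 (x * t)) x); [apply Hd|].
      auto_derive; [trivial|ring].
    - intros t _. apply (ex_derive_continuous (fun t => - x * exp (- (/ 2 * x ^ 2 * (1 + t ^ 2))))).
      auto_derive. trivial. }
  assert (DW : forall x, is_derive W x 0).
  { intros x.
    assert (E : 2 * (T 0 - T x) * (0 - - epow (/ 2) 2 x) +
       2 * (- exp (- (/ 2 * x ^ 2)) * (T 0 - T x)) = 0) by (unfold epow; ring).
    rewrite <- E. clear E. unfold W.
    apply (is_derive_plus (V := R_NormedModule)).
    - replace (2 * (T 0 - T x) * (0 - - epow (/ 2) 2 x))
        with ((0 - - epow (/ 2) 2 x) * (2 * (T 0 - T x))) by ring.
      apply (is_derive_comp (fun y => y ^ 2) (fun x => T 0 - T x) x (2 * (T 0 - T x))).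
      + auto_derive; [trivial|]. simpl. ring.
      + apply (is_derive_minus (V := R_NormedModule)); [|apply Hd].
        apply (is_derive_const (V := R_NormedModule)).
    - apply is_derive_scal. rewrite <- HG'. apply gaussian_param_derive. }
  assert (CW : forall x, 0 < x -> W x = W 0).
  { intros x Hx. destruct (is_derive_mvt W (fun _ => 0) 0 x Hx (fun z _ => DW z)) as [z [_ E]]. lra. }
  assert (HW0 : W 0 = PI / 2).
  { unfold W. rewrite Rminus_diag. unfold G.
    rewrite (RInt_ext _ (fun t => / (1 + t ^ 2))).
    2:{ intros t _. replace (- (/ 2 * 0 ^ 2 * (1 + t ^ 2))) with 0 by ring. rewrite exp_0.
        unfold Rdiv. now rewrite Rmult_1_l. }
    rewrite (is_RInt_unique (V := R_CompleteNormedModule) _ 0 1 (atan 1 - atan 0)).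
    { rewrite atan_1, atan_0. field. }
    apply (is_RInt_derive (V := R_CompleteNormedModule) atan (fun t => / (1 + t ^ 2))).
    - intros t _. auto_derive; [trivial|]. simpl. field. nra.
    - intros t _. apply (ex_derive_continuous (fun t => / (1 + t ^ 2))). auto_derive. nra. }
  assert (GB : forall x, 0 <= G x <= epow (/ 2) 2 x).
  { intros x. assert (EX : ex_RInt (fun t => exp (- (/ 2 * x ^ 2 * (1 + t ^ 2))) / (1 + t ^ 2)) 0 1).
    { apply (ex_RInt_continuous (V := R_CompleteNormedModule)). intros t _.
      apply (ex_derive_continuous (fun t => exp (- (/ 2 * x ^ 2 * (1 + t ^ 2))) / (1 + t ^ 2))).
      auto_derive. nra. }
    split.
    - apply RInt_ge_0; [lra|exact EX|]. intros t _. apply Rdiv_le_0_compat; [left; apply exp_pos|nra].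
    - replace (epow (/ 2) 2 x) with (RInt (fun _ => epow (/ 2) 2 x) 0 1).
      2:{ rewrite (RInt_const (V := R_CompleteNormedModule)). unfold scal; simpl. unfold mult; simpl. ring. }
      apply RInt_le; [lra|exact EX|apply (ex_RInt_const (V := R_NormedModule))|].
      intros t _. unfold Rdiv, epow.
      assert (I1 : / (1 + t ^ 2) <= 1).
      { rewrite <- Rinv_1 at 2. apply Rinv_le_contravar; [lra|nra]. }
      assert (I0 : 0 < / (1 + t ^ 2)) by (apply Rinv_0_lt_compat; nra).
      assert (E : exp (- (/ 2 * x ^ 2 * (1 + t ^ 2))) <= exp (- (/ 2 * x ^ 2))).
      { apply exp_le. assert (0 <= x ^ 2 * t ^ 2) by (apply Rmult_le_pos; apply pow2_ge_0). lra. }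
      assert (P := exp_pos (- (/ 2 * x ^ 2 * (1 + t ^ 2)))). nra. }
  assert (LW : is_lim W p_infty ((T 0 - 0) ^ 2 + 2 * 0)).
  { assert (LG : is_lim G p_infty 0).
    { apply (is_lim_le_le_loc (fun _ => 0) (epow (/ 2) 2)).
      - exists 0. intros x _. apply GB.
      - apply is_lim_const.
      - apply is_lim_epow; [lra|lia]. }
    unfold W. apply (is_lim_plus' (fun x => (T 0 - T x) ^ 2) (fun x => 2 * G x)).
    - assert (L0 : is_lim (fun x => T 0 - T x) p_infty (T 0 - 0)).
      { apply is_lim_minus'; [apply is_lim_const|exact Hl]. }
      replace ((T 0 - 0) ^ 2) with ((T 0 - 0) * (T 0 - 0)) by ring.
      apply (is_lim_ext (fun x => (T 0 - T x) * (T 0 - T x))); [intros x; ring|].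
      exact (is_lim_mult _ _ p_infty (T 0 - 0) (T 0 - 0) L0 L0 I).
    - apply (is_lim_scal_l G 2 p_infty 0 LG). }
  assert (LC : is_lim W p_infty (PI / 2)).
  { apply (is_lim_ext_loc (fun _ => PI / 2)); [|apply is_lim_const].
    exists 0. intros x Hx. now rewrite CW. }
  apply is_lim_unique in LW. apply is_lim_unique in LC. rewrite LC in LW.
  assert (E : PI / 2 = (T 0 - 0) ^ 2 + 2 * 0) by congruence.
  assert (P := tail_pos _ _ T 0 HT).
  symmetry. apply sqrt_lem_1; [assert (Q := PI_RGT_0); lra|lra|]. nra.
Qed.

Lemma Rpower_quarter_pow4 (y : R) : 0 < y -> Rpower y (1 / 4) ^ 4 = y.
Proof.
  intros Hy. rewrite <- Rpower_pow by apply exp_pos. rewrite Rpower_mult.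
  replace (1 / 4 * INR 4) with 1 by (simpl; field). now apply Rpower_1.
Qed.

Lemma pow4_Rpower_quarter (y : R) : 0 < y -> Rpower (y ^ 4) (1 / 4) = y.
Proof.
  intros Hy. rewrite <- Rpower_pow by exact Hy. rewrite Rpower_mult.
  replace (INR 4 * (1 / 4)) with 1 by (simpl; field). now apply Rpower_1.
Qed.

(* Substitution t = a y^4 in the integral defining Gamma (1/4). *)
Lemma Gamma_quarter (a : R) (T : R -> R) : 0 < a -> is_tail a 4 T ->
  Gamma_fun (1 / 4) = 4 * Rpower a (1 / 4) * T 0.
Proof.
  intros Ha [Hd Hl]. unfold Gamma_fun.
  apply (is_RInt_gen_unique (V := R_CompleteNormedModule)).
  set (k := 4 * Rpower a (1 / 4)).
  set (y := fun t => Rpower (t / a) (1 / 4)).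
  set (F := fun t => - (k * T (y t))).
  replace (k * T 0) with (- (k * 0) - - (k * T 0)) by ring.
  assert (DF : forall t, 0 < t -> is_derive F t (Rpower t (1 / 4 - 1) * exp (- t))).
  { intros t Ht. assert (Hta : 0 < t / a) by now apply Rdiv_lt_0_compat.
    assert (Dy : is_derive y t (y t / (4 * t))).
    { unfold y, Rpower. auto_derive; [repeat split; try lra; exact Hta|].
      change (t * / a) with (t / a). field. lra. }
    replace (Rpower t (1 / 4 - 1) * exp (- t)) with (- (k * (y t / (4 * t) * - epow a 4 (y t)))).
    - apply (is_derive_opp (V := R_NormedModule)), is_derive_scal.
      apply (is_derive_comp T y t (- epow a 4 (y t)) (y t / (4 * t))); [apply Hd|exact Dy].
    - unfold epow, y. rewrite Rpower_quarter_pow4 by exact Hta.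
      replace (- (a * (t / a))) with (- t) by (field; lra).
      assert (E : Rpower t (1 / 4 - 1) = Rpower a (1 / 4) * Rpower (t / a) (1 / 4) / t).
      { rewrite Rpower_mult_distr by assumption.
        replace (a * (t / a)) with t by (field; lra).
        unfold Rminus. rewrite Rpower_plus, Rpower_Ropp, Rpower_1 by exact Ht. reflexivity. }
      rewrite E. unfold k. field. lra. }
  apply (is_RInt_gen_antiderivative _ F).
  - apply at_right_proper_filter.
  - apply Rbar_locally_filter.
  - apply (Filter_prod _ _ _ (fun t => 0 < t) (fun t => 0 < t)).
    + exists (mkposreal 1 Rlt_0_1). intros t _ Ht. exact Ht.
    + exists 0. intros t Ht. exact Ht.
    + intros u v Hu Hv. simpl.
      assert (Hmin : 0 < Rmin u v) by now apply Rmin_pos.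
      apply (is_RInt_derive (V := R_CompleteNormedModule) F).
      * intros t Ht. apply DF. lra.
      * intros t Ht.
        apply (ex_derive_continuous (fun t => Rpower t (1 / 4 - 1) * exp (- t))).
        unfold Rpower. auto_derive. lra.
  - unfold F. apply (filterlim_comp _ _ _ y (fun z => - (k * T z)) _ (locally 0)).
    + apply filterlim_locally. intros eps. assert (He := cond_pos eps).
      assert (Hd0 : 0 < a * eps ^ 4) by (apply Rmult_lt_0_compat; [exact Ha|now apply pow_lt]).
      exists (mkposreal _ Hd0). intros t Ht Ht0.
      change (Rabs (t - 0) < a * eps ^ 4) in Ht. rewrite Rminus_0_r, Rabs_pos_eq in Ht by lra.
      change (Rabs (y t - 0) < eps). rewrite Rminus_0_r, Rabs_pos_eq by (left; apply exp_pos).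
      rewrite <- (pow4_Rpower_quarter eps He). unfold y.
      apply Rlt_Rpower_l; [lra|]. split; [now apply Rdiv_lt_0_compat|].
      apply (Rmult_lt_reg_l a); [exact Ha|].
      rewrite (Rmult_comm a (t / a)). unfold Rdiv. rewrite Rmult_assoc, Rinv_l, Rmult_1_r by lra.
      lra.
    + apply (ex_derive_continuous (fun z => - (k * T z)) 0).
      exists (- (k * - epow a 4 0)).
      apply (is_derive_opp (V := R_NormedModule)), is_derive_scal, Hd.
  - assert (Ly : is_lim y p_infty p_infty).
    { apply (is_lim_spec y p_infty p_infty). intros M.
      set (M1 := Rmax M 1). assert (H1 := Rmax_r M 1). assert (H2 := Rmax_l M 1).
      fold M1 in H1, H2.
      exists (a * M1 ^ 4). intros t Ht.
      assert (HM1 : 0 < M1 ^ 4) by (apply pow_lt; lra).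
      apply Rle_lt_trans with M1; [exact H2|].
      rewrite <- (pow4_Rpower_quarter M1 ltac:(lra)). unfold y.
      apply Rlt_Rpower_l; [lra|]. split; [exact HM1|].
      apply (Rmult_lt_reg_l a); [exact Ha|].
      replace (a * (t / a)) with t by (field; lra). exact Ht. }
    assert (L : is_lim (fun t => T (y t)) p_infty 0).
    { apply (is_lim_comp T y p_infty 0 p_infty Hl Ly). exists 0. intros t _. discriminate. }
    apply (is_lim_scal_l _ k p_infty) in L. apply is_lim_opp in L. exact L.
Qed.

Lemma Phi_tail (T : R -> R) (x : R) : is_tail (/ 2) 2 T -> 1 - Phi x = T x / (2 * T 0).
Proof.
  intros HT. unfold Phi. rewrite (cdf_tail (/ 2) 2 T ltac:(now exists 1%nat) HT (/ (2 * T 0))).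
  - ring.
  - reflexivity.
  - intros t. rewrite <- (gaussian_integral T HT). unfold epow, Rdiv.
    rewrite Rmult_comm. do 2 f_equal. ring.
Qed.

Lemma special_cdf_tail (H4 : R) (T : R -> R) (x : R) : H4 < 0 -> is_tail (- H4 / 24) 4 T ->
  1 - special_cdf H4 x = T x / (2 * T 0).
Proof.
  intros HH HT. unfold special_cdf.
  assert (Ha : 0 < - H4 / 24) by lra. assert (P := tail_pos _ _ T 0 HT).
  rewrite (cdf_tail (- H4 / 24) 4 T ltac:(now exists 2%nat) HT (/ (2 * T 0))).
  - ring.
  - reflexivity.
  - intros t. unfold special_density. rewrite (Gamma_quarter _ T Ha HT).
    assert (Pa : 0 < Rpower (- H4 / 24) (1 / 4)) by apply exp_pos.
    replace (exp (H4 / 24 * t ^ 4)) with (epow (- H4 / 24) 4 t).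
    + field. lra.
    + unfold epow. f_equal. field.
Qed.

(** * Conditional probabilities *)

Lemma restrict_or (P Q S : Prop) (w : R) : (S <-> P \/ Q) -> ~ (P /\ Q) ->
  restrict S w = restrict P w + restrict Q w.
Proof.
  intros H1 H2. unfold restrict.
  destruct (excluded_middle_informative P), (excluded_middle_informative Q),
    (excluded_middle_informative S); try tauto; lra.
Qed.

Lemma lsum_plus {A : Type} (f g : A -> R) (l : list A) :
  lsum (fun a => f a + g a) l = lsum f l + lsum g l.
Proof. induction l as [|a l IH]; simpl; [ring|]. rewrite IH; ring. Qed.

(** The common scale nu cancels in the quotient. Numerator and denominator have relative errors
    adding up to at most 2 K (1 + y) e, and division by a quantity of at least 1/2 doubles this. *)
Lemma relative_error (nu a D1 D2 T0 Tx K e y : R) :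
  0 < nu -> 0 < T0 -> 0 < Tx -> 0 <= K -> 0 < e -> 0 <= y -> K * e <= / 2 ->
  Rabs (nu * a - Tx) <= K * (1 + y) * e * Tx ->
  Rabs (nu * D1 - T0) <= K * e * T0 -> Rabs (nu * D2 - T0) <= K * e * T0 ->
  Rabs (a / (D1 + D2) / (Tx / (2 * T0)) - 1) <= 4 * K * (1 + y) * e.
Proof.
  intros Hnu HT0 HTx HK He Hy HKe Ha H1 H2.
  apply Rabs_le_between in Ha, H1, H2.
  set (al := nu * a / Tx - 1). set (de := nu * (D1 + D2) / (2 * T0) - 1).
  assert (Ea : nu * a = Tx * (1 + al)) by (unfold al; field; lra).
  assert (Ed : nu * (D1 + D2) = 2 * T0 * (1 + de)) by (unfold de; field; lra).
  assert (Hal : - (K * (1 + y) * e) <= al <= K * (1 + y) * e).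
  { split; apply (Rmult_le_reg_r Tx); lra. }
  assert (Hde : - (K * e) <= de <= K * e).
  { split; apply (Rmult_le_reg_r T0); lra. }
  assert (HD : D1 + D2 <> 0).
  { intros E. rewrite E, Rmult_0_r in Ed. nra. }
  replace (a / (D1 + D2) / (Tx / (2 * T0)) - 1) with ((al - de) / (1 + de)).
  2:{ replace a with (Tx * (1 + al) / nu) by (rewrite <- Ea; field; lra).
      replace (D1 + D2) with (2 * T0 * (1 + de) / nu) by (rewrite <- Ed; field; lra).
      field. lra. }
  unfold Rdiv. rewrite Rabs_mult, Rabs_inv, (Rabs_pos_eq (1 + de)) by lra.
  assert (HI : / (1 + de) <= 2).
  { rewrite <- (Rinv_inv 2). apply Rinv_le_contravar; lra. }
  assert (HKey : 0 <= K * y * e) by (apply Rmult_le_pos; [now apply Rmult_le_pos|lra]).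
  assert (HA : Rabs (al - de) <= 2 * K * (1 + y) * e) by (apply Rabs_le; lra).
  apply Rle_trans with (2 * K * (1 + y) * e * 2); [|lra].
  apply Rmult_le_compat; [apply Rabs_pos|left; apply Rinv_0_lt_compat; lra|exact HA|exact HI].
Qed.

Lemma partition_function_pos (beta h : R) (p N : nat) : 0 < lsum (cw_weight beta h p N) (configs N).
Proof.
  destruct (configs N) as [|X l] eqn:E.
  - exfalso. assert (L := configs_binomial N (fun _ => 1)). rewrite E in L.
    assert (B : 1 <= sum_f_R0 (fun j => Binomial.C N j * 1) N).
    { rewrite <- (C_n_0 N), <- (Rmult_1_r (Binomial.C N 0)) at 1.
      apply (sum_term_le (fun j => Binomial.C N j * 1)); [|lia].
      intros i. assert (P := binomial_nonneg N i). lra. }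
    simpl in L. lra.
  - simpl. assert (0 <= lsum (cw_weight beta h p N) l)
      by (apply lsum_nonneg; intros; left; apply exp_pos).
    assert (0 < cw_weight beta h p N X) by apply exp_pos. lra.
Qed.

Section TwoSided.

Variables (beta h : R) (p : nat) (c s m : R) (r : nat) (T : R -> R) (A : R -> Prop).
Hypotheses (Hp : (3 <= p)%nat) (Hbeta : 0 < beta) (Hh : 0 < h).
Hypotheses (Hc : 0 < c) (Hs : 0 < s) (Hr : (1 <= r)%nat) (Hodd : Nat.Odd r)
  (HT : is_tail c (S r) T) (HG : is_global_max beta h p m).
Hypothesis HA : is_nbhd A m.
Hypothesis HAcl : forall m', is_global_max beta h p m' -> m' <> m -> ~ in_closure A m'.
Variables (K0 d0 : R).
Hypotheses (HK0 : 0 < K0) (Hd0 : 0 < d0).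
Hypothesis Hexp : forall u, Rabs (u - m) <= d0 ->
  Rabs (Hfun beta h p u - Hfun beta h p m + c * ((u - m) / s) ^ S r)
  <= K0 * Rabs (u - m) ^ S (S r).

Let g (u : R) : R := beta * u ^ p + h * u.
Let side (sg th : R) (N : nat) (B : R -> Prop) : R :=
  lsum (fun X => restrict (A (magn X / INR N) /\ B (sg * ((magn X / INR N - m) / s * th ^ S (S r))))
                          (exp (INR N * g (magn X / INR N)))) (configs N).
Let nu (N : nat) (th : R) : R :=
  spacing r s N th * exp (- (log_prefactor m N + INR N * Hfun beta h p m)).

Lemma two_sided_pow_even (x : R) : (- x) ^ S r = x ^ S r.
Proof.
  destruct Hodd as [k Hk]. replace (S r) with (2 * (k + 1))%nat by lia.
  rewrite !pow_mult. f_equal. ring.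
Qed.

(** [laplace_tail_aux] sees only points to the right of its centre. For sg = -1 it is applied at - m
    to the function u -> g (- u); the entropy is even and [S r] is even, so the expansion keeps its
    form. *)
Lemma one_sided (sg : R) : sg = 1 \/ sg = -1 ->
  exists K th0, 1 <= th0 /\ forall (N : nat) (th : R),
  th0 <= th -> th ^ (S r * S (S r)) = INR N ->
  forall x, 0 <= x <= th -> forall B : R -> Prop,
  (forall v, x < v -> B v) -> (forall v, B v -> x <= v) ->
  Rabs (nu N th * side sg th N B - T x) <= K * (1 + x ^ S (S r)) / th ^ S (S r) * T x.
Proof.
  intros Hsg.
  assert (Hm := max_interior beta h p Hp Hbeta Hh m HG).
  destruct HA as [ea [Hea HAe]].
  set (d1 := Rmin d0 (ea / 2)).
  assert (Hd1 : 0 < d1) by (apply Rmin_pos; lra).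
  assert (D1 := Rmin_l d0 (ea / 2)). assert (D2 := Rmin_r d0 (ea / 2)). fold d1 in D1, D2.
  assert (Hsg2 : sg * sg = 1) by (destruct Hsg as [-> | ->]; ring).
  assert (HHs : forall u, g (sg * u) - Ient u = Hfun beta h p (sg * u)).
  { intros u. unfold Hfun, g. f_equal. destruct Hsg as [-> | ->]; [now rewrite Rmult_1_l|].
    replace (-1 * u) with (- u) by ring. now rewrite Ient_even. }
  assert (Hsm : sg * (sg * m) = m) by (rewrite <- Rmult_assoc, Hsg2; ring).
  assert (Hdist : forall u, Rabs (sg * u - m) = Rabs (u - sg * m)).
  { intros u. replace (sg * u - m) with (sg * (u - sg * m)).
    - rewrite Rabs_mult. replace (Rabs sg) with 1; [ring|].
      destruct Hsg as [-> | ->]; [now rewrite Rabs_R1|rewrite Rabs_left; lra].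
    - rewrite Rmult_minus_distr_l, Hsm. reflexivity. }
  destruct (laplace_tail_aux c r s (sg * m) (fun u => g (sg * u)) T Hc Hr Hs
    ltac:(destruct Hsg as [-> | ->]; lra) HT K0 d1 HK0 Hd1) with (A := fun u => A (sg * u))
    as [K [th0 [Hth0 HL]]].
  - intros u Hu. rewrite !HHs, Hsm.
    assert (Ha : Rabs (sg * u - m) = u - sg * m) by (rewrite Hdist, Rabs_pos_eq; lra).
    replace (((u - sg * m) / s) ^ S r) with (((sg * u - m) / s) ^ S r).
    + rewrite <- Ha. apply Hexp. rewrite Ha. lra.
    + destruct Hsg as [-> | ->]; [now rewrite !Rmult_1_l|].
      rewrite <- two_sided_pow_even. f_equal. field. lra.
  - intros u Hu. apply HAe. rewrite Hdist, Rabs_pos_eq; lra.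
  - intros d Hd. destruct (max_gap beta h p m A d HG Hd HAcl) as [eta [Heta Hg]].
    exists eta. split; [exact Heta|]. intros u HAu Hu. rewrite !HHs, Hsm.
    apply Hg; [exact HAu| |].
    + destruct Hsg as [-> | ->]; lra.
    + rewrite Hdist, Rabs_pos_eq; lra.
  - exists K, th0. split; [exact Hth0|]. intros N th Hth HN x Hx B HB1 HB2.
    specialize (HL N th Hth HN x Hx B HB1 HB2).
    rewrite HHs, Hsm in HL.
    replace (log_prefactor (sg * m) N) with (log_prefactor m N) in HL.
    2:{ unfold log_prefactor. replace ((sg * m) ^ 2) with (sg * sg * m ^ 2) by ring.
        now rewrite Hsg2, Rmult_1_l. }
    unfold nu. replace (side sg th N B) with
      (binomial_sum N (fun u => restrict (A (sg * u) /\ B ((u - sg * m) / s * th ^ S (S r)))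
                                         (exp (INR N * g (sg * u))))); [exact HL|].
    unfold side, binomial_sum, lattice. symmetry.
    rewrite <- (configs_binomial N (fun y => restrict
      (A (sg * (y / INR N)) /\ B ((y / INR N - sg * m) / s * th ^ S (S r)))
      (exp (INR N * g (sg * (y / INR N)))))).
    destruct Hsg as [-> | ->].
    + apply lsum_ext_in. intros X _. now rewrite !Rmult_1_l.
    + rewrite (configs_reflect N (fun y => restrict
        (A (-1 * (y / INR N)) /\ B ((y / INR N - -1 * m) / s * th ^ S (S r)))
        (exp (INR N * g (-1 * (y / INR N)))))).
      apply lsum_ext_in. intros X _.
      replace (-1 * (- magn X / INR N)) with (magn X / INR N) by (unfold Rdiv; ring).
      replace ((- magn X / INR N - -1 * m) / s * th ^ S (S r))
        with (-1 * ((magn X / INR N - m) / s * th ^ S (S r))) by (unfold Rdiv; ring).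
      reflexivity.
Qed.

Lemma cw_prob_restrict (N : nat) (E : list R -> Prop) : (1 <= N)%nat ->
  cw_prob beta h p N E =
  lsum (fun X => restrict (E X) (exp (INR N * g (magn X / INR N)))) (configs N)
  / lsum (cw_weight beta h p N) (configs N).
Proof.
  intros HN. unfold cw_prob. f_equal. apply lsum_ext_in. intros X HX.
  rewrite (cw_weight_magn beta h p N X) by (lia || assumption). reflexivity.
Qed.

(** The conditioning event is split into v >= 0 on the side sg and v > 0 on the opposite side, so
    that a lattice point at m is counted once; each half is T 0 up to the scale nu. *)
Lemma two_sided (k : nat) : exists K N0, forall N : nat, (N0 <= N)%nat -> (1 <= N)%nat ->
  forall th, 0 < th -> th ^ (S r * S (S r)) = INR N ->
  forall x, 0 <= x <= th -> forall E : list R -> Prop,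
  (forall X, E X <-> (-1) ^ k * ((magn X / INR N - m) / s * th ^ S (S r)) > x) ->
  Rabs (cw_cond_prob beta h p N E (fun X => A (magn X / INR N)) / (T x / (2 * T 0)) - 1)
  <= K * (1 + x ^ S (S r)) / th ^ S (S r).
Proof.
  set (sg := (-1) ^ k).
  assert (Hsg : sg = 1 \/ sg = -1).
  { unfold sg. induction k as [|k IH]; [now left|]. simpl. destruct IH as [-> | ->]; [right|left]; ring. }
  assert (Hsg' : - sg = 1 \/ - sg = -1) by lra.
  destruct (one_sided sg Hsg) as [K1 [t1 [Ht1 H1]]].
  destruct (one_sided (- sg) Hsg') as [K2 [t2 [Ht2 H2]]].
  set (K := Rabs K1 + Rabs K2).
  assert (HK : 0 <= K) by (assert (X1 := Rabs_pos K1); assert (X2 := Rabs_pos K2); unfold K; lra).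
  assert (HK1 : K1 <= K) by (assert (X1 := Rle_abs K1); assert (X2 := Rabs_pos K2); unfold K; lra).
  assert (HK2 : K2 <= K) by (assert (X1 := Rle_abs K2); assert (X2 := Rabs_pos K1); unfold K; lra).
  (* t1 and t2 are the thresholds of the two sides; 2 K makes K / th^(r+2) <= 1/2, as
     [relative_error] requires. *)
  set (t := t1 + t2 + 2 * K).
  assert (Ht : 0 < t) by (unfold t; lra).
  destruct (INR_unbounded (t ^ (S r * S (S r)))) as [N0 HN0].
  exists (4 * K), N0. intros N HN HN1 th Hth0 Eth x Hx E HE.
  assert (Hth : t < th).
  { apply Rnot_le_lt. intros Hle.
    assert (X1 : th ^ (S r * S (S r)) <= t ^ (S r * S (S r))) by (apply pow_incr; lra).
    apply le_INR in HN. lra. }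
  unfold t in Hth.
  assert (Hp1 : th <= th ^ S (S r)).
  { rewrite <- (pow_1 th) at 1. apply Rle_pow; [lra|lia]. }
  set (e := / th ^ S (S r)).
  assert (He : 0 < e) by (apply Rinv_0_lt_compat; lra).
  assert (HKe : K * e <= / 2).
  { apply (Rmult_le_reg_r (th ^ S (S r))); [lra|]. unfold e.
    rewrite Rmult_assoc, Rinv_l by lra. lra. }
  assert (P0 := tail_pos c (S r) T 0 HT). assert (Px := tail_pos c (S r) T x HT).
  assert (Hxp : 0 <= x ^ S (S r)) by (apply pow_le; lra).
  assert (HN0' : 0 < INR N) by (apply lt_0_INR; lia).
  assert (Hnu : 0 < nu N th).
  { apply Rmult_lt_0_compat; [|apply exp_pos]. apply Rdiv_lt_0_compat; [lra|].
    now apply Rmult_lt_0_compat. }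
  assert (A1 := H1 N th ltac:(lra) Eth x Hx (fun v => v > x) ltac:(intros; lra) ltac:(intros; lra)).
  assert (A2 := H1 N th ltac:(lra) Eth 0 ltac:(lra) (fun v => v >= 0)
    ltac:(intros; lra) ltac:(intros; lra)).
  assert (A3 := H2 N th ltac:(lra) Eth 0 ltac:(lra) (fun v => v > 0)
    ltac:(intros; lra) ltac:(intros; lra)).
  rewrite pow_i, Rplus_0_r, Rmult_1_r in A2, A3 by lia.
  unfold Rdiv in A1, A2, A3. fold e in A1, A2, A3.
  assert (R1 := relative_error (nu N th) (side sg th N (fun v => v > x))
    (side sg th N (fun v => v >= 0)) (side (- sg) th N (fun v => v > 0))
    (T 0) (T x) K e (x ^ S (S r)) Hnu P0 Px HK He Hxp HKe).
  change (4 * K * (1 + x ^ S (S r)) / th ^ S (S r)) with (4 * K * (1 + x ^ S (S r)) * e).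
  eapply Rle_trans; [|apply R1; clear R1].
  - right. do 3 f_equal.
    unfold cw_cond_prob. rewrite !cw_prob_restrict by exact HN1.
    assert (PZ := partition_function_pos beta h p N).
    set (Z := lsum (cw_weight beta h p N) (configs N)) in *.
    assert (EN : lsum (fun X => restrict (E X /\ A (magn X / INR N))
        (exp (INR N * g (magn X / INR N)))) (configs N) = side sg th N (fun v => v > x)).
    { apply lsum_ext_in. intros X _. apply restrict_iff. rewrite HE. fold sg. tauto. }
    assert (ED : lsum (fun X => restrict (A (magn X / INR N))
        (exp (INR N * g (magn X / INR N)))) (configs N)
        = side sg th N (fun v => v >= 0) + side (- sg) th N (fun v => v > 0)).
    { unfold side. rewrite <- lsum_plus. apply lsum_ext_in. intros X _.
      apply restrict_or.
      - destruct (Rlt_le_dec (sg * ((magn X / INR N - m) / s * th ^ S (S r))) 0) as [Hl|Hl];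
          split; try tauto; intros HAX.
        + right. split; [exact HAX|]. lra.
        + left. split; [exact HAX|]. lra.
      - intros [[_ Q1] [_ Q2]]. lra. }
    rewrite EN, ED. unfold Rdiv. rewrite Rinv_mult, Rinv_inv.
    field_simplify_eq; [ring|].
    assert (Hden : nu N th * (side sg th N (fun v => v >= 0) + side (- sg) th N (fun v => v > 0)) > 0).
    { apply Rabs_le_between in A2, A3.
      assert (K1 * e * T 0 <= / 2 * T 0) by (apply Rmult_le_compat_r; [lra|]; nra).
      assert (K2 * e * T 0 <= / 2 * T 0) by (apply Rmult_le_compat_r; [lra|]; nra).
      lra. }
    split; [|lra]. intros E0. rewrite E0, Rmult_0_r in Hden. lra.
  - eapply Rle_trans; [exact A1|]. apply Rmult_le_compat_r; [lra|].
    apply Rmult_le_compat_r; [lra|]. apply Rmult_le_compat_r; lra.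
  - eapply Rle_trans; [exact A2|]. apply Rmult_le_compat_r; [lra|]. apply Rmult_le_compat_r; lra.
  - eapply Rle_trans; [exact A3|]. apply Rmult_le_compat_r; [lra|]. apply Rmult_le_compat_r; lra.
Qed.

End TwoSided.

(** The unconditional cases are the conditional one with A the whole line; the condition is left as
    a beta-redex so that it matches [A (magn X / INR N)]. *)
Lemma cw_prob_cond_True (beta h : R) (p N : nat) (E : list R -> Prop) :
  cw_prob beta h p N E =
  cw_cond_prob beta h p N E (fun X => (fun _ : R => True) (magn X / INR N)).
Proof.
  unfold cw_cond_prob.
  assert (PZ := partition_function_pos beta h p N).
  replace (cw_prob beta h p N (fun _ => True)) with 1.
  - unfold Rdiv. rewrite Rinv_1, Rmult_1_r. unfold cw_prob. f_equal.
    apply lsum_ext_in. intros X _. apply (restrict_iff (E X) (E X /\ True)). tauto.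
  - unfold cw_prob.
    rewrite (lsum_ext_in _ (cw_weight beta h p N)) by (intros X _; now apply (restrict_true True)).
    symmetry. apply Rinv_r. lra.
Qed.

(** * The quadratic and the quartic case *)

Lemma Rpower_inv_pow (x : R) (n : nat) : 0 < x -> (1 <= n)%nat ->
  Rpower x (1 / INR n) ^ n = x.
Proof.
  intros Hx Hn. assert (0 < INR n) by (apply lt_0_INR; lia).
  rewrite <- Rpower_pow by apply exp_pos. rewrite Rpower_mult.
  replace (1 / INR n * INR n) with 1 by (field; lra). now apply Rpower_1.
Qed.

(** Regular and critical case together: r = 1, c = 1/2, s = 1 / sqrt (- H''(m)) and th = N^(1/6), so
    that sqrt N = th^3 and the limit law is the standard normal one. *)
Lemma nondegenerate_max (beta h : R) (p : nat) (m : R) (A : R -> Prop) (k : nat) :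
  (3 <= p)%nat -> 0 < beta -> 0 < h -> is_global_max beta h p m ->
  Hder beta h p 2 m < 0 -> is_nbhd A m ->
  (forall m', is_global_max beta h p m' -> m' <> m -> ~ in_closure A m') ->
  exists K N0, forall N : nat, (N0 <= N)%nat -> (1 <= N)%nat ->
  forall x, 0 <= x <= 1 * Rpower (INR N) (1 / 6) ->
  Rabs (cw_cond_prob beta h p N
          (fun X => (-1) ^ k * (magn X - INR N * m) / sqrt (- INR N / Hder beta h p 2 m) > x)
          (fun X => A (magn X / INR N)) / (1 - Phi x) - 1)
  <= K * (1 + x ^ 3) / sqrt (INR N).
Proof.
  intros Hp Hbeta Hh HG H2 HA Hcl.
  assert (Hm := max_interior beta h p Hp Hbeta Hh m HG).
  rewrite Hder_Hd in H2 |- * by (lia || lra).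
  set (H2m := Hd beta h p 2 m) in *.
  assert (Hsq : 0 < sqrt (- H2m)) by (apply sqrt_lt_R0; lra).
  destruct (tail_exists (/ 2) 2) as [T HT]; [lra|lia|].
  destruct (Hfun_taylor beta h p 2 m) as [K0 [d0 [HK0 [Hd0 [_ HTay]]]]]; [lia|lra| |].
  { intros j Hj. assert (j = 1)%nat as -> by lia. now apply max_critical. }
  destruct (two_sided beta h p (/ 2) (/ sqrt (- H2m)) m 1 T A Hp Hbeta Hh)
    with (K0 := K0) (d0 := d0) (k := k) as [K [N0 HKN]];
    try assumption; try lra; try lia.
  - now apply Rinv_0_lt_compat.
  - now exists 0%nat.
  - intros u Hu. specialize (HTay u Hu). fold H2m in HTay.
    replace (Hfun beta h p u - Hfun beta h p m + / 2 * ((u - m) / / sqrt (- H2m)) ^ 2)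
      with (Hfun beta h p u - Hfun beta h p m - H2m / INR (fact 2) * (u - m) ^ 2); [exact HTay|].
    unfold Rdiv at 2. rewrite Rinv_inv, Rpow_mult_distr.
    replace (sqrt (- H2m) ^ 2) with (- H2m) by (symmetry; apply pow2_sqrt; lra). simpl. field.
  - exists K, N0. intros N HN HN1 x Hx.
    assert (HN0 : 0 < INR N) by (apply lt_0_INR; lia).
    set (th := Rpower (INR N) (1 / 6)) in *.
    assert (E6 : th ^ 6 = INR N).
    { unfold th. replace 6 with (INR 6) by (simpl; ring). apply Rpower_inv_pow; [exact HN0|lia]. }
    assert (Hth : 0 < th) by apply exp_pos.
    assert (Hth3 : 0 < th ^ 3) by now apply pow_lt.
    assert (E3 : th ^ 3 = sqrt (INR N)).
    { symmetry. apply sqrt_lem_1; [lra|lra|]. rewrite <- E6. ring. }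
    rewrite (Phi_tail T x HT), <- E3.
    apply (HKN N HN HN1 th Hth E6 x); [lra|]. intros X.
    replace ((-1) ^ k * (magn X - INR N * m) / sqrt (- INR N / H2m)) with
      ((-1) ^ k * ((magn X / INR N - m) / / sqrt (- H2m) * th ^ 3)); [tauto|].
    replace (- INR N / H2m) with (INR N / - H2m) by (field; lra).
    rewrite sqrt_div by lra. rewrite <- E3, <- E6. field.
    repeat split; lra || now apply Rgt_not_eq.
Qed.

(** Here r = 3, s = 1, c = - H^(4)(m) / 24 and th = N^(1/20), so that N^(3/4) = th^15 and N^(1/4) =
    th^5. *)
Lemma degenerate_max (beta h : R) (p : nat) (m : R) (k : nat) :
  (3 <= p)%nat -> 0 < beta -> 0 < h -> is_global_max beta h p m ->
  (forall y, is_global_max beta h p y -> y = m) -> Hder beta h p 2 m = 0 ->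
  exists K N0, forall N : nat, (N0 <= N)%nat -> (1 <= N)%nat ->
  forall x, 0 <= x <= 1 * Rpower (INR N) (1 / 20) ->
  Rabs (cw_prob beta h p N
          (fun X => (-1) ^ k * (magn X - INR N * m) / Rpower (INR N) (3 / 4) > x)
        / (1 - special_cdf (Hder beta h p 4 m) x) - 1)
  <= K * (1 + x ^ 5) / Rpower (INR N) (1 / 4).
Proof.
  intros Hp Hbeta Hh HG Huniq H2.
  assert (Hm := max_interior beta h p Hp Hbeta Hh m HG).
  rewrite Hder_Hd in H2 by (lia || lra). rewrite Hder_Hd by (lia || lra).
  assert (H4 := max_degenerate_fourth beta h p Hp Hbeta Hh m HG H2).
  destruct (max_degenerate beta h p Hp Hbeta Hh m HG H2) as [H3 _].
  set (H4m := Hd beta h p 4 m) in *.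
  destruct (tail_exists (- H4m / 24) 4) as [T HT]; [lra|lia|].
  destruct (Hfun_taylor beta h p 4 m) as [K0 [d0 [HK0 [Hd0 [_ HTay]]]]]; [lia|lra| |].
  { intros j Hj. assert (j = 1 \/ j = 2 \/ j = 3)%nat as [-> | [-> | ->]] by lia;
      [now apply max_critical|exact H2|exact H3]. }
  destruct (two_sided beta h p (- H4m / 24) 1 m 3 T (fun _ => True) Hp Hbeta Hh)
    with (K0 := K0) (d0 := d0) (k := k) as [K [N0 HKN]];
    try assumption; try lra; try lia.
  - now exists 1%nat.
  - exists 1. split; [lra|trivial].
  - intros m' Hm' Hne. exfalso. apply Hne. now apply Huniq.
  - intros u Hu. specialize (HTay u Hu). fold H4m in HTay.
    replace (Hfun beta h p u - Hfun beta h p m + - H4m / 24 * ((u - m) / 1) ^ 4)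
      with (Hfun beta h p u - Hfun beta h p m - H4m / INR (fact 4) * (u - m) ^ 4); [exact HTay|].
    simpl. field.
  - exists K, N0. intros N HN HN1 x Hx.
    assert (HN0 : 0 < INR N) by (apply lt_0_INR; lia).
    set (th := Rpower (INR N) (1 / 20)) in *.
    assert (E20 : th ^ 20 = INR N).
    { unfold th. replace 20 with (INR 20) by (simpl; ring). apply Rpower_inv_pow; [exact HN0|lia]. }
    assert (Hth : 0 < th) by apply exp_pos.
    assert (E5 : th ^ 5 = Rpower (INR N) (1 / 4)).
    { unfold th. rewrite <- Rpower_pow by apply exp_pos. rewrite Rpower_mult. f_equal.
      simpl. field. }
    assert (E15 : th ^ 15 = Rpower (INR N) (3 / 4)).
    { unfold th. rewrite <- Rpower_pow by apply exp_pos. rewrite Rpower_mult. f_equal.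
      simpl. field. }
    rewrite (special_cdf_tail H4m T x H4 HT), <- E5, cw_prob_cond_True.
    apply (HKN N HN HN1 th Hth E20 x); [lra|]. intros X.
    rewrite <- E15.
    replace ((-1) ^ k * (magn X - INR N * m) / th ^ 15) with
      ((-1) ^ k * ((magn X / INR N - m) / 1 * th ^ 5)); [tauto|].
    rewrite <- E20. field. lra.
Qed.

Theorem theorem3p1 (p : nat) (beta h : R) :
  (3 <= p)%nat -> 0 < beta -> 0 < h ->
  exists C, 0 < C /\
  (* 1. p-regular case *)
  (p_regular beta h p ->
   forall m, is_global_max beta h p m ->
   forall r : nat, (r <= 1)%nat ->
   exists K N0, forall N : nat, (N0 <= N)%nat -> (1 <= N)%nat ->
   forall x, 0 <= x <= C * Rpower (INR N) (1 / 6) ->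
     Rabs (cw_prob beta h p N
             (fun X => (-1) ^ r * (magn X - INR N * m)
                       / sqrt (- INR N / Hder beta h p 2 m) > x)
           / (1 - Phi x) - 1)
     <= K * (1 + x ^ 3) / sqrt (INR N)) /\
  (* 2. p-critical case *)
  (p_critical beta h p ->
   forall m, is_global_max beta h p m ->
   forall A : R -> Prop, is_nbhd A m ->
   (forall m', is_global_max beta h p m' -> m' <> m -> ~ in_closure A m') ->
   forall r : nat, (r <= 1)%nat ->
   exists K N0, forall N : nat, (N0 <= N)%nat -> (1 <= N)%nat ->
   forall x, 0 <= x <= C * Rpower (INR N) (1 / 6) ->
     Rabs (cw_cond_prob beta h p N
             (fun X => (-1) ^ r * (magn X - INR N * m)
                       / sqrt (- INR N / Hder beta h p 2 m) > x)
             (fun X => A (magn X / INR N))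
           / (1 - Phi x) - 1)
     <= K * (1 + x ^ 3) / sqrt (INR N)) /\
  (* 3. p-special case *)
  (p_special beta h p ->
   forall m, is_global_max beta h p m ->
   forall r : nat, (r <= 1)%nat ->
   exists K N0, forall N : nat, (N0 <= N)%nat -> (1 <= N)%nat ->
   forall x, 0 <= x <= C * Rpower (INR N) (1 / 20) ->
     Rabs (cw_prob beta h p N
             (fun X => (-1) ^ r * (magn X - INR N * m)
                       / Rpower (INR N) (3 / 4) > x)
           / (1 - special_cdf (Hder beta h p 4 m) x) - 1)
     <= K * (1 + x ^ 5) / Rpower (INR N) (1 / 4)).
Proof.
  (* C = 1 works for all parameters, because [two_sided] reaches up to x = th. *)
  intros Hp Hbeta Hh. exists 1. split; [lra|]. split; [|split].
  - intros [m0 [Huniq [_ H2]]] m HG r _.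
    assert (m = m0) as -> by now apply Huniq.
    destruct (nondegenerate_max beta h p m0 (fun _ => True) r Hp Hbeta Hh HG H2) as [K [N0 HK]].
    + exists 1. split; [lra|trivial].
    + intros m' Hm' Hne. exfalso. apply Hne. now apply Huniq.
    + exists K, N0. intros N HN HN1 x Hx. rewrite cw_prob_cond_True. now apply HK.
  - intros Hcrit m HG A HA Hcl r _.
    apply nondegenerate_max; try assumption.
    assert (Hm := max_interior beta h p Hp Hbeta Hh m HG).
    rewrite Hder_Hd by (lia || lra). now apply critical_max_nondegenerate.
  - intros [m0 [Huniq [_ H2]]] m HG r _.
    assert (m = m0) as -> by now apply Huniq.
    apply degenerate_max; try assumption. intros y Hy. now apply Huniq.
Qed.
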